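(* Let $v=(v_1,\dots,v_N)\in\mathbb Z^N_1$ be a prime rotational vector, let $N_0=\#\{i: 1\le i\le N,\ v_i=0\}$, and let $M_0>0$. If $1\le N_0\le N-1$, then there exist masses $m_j>0$, lengths $\ell_j>0$ ($1\le j\le N$) and constants $0<T_1<T_2$ such that for each $T\in[T_1,T_2]$ and each $f\in L^2(\mathbb R/(T\mathbb Z),\mathbb R^N)$ with $\int_0^Tf(t)\,dt=0$ and $|f(t)|\le M_0$ for all $t\in\mathbb R$, the set $\mathcal P(v,T)$ of distinct rotational solutions, with rotational vector $v$ and period $T$, of the forced $N$-pendulum system $\frac{d}{dt}L_p(q,\dot q)-L_q(q,\dot q)=f(t)$ with these masses and lengths satisfies: (i) If $f\not\equiv0$, then $\#\mathcal P(v,T)\ge (N-N_0+1)2^{N_0}$. (ii) If $f\equiv0$, then $\#\mathcal P(v,T)\ge (N-N_0)2^{N_0}$.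
   Context: Lagrangian of the planar $N$-pendulum: for constants $m_i,\ell_i>0$ and $g>0$ (gravity), put $\alpha_j=\sum_{s=j}^N m_s$, $\beta_j=\alpha_j\ell_j$, and for $q,p\in\mathbb R^N$ $$L(q,p)=\tfrac12 A(q)p\cdot p+V(q),\qquad V(q)=g\sum_{j=1}^N\beta_j\cos q_j,$$ where $A(q)$ is the symmetric matrix determined by $$A(q)p\cdot p=\sum_{i=1}^N\alpha_i\ell_i^2p_i^2+\sum_{1\le i<j\le N}2\alpha_j\ell_i\ell_j\cos(q_i-q_j)p_ip_j .$$ Prime vectors: $v\in\mathbb Z^N\setminus\{0\}$ is prime if one of its coordinates equals $1$ while all others are $0$, or two of its coordinates are relatively prime. $\mathbb Z^N_1$ is the set of all prime vectors in $\mathbb Z^N$. Rotational solutions with rotational vector $v$ and period $T$: solutions $q:\mathbb R\to\mathbb R^N$ of $\frac{d}{dt}L_p(q,\dot q)-L_q(q,\dot q)=f(t)$ with $q(t+T)-q(t)=2\pi v$ for all $t\in\mathbb R$. Distinct solutions: solutions differing by an element of $2\pi\mathbb Z^N$ are identified. If $f\equiv0$, solutions that are time translates $q(\cdot)\mapsto q(\cdot+\theta)$ of one another are identified as well. *)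

(* Defs.v *)
From HB Require Import structures.
From mathcomp Require Export all_boot all_order all_algebra.
From mathcomp Require Export all_classical all_reals all_analysis.
From mathcomp Require Import ring.

Set Implicit Arguments.
Unset Strict Implicit.
Unset Printing Implicit Defensive.

Export Order.TTheory GRing.Theory Num.Theory numFieldNormedType.Exports.

Local Open Scope classical_set_scope.
Local Open Scope ring_scope.

(* Indices run over 0, ..., N-1 instead of 1, ..., N. *)

Section Pendulum.
Context {R : realType} {N : nat}.
Implicit Types (m l : 'I_N -> R) (g : R) (q p x : 'rV[R]_N).

Definition alpha m (j : 'I_N) : R := \sum_(s < N | (j <= s)%N) m s.

Definition beta m l (j : 'I_N) : R := alpha m j * l j.

Definition inertia m l q : 'M[R]_N :=
  \matrix_(i, j) (alpha m (if (i <= j)%N then j else i) * l i * l j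
                  * cos (q 0 i - q 0 j)).

Definition dot x p : R := \sum_(i < N) x 0 i * p 0 i.

(* The norm of the normed module 'rV[R]_N is the sup norm. *)
Definition eucl_norm x : R := Num.sqrt (dot x x).

(* p is a row vector and A(q) is symmetric: A(q) p is p *m A(q). *)
Definition kinetic m l q p : R := dot (p *m inertia m l q) p.

Definition potential m l g q : R := g * \sum_(j < N) beta m l j * cos (q 0 j).

Definition lagrangian m l g q p : R :=
  2^-1 * kinetic m l q p + potential m l g q.

Definition Lq m l g q p (i : 'I_N) : R :=
  'D_(delta_mx 0 i) (fun x : 'rV[R]_N => lagrangian m l g x p) q.

Definition Lp m l g q p (i : 'I_N) : R :=
  'D_(delta_mx 0 i) (fun x : 'rV[R]_N => lagrangian m l g q x) p.

Lemma inertia_sym m l q : (inertia m l q)^T = inertia m l q.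
Proof.
apply/matrixP => i j; rewrite !mxE -cosN opprB.
have -> : (if (j <= i)%N then i else j) = (if (i <= j)%N then j else i).
  by case: ltngtP => // /val_inj.
by rewrite (mulrAC _ (l j)).
Qed.

Lemma kineticE m l q p : kinetic m l q p =
  \sum_(i < N) alpha m i * l i ^+ 2 * p 0 i ^+ 2 +
  \sum_(i < N) \sum_(j < N | (i < j)%N)
    2 * alpha m j * l i * l j * cos (q 0 i - q 0 j) * p 0 i * p 0 j.
Proof.
pose F i j := p 0 i * inertia m l q i j * p 0 j.
have FC i j : F i j = F j i.
  by rewrite /F -{1}inertia_sym mxE; ring.
have -> : kinetic m l q p = \sum_(j < N) \sum_(i < N) F i j.
  by apply: eq_bigr => j _; rewrite mxE mulr_suml.
have -> : \sum_(j < N) \sum_(i < N) F i j = \sum_(j < N) F j j +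
    (\sum_(j < N) \sum_(i < N | (i < j)%N) F i j +
     \sum_(j < N) \sum_(i < N | (j < i)%N) F i j).
  rewrite -!big_split; apply: eq_bigr => j _ /=.
  rewrite (bigD1 j) //= (bigID (fun i : 'I_N => (i < j)%N)) /=.
  congr (_ + (_ + _)); apply: eq_bigl => i;
    rewrite -(inj_eq val_inj) /=; case: ltngtP => //.
congr (_ + _).
  by apply: eq_bigr => i _; rewrite /F mxE leqnn subrr cos0; ring.
have -> : \sum_(j < N) \sum_(i < N | (i < j)%N) F i j =
          \sum_(j < N) \sum_(i < N | (j < i)%N) F i j.
  rewrite (exchange_big_dep xpredT) /=; last by [].
  by apply: eq_bigr => i _; apply: eq_bigr => j _; rewrite FC.
rewrite -big_split; apply: eq_bigr => i _ /=.
rewrite -big_split; apply: eq_bigr => j ij /=.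
by rewrite /F mxE leqNgt ij /= -cosN opprB; ring.
Qed.

End Pendulum.

Section Solutions.
Context {R : realType} {N : nat}.
Implicit Types (m l : 'I_N -> R) (g T : R) (q f : R -> 'rV[R]_N)
  (v : 'rV[int]_N).

(* As usual gcd(0, a) = |a|, so 0 and -1 are relatively prime. *)
Definition prime_vector v : Prop :=
  v <> 0 /\
  ((exists i, v 0 i = 1 /\ forall j, j != i -> v 0 j = 0) \/
   (exists i j, i != j /\ coprimez (v 0 i) (v 0 j))).

Definition abs_continuous (a b : R) (h : R -> R) : Prop :=
  forall e : R, 0 < e -> exists2 d : R, 0 < d &
    forall (n : nat) (u w : 'I_n -> R),
      (forall i, a <= u i /\ u i <= w i /\ w i <= b) ->
      trivIset setT (fun i => `]u i, w i[%classic) ->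
      \sum_(i < n) (w i - u i) < d ->
      \sum_(i < n) `|h (w i) - h (u i)| < e.

Definition velocity q (t : R) : 'rV[R]_N := \row_i derive1 (fun s => q s 0 i) t.

(* The forcing is only square integrable, so solutions are understood in the
   sense of Caratheodory: q is differentiable, its derivative is locally
   absolutely continuous, and the equation holds for almost every t. *)
Definition solves_pendulum m l g f q : Prop :=
  [/\ forall t i, derivable (fun s => q s 0 i) t 1,
      forall (a b : R) i, abs_continuous a b (fun s => velocity q s 0 i) &
      {ae lebesgue_measure, forall t : R, forall i : 'I_N,
        let Lp_along := fun s => Lp m l g (q s) (velocity q s) i in
        derivable Lp_along t 1 /\
        derive1 Lp_along t - Lq m l g (q t) (velocity q t) i = f t 0 i}].

Definition rotational v T q : Prop :=
  forall t i, q (t + T) 0 i - q t 0 i = 2 * pi * (v 0 i)%:~R.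

Definition rotational_solutions m l g f v T : set (R -> 'rV[R]_N) :=
  [set q | solves_pendulum m l g f q /\ rotational v T q].

(* L^2(R/TZ, R^N), through T-periodic representatives defined everywhere. *)
Definition L2_periodic T f : Prop :=
  [/\ forall t, f (t + T) = f t,
      forall i, measurable_fun setT (fun t => f t 0 i) &
      (@lebesgue_measure R).-integrable `[0, T]
        (fun t => (eucl_norm (f t) ^+ 2)%:E)].

(* f = 0 as an element of L^2. *)
Definition ae_zero f : Prop := {ae lebesgue_measure, forall t : R, f t = 0}.

Definition same_solution f q1 q2 : Prop :=
  exists (k : 'rV[int]_N) (theta : R), (theta <> 0 -> ae_zero f) /\
    forall t i, q2 t 0 i = q1 (t + theta) 0 i + 2 * pi * (k 0 i)%:~R.

Lemma same_solution_refl f q : same_solution f q q.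
Proof.
by exists 0, 0; split=> // t i; rewrite addr0 mxE mulr0 addr0.
Qed.

Lemma same_solution_sym f q1 q2 : same_solution f q1 q2 -> same_solution f q2 q1.
Proof.
move=> [k [th [hf h]]]; exists (- k), (- th); split.
  by move=> th0; apply: hf => e; apply: th0; rewrite e oppr0.
by move=> t i; rewrite h subrK mxE mulrNz mulrN addrK.
Qed.

Lemma same_solution_trans f q1 q2 q3 :
  same_solution f q1 q2 -> same_solution f q2 q3 -> same_solution f q1 q3.
Proof.
move=> [k [th [hf h]]] [k' [th' [hf' h']]].
exists (k + k'), (th' + th); split.
  have [->|/eqP/hf' //] := eqVneq th' 0.
  by rewrite add0r.
by move=> t i; rewrite h' h (addrA t) mxE intrD; ring.
Qed.

(* The set P(v, T): its elements are the classes of rotational solutions. *)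
Definition distinct_rotational_solutions m l g f v T
    : set (set (R -> 'rV[R]_N)) :=
  [set [set q' | rotational_solutions m l g f v T q' /\ same_solution f q q']
    | q in rotational_solutions m l g f v T].

End Solutions.

(* Main.v *)
Require Import Defs.
From mathcomp Require Import all_fingroup.
From mathcomp Require Import ring lra zify.

Set Implicit Arguments.
Unset Strict Implicit.
Unset Printing Implicit Defensive.

Local Open Scope classical_set_scope.
Local Open Scope card_scope.
Local Open Scope ring_scope.

(** Divided by the inertia [rho_i = alpha_i l_i^2] of its link, the i-th Lagrange
    equation reads, with [p = q'],
      [(p_i + sum_j c_ij cos (q_i - q_j) p_j - F_i)' =
         - a_i sin q_i - sum_j c_ij sin (q_i - q_j) p_i p_j],
    where [a_i = g / l_i], where [c_ij] is the off-diagonal inertia divided by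
    [rho_i], and where [F_i] is a primitive of [f_i / rho_i].  The masses and
    lengths can be taken in a hierarchy ([bob_mass], [rod_length]) for which every
    [c_ij] is small, [c_ij ^ 2] is small compared with [a_i] and [F_i] is small
    compared with [a_i]; for a short period the motion is then a perturbation of
    free rotation.

    Solutions are sought as [q_i = x_i + V_i t + w_i] with [V_i = 2 pi v_i / T]
    and [w_i] periodic of mean zero.  The phases [x_i] of the rotating links
    ([v_i <> 0]) are prescribed, and every resting link ([v_i = 0]) is assigned one
    of its two equilibria 0 and pi.  The remaining equations are the fixed points
    of a contraction [Phi]: the velocities are recovered from the momentum
    balance, and the phase of a resting link from the requirement that its
    mean torque vanish, near the chosen equilibrium.  A fixed point is a solution
    if and only if the mean torques of the rotating links vanish too, and these
    are, up to the factors [rho_i], the partial derivatives of the reduced action,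
    a function on the torus of dimension [k = N - N0] of the phases of the rotating
    links ([action_taylor], [torus_stationary]).

    For the forced system it remains to use that a function on a k-dimensional
    torus with Lipschitz gradient has at least [k + 1] critical points
    ([many_torus_critical_points]): this gives [k + 1] solutions for each of the
    [2^N0] choices of equilibria, and these are distinct because the phases of the
    resting links remain near the chosen equilibria.  The bound on critical points
    is the Lusternik-Schnirelmann theorem.  It is obtained from gradient descent:
    if [k] points were all the critical points, every orbit would eventually come
    near one of them, and the lift of that point near which it comes would define
    locally constant coordinates of the torus, which is impossible for
    degree reasons ([discrete_degree]).

    The free system is reversible.  If all phases lie in [pi Z], the contraction
    preserves the states with even velocities, and on these all torques are odd,
    so that all mean torques vanish ([symmetric_solution]).  Normalize to 0 the
    phase of a link with odd rotation number; the [2^(N-1)] remaining choices of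
    phases in [{0, pi}] give solutions that are distinct even up to time
    translation, because the primality of [v] forces a translation that matches
    two of them to be a multiple of the period ([half_period_parity]).
    Finally [(N - N0) 2^N0 <= 2^(N-1)]. *)

(** * A discrete degree on the torus *)

Section DiscreteDegree.
Variables (R : realType) (d n : nat).
Hypothesis n_gt0 : (0 < n)%N.
Notation k := d.+1.
Notation point := ('I_k -> int).
Implicit Types (x : point) (s : 'S_k) (phi : 'I_k -> point -> R).

(** The vertex number [j] of the Kuhn simplex with corner [x]: the unit steps
    ranked below [j] by [s] have been made.  The Kuhn simplices triangulate the grid. *)
Definition kuhn x s (j : nat) : point := fun m => x m + (s m < j)%N%:Z.

Definition shift x (m : 'I_k) (c : int) : point := fun l => x l + (if l == m then c else 0).

(** Up to sign, the determinant is [k`!] times the volume of the image of the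
    simplex under the affine interpolation of [phi]. *)
Definition simplex_mx phi x s : 'M[R]_(k.+1) :=
  \matrix_(i, j) oapp (fun l => phi l (kuhn x s j)) 1 (unlift ord0 i).

Lemma simplex_mx0 phi x s j : simplex_mx phi x s ord0 j = 1.
Proof. by rewrite mxE unlift_none. Qed.

Lemma simplex_mxS phi x s i j :
  simplex_mx phi x s (lift ord0 i) j = phi i (kuhn x s j).
Proof. by rewrite mxE liftK. Qed.

Lemma sum_cofactor_ones p (A : 'M[R]_p.+1) (i : 'I_p.+1) :
  (forall j, A ord0 j = 1) -> i != ord0 -> \sum_j cofactor A i j = 0.
Proof.
move=> A0 i0; have := mul_mx_adj A => /matrixP/(_ ord0 i).
rewrite !mxE eq_sym (negbTE i0) mulr0n => e0; rewrite -[RHS]e0.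
by apply: eq_bigr => j _; rewrite A0 mul1r mxE.
Qed.

(** The change adds to each row a multiple of the first one, whose entries are 1. *)
Lemma det_add_row0 p (A A' : 'M[R]_p.+1) (c : 'I_p.+1 -> R) :
  (forall j, A ord0 j = 1) -> c ord0 = 0 ->
  (forall i j, A' i j = A i j + c i) -> \det A' = \det A.
Proof.
move=> A0 c0 hA.
pose U : 'M[R]_p.+1 := \matrix_(i, j) ((i == j)%:R + c i * (j == ord0)%:R).
have -> : A' = U *m A.
  apply/matrixP => i j; rewrite hA !mxE.
  under eq_bigr do rewrite mxE mulrDl.
  rewrite big_split /=; congr (_ + _).
    rewrite (bigD1 i) //= eqxx mul1r big1 ?addr0 // => l li.
    by rewrite eq_sym (negbTE li) mul0r.
  rewrite (bigD1 ord0) //= A0 !mulr1 big1 ?addr0 // => l li.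
  by rewrite (negbTE li) mulr0 mul0r.
have Utrig : is_trig_mx U.
  apply/is_trig_mxP => i j ij; rewrite mxE.
  have -> : (j == ord0) = false by apply/negP => /eqP j0; rewrite j0 in ij.
  have -> : (i == j) = false by apply/negP => /eqP e; rewrite e ltnn in ij.
  by rewrite mulr0 addr0.
rewrite det_mulmx (det_trig Utrig) big1 ?mul1r // => i _.
by rewrite mxE eqxx; case: eqVneq => [->|]; rewrite ?c0 ?mulr0 ?mul0r ?addr0.
Qed.

Definition emb (y : {ffun 'I_k -> 'I_n}) : point := fun m => (y m : nat)%:Z.

(** The signed volume, up to the factor [k`!], of the image of the torus of side
    [n]: a degree when [phi] is the identity up to periodic terms. *)
Definition degree_sum phi : R :=
  \sum_(s : 'S_k) (-1) ^+ s * \sum_y \det (simplex_mx phi (emb y) s).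

Lemma sum_emb_shift (g : point -> R) (m : 'I_k) :
  (forall x l, g (shift x l n%:Z) = g x) ->
  \sum_y g (shift (emb y) m 1) = \sum_y g (emb y).
Proof.
move=> gper.
pose h (y : {ffun 'I_k -> 'I_n}) : {ffun 'I_k -> 'I_n} :=
  [ffun l => if l == m then ordS (y l) else y l].
have hinj : injective h.
  move=> y y' /ffunP e; apply/ffunP => l; have := e l; rewrite !ffunE.
  by case: eqP => // _; exact: ordS_inj.
rewrite [RHS](reindex_inj hinj); apply: eq_bigr => y _.
have [yn|yn] := ltnP (y m).+1 n.
  congr g; apply: funext => l; rewrite /shift /emb ffunE.
  case: eqP => [->|_]; last by rewrite addr0.
  by rewrite /= modn_small // intS addrC.
rewrite -[RHS](gper _ m); congr g; apply: funext => l; rewrite /shift /emb ffunE.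
case: eqP => [->|//] /=.
have e : (y m).+1 = n by apply/eqP; rewrite eqn_leq yn andbT ltn_ord.
by rewrite e modnn add0r addrC -intS e.
Qed.

Lemma kuhn_shift x s j m c : kuhn (shift x m c) s j = shift (kuhn x s j) m c.
Proof. by apply: funext => l; rewrite /kuhn /shift addrAC. Qed.

Definition rot_perm : 'S_k := lift_perm ord0 ord_max 1.

(** The face opposite to the first vertex is the face opposite to the last vertex
    of the simplex one step further, with cyclically rotated order. *)
Lemma kuhn_rot x s (j : nat) : (j < k)%N ->
  kuhn (shift x ((s^-1)%g ord0) 1) (s * rot_perm)%g j = kuhn x s j.+1.
Proof.
move=> jk; apply: funext => m; rewrite /kuhn /shift permM.
have [->|ms] := eqVneq m ((s^-1)%g ord0).
  rewrite permKV /rot_perm lift_perm_id.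
  have -> : (@ord_max d < j)%N = false by apply/negbTE; rewrite -leqNgt -ltnS.
  by rewrite addr0.
have sm0 : s m != ord0 by apply: contra_neq ms => <-; rewrite permK.
have [l ->] : exists l, s m = lift ord0 l.
  by case: (unliftP ord0 (s m)) sm0 => [l ->|->]; [exists l|rewrite eqxx].
by rewrite /rot_perm lift_perm_lift perm1 addr0 lift_max lift0.
Qed.

(** The face opposite to an intermediate vertex is shared with the simplex in
    which the steps before and after that vertex are exchanged. *)
Lemma kuhn_swap x s (j : nat) (j1 : (j < k)%N) (j2 : (j.+1 < k)%N) (l : nat) :
  l != j.+1 -> kuhn x (s * tperm (Ordinal j1) (Ordinal j2))%g l = kuhn x s l.
Proof.
move=> lj; apply: funext => m; rewrite /kuhn permM; congr (_ + Posz (nat_of_bool _)).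
case: tpermP => [->|->|//] /=.
  by rewrite [LHS]ltn_neqAle eq_sym lj.
by rewrite [RHS]ltn_neqAle eq_sym lj.
Qed.

Lemma odd_tperm_succ (j : nat) (j1 : (j < k)%N) (j2 : (j.+1 < k)%N) :
  odd_perm (tperm (Ordinal j1) (Ordinal j2)) = true.
Proof. by rewrite odd_tperm -val_eqE /= neq_ltn ltnSn. Qed.

Section PeriodicRow.
Variables (phi : 'I_k -> point -> R) (c : 'I_k -> 'I_k -> R) (i : 'I_k).
Hypothesis phi_shift : forall l x m, phi l (shift x m n%:Z) = phi l x + c l m.
Hypothesis c_i : forall m, c i m = 0.

Let minor (j : 'I_k.+1) x s : R :=
  \det (row' (lift ord0 i) (col' j (simplex_mx phi x s))).
Let weight (j : 'I_k.+1) x s : R := \sum_(l | l != j) phi i (kuhn x s l).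
Let face (j : 'I_k.+1) x s : R := weight j x s * minor j x s.

(** The cofactors of the row [i] sum to 0, because another row is constant; the
    sum of the entries can thus be subtracted from every entry of that row, which
    leaves in front of the [j]-th cofactor a weight that depends on the face
    opposite to the vertex [j] only, like the cofactor itself. *)
Let det_faces x s : \det (simplex_mx phi x s) =
  - \sum_(j < k.+1) (-1) ^+ (lift ord0 i + j) * face j x s.
Proof.
set A := simplex_mx phi x s.
have cof0 : \sum_j cofactor A (lift ord0 i) j = 0.
  by apply: sum_cofactor_ones => // j; rewrite simplex_mx0.
rewrite (expand_det_row A (lift ord0 i)).
transitivity (\sum_j (A (lift ord0 i) j - \sum_(l < k.+1) phi i (kuhn x s l))
                       * cofactor A (lift ord0 i) j).
  under [RHS]eq_bigr do rewrite mulrBl.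
  by rewrite sumrB -mulr_sumr cof0 mulr0 subr0.
rewrite -[RHS]sumrN; apply: eq_bigr => j _.
rewrite simplex_mxS (bigD1 j) //= opprD addNKr /face /cofactor /minor.
by rewrite mulNr mulrCA.
Qed.

Let face_congr j x s x' s' :
  (forall l, l != j -> kuhn x s (l : 'I_k.+1) = kuhn x' s' l) ->
  face j x s = face j x' s'.
Proof.
move=> h; congr (_ * _).
  by apply: eq_bigr => l lj; rewrite h.
rewrite /minor; congr (\det _); apply/matrixP => a b; rewrite !mxE.
by rewrite h // eq_sym neq_lift.
Qed.

Let face_rot x s :
  face ord0 x s = face ord_max (shift x ((s^-1)%g ord0) 1) (s * rot_perm)%g.
Proof.
congr (_ * _).
  rewrite /weight (bigID (pred1 ord0)) /= big_pred0 ?add0r; last first.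
    by move=> j; case: eqP.
  rewrite [RHS](bigID (pred1 ord_max)) /= [X in _ = X + _]big_pred0 ?add0r; last first.
    by move=> j; case: eqP.
  under eq_bigl do rewrite andbb.
  under [RHS]eq_bigl do rewrite andbb.
  rewrite big_mkcond big_ord_recl /= add0r.
  rewrite [RHS]big_mkcond [RHS]big_ord_recr /= eqxx addr0.
  apply: eq_bigr => l _; rewrite kuhn_rot; last by rewrite /= ltn_ord.
  by rewrite -val_eqE /= neq_ltn ltn_ord.
rewrite /minor; congr (\det _); apply/matrixP => a b; rewrite !mxE.
rewrite lift_max lift0 kuhn_rot //.
Qed.

Let face_periodic j s x m : face j (shift x m n%:Z) s = face j x s.
Proof.
congr (_ * _).
  by apply: eq_bigr => l _; rewrite kuhn_shift phi_shift c_i addr0.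
pose e (a : 'I_k) : R := oapp (fun l => c l m) 0 (unlift ord0 (lift (lift ord0 i) a)).
have l0 : lift (lift ord0 i) ord0 = ord0 by apply: val_inj.
apply: (@det_add_row0 _ _ _ e).
- by move=> b; rewrite !mxE l0 unlift_none.
- by rewrite /e l0 unlift_none.
- move=> a b; rewrite !mxE /e; case: (unlift _ _) => [l|] /=; last by rewrite addr0.
  by rewrite kuhn_shift phi_shift.
Qed.

Let sumface j := \sum_(s : 'S_k) (-1) ^+ s * \sum_y face j (emb y) s.

Let sumface_mid (j : 'I_k.+1) : j != ord0 -> j != ord_max -> sumface j = 0.
Proof.
case: j => -[|j] jk // _ jm.
have j2 : (j.+1 < k)%N by rewrite ltn_neqAle -ltnS jk andbT.
have j1 : (j < k)%N by apply: ltnW.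
pose t := tperm (Ordinal j1) (Ordinal j2).
have : sumface (Ordinal jk) = - sumface (Ordinal jk).
  rewrite {1}/sumface (reindex_inj (mulIg t)) /= -sumrN; apply: eq_bigr => s _.
  rewrite odd_permM odd_tperm_succ signr_addb expr1 mulrN1 mulNr.
  congr (- (_ * _)); apply: eq_bigr => y _; apply: face_congr => l lj.
  exact: kuhn_swap.
by lra.
Qed.

Let sumface_ends : sumface ord0 = (-1) ^+ d * sumface ord_max.
Proof.
rewrite /sumface [X in _ = _ * X](reindex_inj (mulIg rot_perm)) /= mulr_sumr.
apply: eq_bigr => s _.
have -> : \sum_y face ord0 (emb y) s = \sum_y face ord_max (emb y) (s * rot_perm)%g.
  under eq_bigr do rewrite face_rot.
  by apply: (sum_emb_shift (g := fun x => face ord_max x (s * rot_perm)%g)) => x l; apply: face_periodic.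
rewrite mulrA; congr (_ * _).
rewrite odd_permM signr_addb mulrCA.
rewrite /rot_perm odd_lift_perm odd_perm1 /= addbF signr_odd.
by rewrite -exprMn mulrNN mulr1 expr1n mulr1.
Qed.

(** A discrete Stokes formula.  By [det_faces] the degree is a sum over faces of
    simplices; each face occurs in two simplices, [kuhn_swap] or [kuhn_rot], with
    opposite signs. *)
Lemma degree_sum_periodic_row : degree_sum phi = 0.
Proof.
rewrite /degree_sum.
transitivity (- \sum_(j : 'I_k.+1) (-1) ^+ (lift ord0 i + j) * sumface j).
  rewrite /sumface -sumrN; under [RHS]eq_bigr do rewrite mulr_sumr -sumrN.
  rewrite exchange_big /=; apply: eq_bigr => s _.
  under eq_bigr do rewrite det_faces -sumrN.
  rewrite exchange_big /= mulr_sumr; apply: eq_bigr => j _.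
  rewrite sumrN -mulr_sumr mulrN; congr (- _).
  by rewrite mulrCA.
rewrite big_ord_recl big_ord_recr /= big1 => [|j _]; last first.
  rewrite sumface_mid ?mulr0 // -val_eqE //=.
  by rewrite /bump /= add1n neq_ltn ltnS ltn_ord.
have -> : lift ord0 ord_max = ord_max :> 'I_k.+1 by apply: val_inj.
rewrite add0r sumface_ends mulrA -exprD -mulrDl.
have -> : (lift ord0 i + @ord_max k = (lift ord0 i + d).+1)%N by rewrite -addnS.
by rewrite addn0 exprS mulN1r subrr mul0r oppr0.
Qed.

End PeriodicRow.

Let lin : 'I_k -> point -> R := fun i x => (x i)%:~R.

(** For the identity every simplex contributes 1. *)
Lemma degree_sum_linear : degree_sum lin != 0.
Proof.
have -> : degree_sum lin = \sum_(s : 'S_k) \sum_(y : {ffun 'I_k -> 'I_n}) 1.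
  apply: eq_bigr => s _; rewrite mulr_sumr; apply: eq_bigr => y _.
  pose B s : 'M[R]_(k.+1) :=
    \matrix_(i, j) oapp (fun l => (s l < j)%N%:R) 1 (unlift ord0 i).
  pose e (a : 'I_k.+1) : R := oapp (fun l => (emb y l)%:~R) 0 (unlift ord0 a).
  have -> : \det (simplex_mx lin (emb y) s) = \det (B s).
    apply: (@det_add_row0 _ _ _ e).
    - by move=> j; rewrite mxE unlift_none.
    - by rewrite /e unlift_none.
    - move=> a j; rewrite !mxE /e; case: (unlift _ _) => [l|] /=; last by rewrite addr0.
      by rewrite /lin /kuhn intrD addrC; congr (_ + _); case: (_ < _)%N.
  have -> : B s = row_perm (lift_perm ord0 ord0 s) (B 1%g).
    apply/matrixP => a j; rewrite !mxE.
    case: unliftP => [l ->|->]; first by rewrite lift_perm_lift liftK /= perm1.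
    by rewrite lift_perm_id unlift_none.
  rewrite row_permE det_mulmx det_perm odd_lift_perm /=.
  have -> : \det (B 1%g) = 1.
    have Btrig : is_trig_mx (B 1%g)^T.
      apply/is_trig_mxP => a b ab; rewrite !mxE.
      case: unliftP ab => [l ->|->] //=; rewrite perm1 /bump /= add1n => al.
      by rewrite ltnNge -ltnS al.
    rewrite -det_tr (det_trig Btrig) big1 // => a _; rewrite !mxE.
    case: unliftP => [l ->|-> //] /=.
    by rewrite perm1 /bump /= add1n ltnSn.
  by rewrite mulr1 -expr2 sqrr_sign.
rewrite !sumr_const -!mulrnA pnatr_eq0 muln_eq0 negb_or.
rewrite -!lt0n; apply/andP; split.
  by apply/card_gt0P; exists [ffun=> Ordinal n_gt0].
by apply/card_gt0P; exists 1%g.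
Qed.

(** The coordinates of [phi] can be replaced one at a time by those of the identity:
    by multilinearity the degree changes by the degree of a map with a periodic
    coordinate, which vanishes.  So some simplex has a nonzero determinant; a
    coordinate that is constant on its vertices would make two rows proportional. *)
Lemma discrete_degree phi :
  (forall i x m, phi i (shift x m n%:Z) = phi i x + (if i == m then n%:R else 0)) ->
  exists x s, forall i, exists j : 'I_k.+1, phi i (kuhn x s j) <> phi i (kuhn x s 0).
Proof.
move=> phi_qp.
pose psi (t : nat) (i : 'I_k) := if (i < t)%N then phi i else lin i.
have psi_qp t i x m : psi t i (shift x m n%:Z) = psi t i x + (if i == m then n%:R else 0).
  rewrite /psi; case: ifP => _ //.
  by rewrite /lin /shift intrD; congr (_ + _); case: eqP.
have psi_deg t : (t <= k)%N -> degree_sum (psi t) = degree_sum lin.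
  elim: t => [|t IH] tk; first by congr degree_sum.
  rewrite -(IH (ltnW tk)).
  pose i := Ordinal tk.
  pose chi (l : 'I_k) x := if l == i then phi l x - lin l x else psi t l x.
  have chi0 : degree_sum chi = 0.
    apply: (@degree_sum_periodic_row chi
      (fun l m => if l == i then 0 else if l == m then n%:R else 0) i).
      move=> l x m; rewrite /chi; case: eqP => // _.
      rewrite phi_qp /lin /shift intrD.
      by case: eqP => _; rewrite !addr0 // opprD addrACA subrr addr0.
    by move=> m; rewrite eqxx.
  suff -> : degree_sum (psi t.+1) = degree_sum (psi t) + degree_sum chi.
    by rewrite chi0 addr0.
  rewrite /degree_sum -big_split /=; apply: eq_bigr => s _.
  rewrite -mulrDr -big_split /=; congr (_ * _); apply: eq_bigr => y _.
  rewrite -[X in X + _]mul1r -[X in _ + X]mul1r.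
  have psiS l : l != i -> psi t.+1 l = psi t l.
    rewrite /psi ltnS leq_eqVlt -val_eqE /= => /negbTE -> //.
  apply: (@determinant_multilinear _ _ _ _ _ (lift ord0 i)).
  - apply/rowP => j; rewrite !mxE !liftK /= !mul1r /chi eqxx /psi ltnSn ltnn.
    by rewrite addrC subrK.
  - apply/matrixP => a j; rewrite !mxE.
    case: unliftP => [l|//] e /=; rewrite psiS //; apply/eqP => li.
    by have := neq_lift (lift ord0 i) a; rewrite e li eqxx.
  - apply/matrixP => a j; rewrite !mxE.
    case: unliftP => [l|//] e /=; rewrite psiS /chi; last first.
      by apply/eqP => li; have := neq_lift (lift ord0 i) a; rewrite e li eqxx.
    by case: eqP => // li; have := neq_lift (lift ord0 i) a; rewrite e li eqxx.
have psik : psi k = phi by apply: funext => i; rewrite /psi ltn_ord.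
have := degree_sum_linear; rewrite -(psi_deg k (leqnn _)) psik => S0.
have [s [y Dsy]] : exists s, exists y, \det (simplex_mx phi (emb y) s) <> 0.
  apply/not_existsP => h; move/eqP: S0; apply.
  rewrite /degree_sum big1 // => s _; rewrite big1 ?mulr0 // => y _.
  by have /forallNP/(_ y)/contrapT := h s.
exists (emb y), s => i; apply/not_existsP => h; apply: Dsy.
rewrite (expand_det_row _ (lift ord0 i)).
under eq_bigr => j _ do rewrite simplex_mxS (contrapT (h j)).
rewrite -mulr_sumr sum_cofactor_ones ?mulr0 // => j.
by rewrite simplex_mx0.
Qed.

End DiscreteDegree.

(** * Supremum norm and lattice translates *)

Lemma finite_common_radius (R : realType) (I : finType) (P : I -> R -> Prop) :
  (forall i e e', P i e -> 0 < e' -> e' <= e -> P i e') ->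
  (forall i, exists2 e, 0 < e & P i e) -> exists2 e, 0 < e & forall i, P i e.
Proof.
move=> Pmono h.
have [e he] := boolp.choice (fun i => let: ex_intro2 e e0 Pe := h i in
  ex_intro (fun e => 0 < e /\ P i e) e (conj e0 Pe)).
exists (\big[Num.min/1]_i e i).
  by apply/bigmin_gtP; split=> // i _; have [] := he i.
by move=> i; apply: (Pmono _ _ _ (he i).2); [apply/bigmin_gtP; split=> // j _; have [] := he j|apply: bigmin_le_cond].
Qed.

Section RowNorm.
Variables (R : realType) (k : nat).
Implicit Types x y : 'rV[R]_k.+1.

Lemma coord_le_norm x i : `|x ord0 i| <= `|x|.
Proof.
rewrite [leRHS]/Num.norm /= mx_normrE; apply/bigmax_geP; right => /=.
by exists (ord0, i).
Qed.

Lemma norm_row_le x e : 0 <= e -> (forall i, `|x ord0 i| <= e) -> `|x| <= e.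
Proof.
move=> e0 h; rewrite [leLHS]/Num.norm /= mx_normrE; apply/bigmax_leP; split=> //.
by move=> [a b] _ /=; rewrite (ord1 a).
Qed.

Lemma norm_row_attained x : exists i, `|x| = `|x ord0 i|.
Proof.
have [->|x0] := eqVneq x 0; first by exists ord0; rewrite mxE !normr0.
have /mx_norm_neq0[[a i] /= e] : mx_norm x != 0.
  by apply: contra_neq x0 => /mx_norm_eq0.
exists i; rewrite [LHS]/Num.norm /= e (ord1 a) //.
Qed.

End RowNorm.

Section Lattice.
Variables (R : realType) (d : nat) (L : R).
Hypothesis L_gt0 : 0 < L.
Notation k := d.+1.

Definition lat (z : 'I_k -> int) : 'rV[R]_k := \row_i (L * (z i)%:~R).

Lemma latB z w : lat z - lat w = lat (fun i => z i - w i).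
Proof. by apply/rowP => i; rewrite !mxE intrD mulrDr mulrNz mulrN. Qed.

Lemma lat_inj z w : lat z = lat w -> z = w.
Proof.
move=> /rowP h; apply: funext => i; have := h i; rewrite !mxE.
by move=> /(mulfI (lt0r_neq0 L_gt0)) /intr_inj.
Qed.

(** The coset [u + L Z] is discrete. *)
Lemma translate_gap (u : R) : exists2 e, 0 < e &
  forall w : int, u + L * w%:~R = 0 \/ e <= `|u + L * w%:~R|.
Proof.
pose f := Num.floor (u / L); pose r := u - L * f%:~R.
have r0 : 0 <= r by rewrite subr_ge0 mulrC -ler_pdivlMr // floor_le.
have rL : r < L.
  rewrite ltrBlDr addrC -{2}(mulr1 L) -mulrDr mulrC -ltr_pdivrMr //.
  by have := floorD1_gt (u / L); rewrite intrD.
have uE (w : int) : u + L * w%:~R = r + L * (f + w)%:~R by rewrite /r intrD mulrDr addrA subrK.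
have hpos (w : int) : (0 <= w)%R -> r <= r + L * w%:~R.
  by move=> w0; rewrite lerDl mulr_ge0 ?ler0z // ltW.
have hneg (w : int) : (w <= -1)%R -> r + L * w%:~R <= r - L.
  move=> w1; rewrite lerD2l -(mulrN1 L) ler_pM2l //.
  by rewrite -[-1]/(-1%:~R) -mulrNz ler_int.
have hcase (w : int) : (0 <= w) \/ (w <= -1).
  by case: (lerP 0 w) => h; [left|right; lia].
have [r_eq0|r_neq0] := eqVneq r 0.
  exists L => // w; rewrite uE; have [w0|w0] := eqVneq (f + w) 0.
    by left; rewrite r_eq0 w0 mulr0 addr0.
  right; rewrite r_eq0 add0r normrM (gtr0_norm L_gt0) ler_peMr ?(ltW L_gt0) //.
  by rewrite -intr_norm ler1z; lia.
have r_gt0 : 0 < r by rewrite lt_neqAle eq_sym r_neq0.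
exists (Num.min r (L - r)); first by rewrite lt_min r_gt0 subr_gt0.
move=> w; right; rewrite uE ge_min; case: (hcase (f + w)) => h.
  by rewrite (le_trans (hpos _ h)) ?ler_norm.
apply/orP; right; rewrite ler_normr; apply/orP; right.
by have := hneg _ h; lra.
Qed.

End Lattice.

(** * Critical points of functions on a torus *)

Lemma clamp_lipschitz (R : realDomainType) (x y z lo hi : R) : x <= z + y -> 0 <= z ->
  Num.min (Num.max x lo) hi - Num.min (Num.max y lo) hi <= z.
Proof.
move=> xy z0; case: (leP x lo) => ?; case: (leP y lo) => ?;
  case: (leP lo hi) => ?; case: (leP x hi) => ?; case: (leP y hi) => ?; lra.
Qed.

(** Functions on the torus are functions on the space of row vectors invariant
    under the lattice.  [G] is the gradient of [Psi], through the second-order upper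
    bound [Psi_taylor]. *)
Section LusternikSchnirelmann.
Variables (R : realType) (d : nat) (L C : R).
Notation k := d.+1.
Variables (Psi : 'rV[R]_k -> R) (G : 'rV[R]_k -> 'rV[R]_k).
Hypothesis L_gt0 : 0 < L.
Hypothesis C_gt0 : 0 < C.
Hypothesis Psi_per : forall x z, Psi (x + lat L z) = Psi x.
Hypothesis G_per : forall x z, G (x + lat L z) = G x.
Hypothesis Psi_taylor : forall x y,
  Psi y <= Psi x + \sum_i G x ord0 i * (y - x) ord0 i + C * `|y - x| ^+ 2.
Hypothesis G_lip : forall x y, `|G y - G x| <= C * `|y - x|.
Implicit Types (x y : 'rV[R]_k) (z w : 'I_k -> int).

Let to_box x : exists z, forall i, 0 <= (x + lat L z) ord0 i <= L.
Proof.
exists (fun i => - Num.floor (x ord0 i / L)) => i; rewrite !mxE mulrNz mulrN.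
have h1 : L * (Num.floor (x ord0 i / L))%:~R <= x ord0 i.
  by rewrite mulrC -ler_pdivlMr // floor_le.
have h2 : x ord0 i < L * (Num.floor (x ord0 i / L))%:~R + L.
  have := floorD1_gt (x ord0 i / L).
  by rewrite ltr_pdivrMr // intrD mulrDl mul1r mulrC.
by apply/andP; split; lra.
Qed.

Let box : set 'rV[R]_k := [set x | forall i, 0 <= x ord0 i <= L].

Let box_norm x : box x -> `|x| <= L.
Proof.
move=> bx; apply: norm_row_le => [|i]; first exact: ltW.
by have /andP[h1 h2] := bx i; rewrite ger0_norm.
Qed.

Let G_bounded : exists2 B, 0 < B & forall x, `|G x| <= B.
Proof.
exists (`|G 0| + C * L) => [|x].
  by apply: ltr_wpDl; rewrite ?mulr_gt0.
have [z hz] := to_box x; rewrite -(G_per x z).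
set y := x + _ in hz *; rewrite -[G y](subrK (G 0)) addrC.
apply: (le_trans (ler_normD _ _)); rewrite lerD2l.
apply: (le_trans (G_lip _ _)); rewrite subr0 ler_pM2l //.
exact: box_norm.
Qed.

Let dotG_le x (u : 'rV[R]_k) B : `|G x| <= B -> `|\sum_i G x ord0 i * u ord0 i| <= k%:R * B * `|u|.
Proof.
move=> GB; apply: (le_trans (ler_norm_sum _ _ _)).
have -> : k%:R * B * `|u| = \sum_(i < k) B * `|u|.
  by rewrite sumr_const card_ord -mulrA mulr_natl.
apply: ler_sum => i _; rewrite normrM ler_pM // ?coord_le_norm //.
exact: le_trans (coord_le_norm _ _) GB.
Qed.

Let Psi_lip B : (forall x, `|G x| <= B) -> forall x y, `|y - x| <= 1 ->
  `|Psi y - Psi x| <= (k%:R * B + C) * `|y - x|.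
Proof.
move=> GB x y xy.
have one a b : `|b - a| <= 1 -> Psi b - Psi a <= (k%:R * B + C) * `|b - a|.
  move=> ab; have := Psi_taylor a b.
  have := dotG_le (b - a) (GB a); have := ler_norm (\sum_i G a ord0 i * (b - a) ord0 i).
  have : C * `|b - a| ^+ 2 <= C * `|b - a|.
    by rewrite ler_pM2l // expr2 ler_piMr.
  lra.
have h1 := one x y xy; have := one y x; rewrite distrC => /(_ xy) h2.
by rewrite ler_norml; lra.
Qed.

Let Psi_bounded : exists M, forall x y, Psi y - Psi x <= M.
Proof.
have [B B0 GB] := G_bounded.
pose m := k%:R * B * L + C * L ^+ 2.
have sq x : `|x| <= L -> C * `|x| ^+ 2 <= C * L ^+ 2.
  by move=> xL; rewrite ler_pM2l // lerXn2r // nnegrE ?normr_ge0 ?ltW.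
have lin x y : `|y| <= L -> `|\sum_i G x ord0 i * y ord0 i| <= k%:R * B * L.
  move=> yL; apply: (le_trans (dotG_le _ (GB x))).
  by rewrite ler_wpM2l // mulr_ge0 // ltW.
have up x : Psi x - Psi 0 <= m.
  have [z hz] := to_box x; rewrite -(Psi_per x z); set y := x + _ in hz *.
  have := Psi_taylor 0 y; rewrite subr0.
  have yL := box_norm hz.
  have := sq _ yL; have := lin 0 _ yL.
  have := ler_norm (\sum_i G 0 ord0 i * y ord0 i); rewrite /m; lra.
have dn x : Psi 0 - Psi x <= m.
  have [z hz] := to_box x; rewrite -(Psi_per x z); set y := x + _ in hz *.
  have := Psi_taylor y 0; rewrite sub0r normrN.
  have yL := box_norm hz; have yL' : `|- y| <= L by rewrite normrN.
  have := sq _ yL; have := lin y _ yL'.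
  have := ler_norm (\sum_i G y ord0 i * (- y) ord0 i); rewrite /m; lra.
exists (m + m) => x y; have := up y; have := dn x; lra.
Qed.

Let G_continuous : continuous (fun x => `|G x|).
Proof.
move=> x; have FF : ProperFilter (nbhs x) by apply: nbhs_pfilter.
apply/(@cvgrPdist_lt _ _ _ (nbhs x)) => e e0; near=> y.
apply: le_lt_trans (ler_dist_dist _ _) _.
rewrite distrC; apply: le_lt_trans (G_lip _ _) _.
rewrite mulrC -ltr_pdivlMr //.
near: y; apply: (filterS _ (nbhsx_ballx x _ (divr_gt0 e0 C_gt0))) => z.
by rewrite -ball_normE /= distrC.
Unshelve. all: by end_near. Qed.

Variable p : 'I_k -> 'rV[R]_k.
Hypothesis zeros_covered : forall x, G x = 0 -> exists i z, x = p i + lat L z.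

Let lift_pt i z := p i + lat L z.

Let lift_ptB i z i' z' :
  lift_pt i z - lift_pt i' z' = p i - p i' + lat L (fun l => z l - z' l).
Proof. by rewrite /lift_pt -latB opprD addrACA. Qed.

Let separation : exists2 e, 0 < e & forall i z i' z',
  lift_pt i z = lift_pt i' z' \/ e <= `|lift_pt i z - lift_pt i' z'|.
Proof.
have [e e0 he] := @finite_common_radius R ('I_k * 'I_k * 'I_k)%type
  (fun t e => forall c : int, (p t.1.1 - p t.1.2) ord0 t.2 + L * c%:~R = 0 \/
     e <= `|(p t.1.1 - p t.1.2) ord0 t.2 + L * c%:~R|)
  (fun t e e' h _ le c => match h c with or_introl a => or_introl a
     | or_intror b => or_intror (le_trans le b) end)
  (fun t => translate_gap L_gt0 _).
exists e => // i z i' z'.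
have [eq0|neq0] := eqVneq (lift_pt i z - lift_pt i' z') 0.
  by left; apply/eqP; rewrite -subr_eq0 eq0.
right; have [l hl] := norm_row_attained (lift_pt i z - lift_pt i' z').
rewrite hl lift_ptB mxE [X in _ + X]mxE.
have [h|//] := he (i, i', l) (z l - z' l).
have : `|lift_pt i z - lift_pt i' z'| = 0.
  by rewrite hl lift_ptB mxE [X in _ + X]mxE h normr0.
by move/eqP; rewrite normr_eq0 (negbTE neq0).
Qed.

(** Compactness of a fundamental box. *)
Let small_gradient e : 0 < e -> exists2 mu, 0 < mu & forall x, `|G x| < mu ->
  exists i z, `|x - lift_pt i z| < e.
Proof.
move=> e0; pose A := box `&` [set x | forall i z, e <= `|x - lift_pt i z|].
have clA : closed A.
  apply: closedI.
    rewrite (_ : box = \bigcap_i [set x : 'rV[R]_k | `[0, L]%classic (x ord0 i)]); last first.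
      apply/seteqP; split => x /= h i; first by move=> _; rewrite /= in_itv /=; exact: h.
      by have := h i Logic.I; rewrite /= in_itv.
    apply: closed_bigI => i _.
    have cl : closed (`[0, L]%classic : set R) by exact: itv_closed.
    apply: ((continuous_closedP (fun x : 'rV[R]_k => x ord0 i)).1 _ _ cl).
    exact: coord_continuous.
  rewrite (_ : [set x | _] = \bigcap_t [set x : 'rV[R]_k | `[e, +oo[%classic `|x - lift_pt t.1 t.2|]); last first.
    apply/seteqP; split => x /= h; first by move=> t _ /=; rewrite in_itv /= andbT.
    by move=> i z; have := h (i, z) Logic.I; rewrite /= in_itv /= andbT.
  apply: closed_bigI => t _.
  have cl : closed `[e, +oo[%classic by exact: itv_closed_ends_closed.
  apply: ((continuous_closedP (fun x : 'rV[R]_k => `|x - lift_pt t.1 t.2|)).1 _ _ cl).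
  move=> x; apply: (@continuous_comp _ _ _ (fun x => x - lift_pt t.1 t.2) (@Num.norm _ _)); last exact: norm_continuous.
  by apply: (@continuousB _ _ _ id (cst _)); [exact: cvg_id|exact: cst_continuous].
have bA : bounded_set A.
  exists L; split; first by rewrite num_real.
  by move=> M LM x [/box_norm xL _]; apply: le_trans xL (ltW LM).
have cA := bounded_closed_compact bA clA.
have key mu : (forall x, A x -> mu <= `|G x|) -> forall x, `|G x| < mu ->
    exists i z, `|x - lift_pt i z| < e.
  move=> hA x Gx; have [z hz] := to_box x.
  apply/not_existsP => h; have : A (x + lat L z).
    split=> // i w; have /forallNP/(_ (fun l => w l - z l)) := h i.
    move/negP; rewrite -leNgt; congr (_ <= `|_|).
    by rewrite /lift_pt -latB; apply/rowP => l; rewrite !mxE; ring.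
  by move/hA; rewrite G_per leNgt Gx.
have [A0|/set0P A0] := eqVneq A set0.
  by exists 1 => //; apply: key => x; rewrite A0.
have [c cA' hc] := @EVT_min_rV R k (fun x => `|G x|) A A0 cA
  (continuous_subspaceT G_continuous).
have {}cA' := set_mem cA'.
exists `|G c|; last by apply: key => x Ax; apply/hc/mem_set.
rewrite normr_gt0; apply/eqP => /zeros_covered[i [z cE]].
by have /(_ i z) := cA'.2; rewrite /lift_pt cE subrr normr0 leNgt e0.
Qed.

(** Gradient descent decreases [Psi] by a definite amount away from the zeros of [G],
    hence every orbit comes close to a lift of some [p i], within a uniform number
    of steps.  It comes close to at most one lift of each [p i]: to pass from
    one lift to another it would have to cross a shell on which the gradient is
    bounded below, and it would lose there more than the value of [Psi] varies
    near the lifts.  This lift, in units of the lattice, is a function [phi i] of the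
    starting point with the periodicity of the [i]-th coordinate, and it is locally
    constant where the orbit comes close to the [i]-th point.  As every small simplex
    lies in one of these regions, this contradicts [discrete_degree]. *)
Lemma gradient_zeros_not_covered : False.
Proof.
have [B B0 GB] := G_bounded.
have [M hM] := Psi_bounded.
have [e0 e0_gt0 sep] := separation.
pose dl := e0 / 3.
have dl_gt0 : 0 < dl by rewrite divr_gt0.
have [mu mu_gt0 hmu] := small_gradient (divr_gt0 dl_gt0 (ltr0n _ 2)).
(* the step of the descent: [h C <= 1/2] makes [Psi] decrease, and [h B <= dl / 2]
   keeps every move below half the radius of the shells *)
pose h := Num.min (1 / 2 / C) (dl / 2 / B).
have h_gt0 : 0 < h by rewrite lt_min !divr_gt0.
have hC : h * C <= 1 / 2 by rewrite -ler_pdivlMr // ge_min lexx.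
have hB : h * B <= dl / 2 by rewrite -ler_pdivlMr // ge_min lexx orbT.
pose S x := x - h *: G x.
have S_lat x z : S (x + lat L z) = S x + lat L z.
  by rewrite /S G_per addrAC.
have S_step x : `|S x - x| = h * `|G x|.
  by rewrite /S addrC addKr normrN normrZ gtr0_norm.
have S_lip x y : `|S x - S y| <= (1 + h * C) * `|x - y|.
  have -> : S x - S y = (x - y) - h *: (G x - G y).
    by apply/rowP => i; rewrite /S !mxE; ring.
  apply: (le_trans (ler_normB _ _)); rewrite mulrDl mul1r lerD2l.
  by rewrite normrZ gtr0_norm // -mulrA ler_pM2l.
have S_drop x : Psi (S x) <= Psi x - h / 2 * `|G x| ^+ 2.
  have := Psi_taylor x (S x); rewrite S_step.
  have -> : \sum_i G x ord0 i * (S x - x) ord0 i = - h * \sum_i G x ord0 i ^+ 2.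
    by rewrite mulr_sumr; apply: eq_bigr => i _; rewrite /S !mxE; ring.
  have : `|G x| ^+ 2 <= \sum_i G x ord0 i ^+ 2.
    have [i ->] := norm_row_attained (G x); rewrite (bigD1 i) //= real_normK ?num_real //.
    by rewrite lerDl sumr_ge0 // => j _; apply: sqr_ge0.
  rewrite -(ler_pM2l h_gt0).
  have : (h * C) * (h * `|G x| ^+ 2) <= (1 / 2) * (h * `|G x| ^+ 2).
    by rewrite ler_wpM2r // mulr_ge0 ?sqr_ge0 // ltW.
  lra.
(* the distance to [P], frozen outside of the shell between [dl] and [2 dl] *)
pose th P x := Num.min (Num.max `|x - P| dl) (2 * dl).
have th_lip P x y : th P x - th P y <= `|x - y|.
  by apply: clamp_lipschitz => //; exact: ler_distD.
(* wherever a step can change the clamped distance, the gradient is at least [mu],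
   and the decrease of [Psi] pays for the change *)
have mono i z x : Psi (S x) + mu / 2 * th (lift_pt i z) (S x)
               <= Psi x + mu / 2 * th (lift_pt i z) x.
  set P := lift_pt i z.
  have drop0 : Psi (S x) <= Psi x.
    by apply: (le_trans (S_drop x)); rewrite gerBl mulr_ge0 ?sqr_ge0 // divr_ge0 ?ltW.
  have mu2 : 0 < mu / 2 by rewrite divr_gt0.
  have [near|far1] := ltP `|x - P| (dl / 2).
    suff -> : th P (S x) = th P x by rewrite lerD2r.
    have near' : `|S x - P| <= dl.
      have : `|S x - P| <= `|S x - x| + `|x - P| by apply: ler_distD.
      have : h * `|G x| <= h * B by rewrite ler_pM2l.
      rewrite S_step; lra.
    rewrite /th (max_r near') max_r //; lra.
  have [far2|near2] := ltP (2 * dl) `|x - P|.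
    apply: lerD => //; rewrite ler_pM2l //.
    have -> : th P x = 2 * dl.
      rewrite /th max_l; last by lra.
      by rewrite min_r // ltW.
    by rewrite /th ge_min lexx orbT.
  have Gmu : mu <= `|G x|.
    rewrite leNgt; apply/negP => /hmu[i' [z' close]].
    have [PE|] := sep i z i' z'.
      by move: close; rewrite -PE -/P ltNge far1.
    have : `|P - lift_pt i' z'| <= `|P - x| + `|x - lift_pt i' z'| by apply: ler_distD.
    rewrite (distrC P x) -/P; rewrite /dl in close near2 *; lra.
  have := S_drop x; have := th_lip P (S x) x; rewrite S_step.
  rewrite -(ler_pM2l mu2) => h1.
  have : mu / 2 * (h * `|G x|) <= h / 2 * `|G x| ^+ 2.
    have -> : h / 2 * `|G x| ^+ 2 = `|G x| / 2 * (h * `|G x|) by field.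
    by apply: ler_wpM2r; [rewrite mulr_ge0 // ltW|lra].
  lra.
have mono_iter i z x a b : Psi (iter (a + b) S x) + mu / 2 * th (lift_pt i z) (iter (a + b) S x)
               <= Psi (iter a S x) + mu / 2 * th (lift_pt i z) (iter a S x).
  elim: b => [|b IH]; first by rewrite addn0.
  by rewrite addnS /=; apply: le_trans (mono _ _ _) IH.
pose K := k%:R * B + C.
have K_gt0 : 0 < K by rewrite addr_gt0 // mulr_gt0 // ltr0n.
(* [Psi] varies by at most [mu * dl / 8] within [r] of a lift: less than the cost
   [mu / 2 * dl] of crossing a shell, even counted at both ends *)
pose r := Num.min (Num.min dl 1) (mu * dl / 8 / K).
have r_gt0 : 0 < r by rewrite !lt_min dl_gt0 ltr01 /= !divr_gt0 // mulr_gt0.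
have r_dl : r <= dl by rewrite !ge_min lexx.
have r_1 : r <= 1 by rewrite !ge_min lexx orbT.
have r_K : K * r <= mu * dl / 8 by rewrite mulrC -ler_pdivlMr // ge_min lexx orbT.
pose meets i x z := exists j, `|iter j S x - lift_pt i z| < r.
(* the orbit of a point comes within [r] of at most one lift of [p i] *)
have meets_uniq i x z z' : meets i x z -> meets i x z' -> z = z'.
  have main a b w w' : `|iter a S x - lift_pt i w| < r ->
      `|iter (a + b) S x - lift_pt i w'| < r -> w = w'.
    move=> ha hb; have [E|sepP] := sep i w i w'.
      by apply: (lat_inj L_gt0); apply: (addrI (p i)).
    exfalso; have := mono_iter i w x a b.
    have PsiE u : Psi (lift_pt i u) = Psi (p i) by rewrite /lift_pt Psi_per.
    have := Psi_lip GB (le_trans (ltW ha) r_1).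
    have := Psi_lip GB (le_trans (ltW hb) r_1).
    rewrite !PsiE -/K => h1 h2.
    have h1' : K * `|iter (a + b) S x - lift_pt i w'| <= K * r.
      by rewrite ler_pM2l // ltW.
    have h2' : K * `|iter a S x - lift_pt i w| <= K * r.
      by rewrite ler_pM2l // ltW.
    have -> : th (lift_pt i w) (iter a S x) = dl.
      rewrite /th max_r; last by lra.
      by rewrite min_l //; lra.
    have -> : th (lift_pt i w) (iter (a + b) S x) = 2 * dl.
      have : `|lift_pt i w - lift_pt i w'| <=
         `|lift_pt i w - iter (a + b) S x| + `|iter (a + b) S x - lift_pt i w'|.
        exact: ler_distD.
      rewrite (distrC (lift_pt i w) (iter _ S x)) => tri.
      have far : 2 * dl <= `|iter (a + b) S x - lift_pt i w|.
        by rewrite /dl in r_dl *; lra.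
      by rewrite /th max_l ?min_r //; lra.
    have : 0 < mu * dl by rewrite mulr_gt0.
    move: h1 h2; rewrite !ler_norml => /andP[h1 _] /andP[_ h2].
    lra.
  move=> [a ha] [b hb]; have [ab|/ltnW ba] := leqP a b.
    by apply: (main a (b - a)%N); rewrite ?subnKC.
  by symmetry; apply: (main b (a - b)%N); rewrite ?subnKC.
have [nu nu_gt0 hnu] := small_gradient (divr_gt0 r_gt0 (ltr0n _ 2)).
(* as [Psi] is bounded, an orbit cannot avoid the regions of small gradient for
   more than [nmax] steps *)
have [nmax hnmax] : exists nmax : nat, forall x, exists j i z,
    (j <= nmax)%N /\ `|iter j S x - lift_pt i z| < r / 2.
  pose q := h / 2 * nu ^+ 2.
  have q_gt0 : 0 < q by rewrite mulr_gt0 ?divr_gt0 ?exprn_gt0.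
  exists (Num.truncn (M / q)).+1 => x.
  have [|none] := pselect (exists2 j, (j <= (Num.truncn (M / q)).+1)%N & `|G (iter j S x)| < nu).
    by move=> [j jn /hnu[i [z hz]]]; exists j, i, z.
  exfalso.
  have dropn j : (j <= (Num.truncn (M / q)).+1)%N -> Psi (iter j S x) <= Psi x - j%:R * q.
    elim: j => [|j IH] jn; first by rewrite mul0r subr0.
    have nuG : nu <= `|G (iter j S x)|.
      by rewrite leNgt; apply/negP => lt; apply: none; exists j => //; exact: ltnW.
    have : q <= h / 2 * `|G (iter j S x)| ^+ 2.
      by rewrite ler_pM2l ?divr_gt0 // lerXn2r // nnegrE ?normr_ge0 // ltW.
    have := IH (ltnW jn); have := S_drop (iter j S x); rewrite /= -[j.+1%:R]natr1 mulrDl mul1r; lra.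
  have := dropn _ (leqnn _); have := hM (iter (Num.truncn (M / q)).+1 S x) x.
  have := truncnS_gt (M / q); rewrite ltr_pdivrMr //; lra.
pose Lm := (1 + h * C) ^+ nmax.
have hC1 : 1 <= 1 + h * C by rewrite lerDl ltW // mulr_gt0.
have Lm_gt0 : 0 < Lm by rewrite exprn_gt0 //; lra.
have iter_lip j x y : (j <= nmax)%N -> `|iter j S x - iter j S y| <= Lm * `|x - y|.
  move=> jn; apply: (@le_trans _ _ ((1 + h * C) ^+ j * `|x - y|)); last first.
    by rewrite ler_wpM2r // ler_weXn2l.
  elim: j {jn} => [|j IH]; first by rewrite expr0 mul1r.
  apply: (le_trans (S_lip _ _)); rewrite exprS -mulrA ler_pM2l //; lra.
have iter_lat j x z : iter j S (x + lat L z) = iter j S x + lat L z.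
  by elim: j => //= j ->; rewrite S_lat.
(* the mesh [L / n] is so fine that [nmax] steps of descent keep the vertices of a
   simplex within [r / 2] of each other *)
pose n := (Num.truncn (Lm * L / (r / 2))).+1.
have n_gt0 : 0 < n%:R :> R by rewrite ltr0n.
have hn : Lm * (L / n%:R) < r / 2.
  rewrite mulrA ltr_pdivrMr // (mulrC (r / 2)) -ltr_pdivrMr ?divr_gt0 //.
  exact: truncnS_gt.
pose pt (X : 'I_k -> int) : 'rV[R]_k := \row_i (L / n%:R * (X i)%:~R).
(* the second case gives [phi i] the required periodicity where the orbit stays
   away from all lifts of [p i] *)
pose phi (i : 'I_k) (X : 'I_k -> int) : R :=
  match pselect (exists z, meets i (pt X) z) with
  | left ex => n%:R * (projT1 (cid ex) i)%:~R
  | right _ => (X i)%:~R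
  end.
have phiE i X z : meets i (pt X) z -> phi i X = n%:R * (z i)%:~R.
  move=> mz; rewrite /phi; case: pselect => [ex|/(_ (ex_intro _ z mz))//].
  by case: (cid ex) => w mw /=; rewrite (meets_uniq _ _ _ _ mz mw).
pose unit_at (m : 'I_k) : 'I_k -> int := fun l => if l == m then 1 else 0.
have pt_shift X m : pt (shift X m n%:Z) = pt X + lat L (unit_at m).
  apply/rowP => l; rewrite !mxE /shift intrD mulrDr; congr (_ + _).
  rewrite /unit_at; case: eqP => _; last by rewrite !mulr0.
  by rewrite mulr1 mulrVK // unitfE gt_eqF.
have meets_shift i X m z : meets i (pt X) z ->
    meets i (pt (shift X m n%:Z)) (fun l => z l + unit_at m l).
  move=> [j hj]; exists j; rewrite pt_shift iter_lat.
  have -> : lift_pt i (fun l => z l + unit_at m l) = lift_pt i z + lat L (unit_at m).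
    by apply/rowP => l; rewrite !mxE intrD mulrDr addrA.
  by rewrite opprD addrACA subrr addr0.
have [] := @discrete_degree R d n (ltn0Sn _) phi.
  move=> i X m; have [[z mz]|none] := pselect (exists z, meets i (pt X) z).
    rewrite (phiE _ _ _ mz) (phiE _ _ _ (meets_shift _ _ m _ mz)) intrD mulrDr.
    by rewrite /unit_at; case: eqP => _; rewrite ?mulr1z ?mulr0z ?mulr1 ?mulr0.
  rewrite /phi; case: pselect => [[z [j hj]]|_].
    exfalso; apply: none; exists (fun l => z l - unit_at m l), j.
    move: hj; rewrite pt_shift iter_lat.
    have -> : lift_pt i (fun l => z l - unit_at m l) = lift_pt i z - lat L (unit_at m).
      by apply/rowP => l; rewrite !mxE intrB mulrBr addrA.
    by rewrite opprB addrA.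
  case: pselect => // _.
  by rewrite /shift intrD; congr (_ + _); case: eqP.
move=> X [s bad].
have [j [i [z [jn hj]]]] := hnmax (pt (kuhn X s 0)).
have [l] := bad i; apply.
rewrite (phiE _ _ z) ?(phiE _ _ z) //; exists j; first by lra.
have hd : `|pt (kuhn X s l) - pt (kuhn X s 0)| <= L / n%:R.
  apply: norm_row_le => [|a]; first by rewrite divr_ge0 // ltW.
  rewrite !mxE -mulrBr -intrB normrM gtr0_norm ?divr_gt0 //.
  rewrite ler_piMr // ?divr_ge0 ?(ltW L_gt0) // /kuhn.
  have -> : X a + (s a < l)%N%:Z - (X a + (s a < 0)%N%:Z) = (s a < l)%N%:Z.
    by rewrite ltn0 addr0 addrC addKr.
  by case: (_ < _)%N; rewrite ?normr1 ?normr0.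
have := iter_lip j _ _ jn : `|iter j S (pt (kuhn X s l)) - iter j S (pt (kuhn X s 0))| <= _.
have : `|iter j S (pt (kuhn X s l)) - lift_pt i z| <=
  `|iter j S (pt (kuhn X s l)) - iter j S (pt (kuhn X s 0))| +
  `|iter j S (pt (kuhn X s 0)) - lift_pt i z| by apply: ler_distD.
have : Lm * `|pt (kuhn X s l) - pt (kuhn X s 0)| <= Lm * (L / n%:R) by rewrite ler_pM2l.
lra.
Qed.

End LusternikSchnirelmann.

(** The zeros are chosen one after the other, each of them outside of the lattice
    translates of the previous ones, which are at most [d.+1]. *)
Lemma many_torus_critical_points (R : realType) (d : nat) (L C : R)
    (Psi : 'rV[R]_d.+1 -> R) (G : 'rV[R]_d.+1 -> 'rV[R]_d.+1) :
  0 < L -> 0 < C ->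
  (forall x z, Psi (x + lat L z) = Psi x) ->
  (forall x z, G (x + lat L z) = G x) ->
  (forall x y,
    Psi y <= Psi x + \sum_i G x ord0 i * (y - x) ord0 i + C * `|y - x| ^+ 2) ->
  (forall x y, `|G y - G x| <= C * `|y - x|) ->
  exists c : 'I_d.+2 -> 'rV[R]_d.+1, (forall a, G (c a) = 0) /\
    forall a b z, c a = c b + lat L z -> a = b.
Proof.
move=> L0 C0 Pp Gp PT GL.
have fresh (p : 'I_d.+1 -> 'rV[R]_d.+1) :
    exists x, G x = 0 /\ forall i z, x <> p i + lat L z.
  apply/not_existsP => h.
  apply: (@gradient_zeros_not_covered R d L C Psi G L0 C0 Pp Gp PT GL p) => x Gx.
  by apply/not_existsP => h'; apply: (h x); split=> // i z; have /forallNP := h' i; apply.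
have latN z : lat L (fun i => - z i) = - lat L z :> 'rV[R]_d.+1.
  by apply/rowP => i; rewrite !mxE mulrNz mulrN.
suff [c [cG cinj]] : exists c : nat -> 'rV[R]_d.+1, (forall a, (a < d.+2)%N -> G (c a) = 0) /\
    forall a b z, (a < b < d.+2)%N -> c b <> c a + lat L z.
  exists (fun a => c a); split=> [a|a b z e]; first exact: cG.
  apply: val_inj; apply/eqP; case: (ltngtP a b) => // ab; exfalso.
    apply: (cinj a b (fun i => - z i)); first by rewrite ab /=.
    by rewrite latN e addrK.
  by apply: (cinj b a z) => //; rewrite ab /=.
have /(_ d.+2 (leqnn _)) : forall m, (m <= d.+2)%N -> exists c : nat -> 'rV[R]_d.+1,
   (forall a, (a < m)%N -> G (c a) = 0) /\
    forall a b z, (a < b < m)%N -> c b <> c a + lat L z.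
  elim=> [_|m IH mk].
    by exists (fun=> 0); split=> // a b z; rewrite ltn0 andbF.
  have [c [cG cinj]] := IH (ltnW mk).
  have [x [Gx hx]] := fresh (fun i => c i).
  exists (fun a => if (a < m)%N then c a else x); split=> [a am|a b z].
    by case: ifP => // h; apply: cG.
  move=> /andP[ab]; rewrite ltnS => bm.
  have am : (a < m)%N by apply: leq_trans ab bm.
  rewrite am; case: ifP => h; first by apply: cinj; rewrite ab.
  have ad : (a < d.+1)%N by rewrite (leq_trans am) // -ltnS.
  exact: (hx (Ordinal ad)).
by [].
Qed.

(** * Primitives *)

Section SignedIntegral.
Variable R : realType.
Implicit Types (h : R -> R) (a b t s T : R).
Notation mu := (@lebesgue_measure R).

(** At most one of the segments has positive length: this is the integral from 0
    to [t] for either sign of [t]. *)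
Definition prim h t : R :=
  \int[mu]_(x in `[0, t]) h x - \int[mu]_(x in `[t, 0]) h x.

Definition integrable_on_segments h :=
  forall a b, mu.-integrable `[a, b] (EFin \o h).

Lemma integral_segment_point h a b : b <= a -> \int[mu]_(x in `[a, b]) h x = 0.
Proof.
rewrite le_eqVlt => /predU1P[->|ba].
  by rewrite set_itv1 /Rintegral integral_set1.
by rewrite set_itv_ge ?bnd_simp -?ltNge // Rintegral_set0.
Qed.

Lemma integral_segmentD h a b c : integrable_on_segments h -> a <= b -> b <= c ->
  \int[mu]_(x in `[a, c]) h x =
  \int[mu]_(x in `[a, b]) h x + \int[mu]_(x in `[b, c]) h x.
Proof.
move=> ih ab bc; have := @Rintegral_itvB R h (BLeft a) (BRight c) b (ih a c).
rewrite !bnd_simp => /(_ ab bc).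
rewrite (@Rintegral_itv_obnd_cbnd R b (BRight c)) //; first by move=> <-; rewrite addrC subrK.
apply: integrableS (ih b c) => //.
by apply: subset_itvr; rewrite bnd_simp.
Qed.

(** Moves the base point to the left of [t] as well as 0, so that the fundamental
    theorem of calculus applies whatever the sign of [t]. *)
Lemma prim_from h a t : integrable_on_segments h -> a <= t -> a <= 0 ->
  prim h t = \int[mu]_(x in `[a, t]) h x - \int[mu]_(x in `[a, 0]) h x.
Proof.
move=> ih at_ a0; rewrite /prim; case: (leP 0 t) => t0.
  by rewrite (@integral_segmentD h a 0 t) // (@integral_segment_point h t 0) //; ring.
by rewrite (@integral_segmentD h a t 0) ?(ltW t0) // (@integral_segment_point h 0 t) ?(ltW t0) //; ring.
Qed.

Lemma prim0 h : prim h 0 = 0.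
Proof. by rewrite /prim subrr. Qed.

Lemma primB h s t : integrable_on_segments h -> s <= t ->
  prim h t - prim h s = \int[mu]_(x in `[s, t]) h x.
Proof.
move=> ih st; pose a := Num.min s 0.
have a0 : a <= 0 by rewrite ge_min lexx orbT.
have as_ : a <= s by rewrite ge_min lexx.
rewrite (@prim_from h a t) ?(le_trans as_ st) // (@prim_from h a s) //.
by rewrite (@integral_segmentD h a s t) //; ring.
Qed.

Lemma prim_integral h T : 0 <= T -> prim h T = \int[mu]_(x in `[0, T]) h x.
Proof. by move=> T0; rewrite /prim (@integral_segment_point h T 0) // subr0. Qed.

Let mshift c : measurable_fun setT ((fun x => x + c) : measurableTypeR R -> measurableTypeR R).
Proof. exact: (measurable_realfun.measurable_funD (@measurable_id _ _ _) (@measurable_cst _ _ _ _ _ c)). Qed.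

Lemma lebesgue_measure_shift c (A : set R) : measurable A ->
  pushforward mu ((fun x => x + c) : measurableTypeR R -> measurableTypeR R) A = mu A.
Proof.
move=> mA; pose phi := (fun x => x + c) : measurableTypeR R -> measurableTypeR R.
pose phi_mix := isMeasurableFun.Build _ _ _ _ phi (mshift c).
pose phi_pack : {mfun measurableTypeR R >-> measurableTypeR R} :=
  MeasurableFun.Pack (MeasurableFun.Class phi_mix).
apply/esym; apply: (@lebesgue_measure_unique R (pushforward mu phi_pack)) => //.
move=> _ [[a b]] _ <-; rewrite [RHS](_ : _ = mu `]a - c, b - c]%classic); last first.
  congr (mu _); apply/seteqP.
  by split=> x; rewrite /phi_pack /= !in_itv /= ltrBlDr lerBrDr.
rewrite !lebesgue_measure_itv /= !lte_fin ltrD2r; case: ifP => // _.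
by rewrite -!EFinD; congr EFin; ring.
Qed.

Lemma integral_segment_shift h a b c : measurable_fun setT h -> integrable_on_segments h ->
  measurable_fun setT (fun x : R => h (x + c)) -> integrable_on_segments (fun x => h (x + c)) ->
  \int[mu]_(x in `[a + c, b + c]) h x = \int[mu]_(x in `[a, b]) h (x + c).
Proof.
move=> mh ih mhc ihc; rewrite /Rintegral; congr fine.
pose phi := (fun x => x + c) : measurableTypeR R -> measurableTypeR R.
have pre : phi @^-1` `[a + c, b + c]%classic = `[a, b]%classic.
  by apply/seteqP; split=> x /=; rewrite !in_itv /= !lerD2r.
pose D := `[a + c, b + c]%classic : set (measurableTypeR R).
transitivity (\int[pushforward mu phi]_(x in D) (h x)%:E)%E.
  apply: eq_measure_integral => [|mphi A mA _]; first exact: mshift.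
  by symmetry; exact: lebesgue_measure_shift.
rewrite (@integral_pushforward _ _ _ _ _ phi (mshift c)) //= ?pre //.
- exact/measurable_realfun.measurable_EFinP.
- exact: measurable_itv.
Qed.

Lemma continuous_integrable h : continuous h -> integrable_on_segments h.
Proof.
move=> ch a b; apply: continuous_compact_integrable; first exact: segment_compact.
exact: continuous_subspaceT.
Qed.

Lemma bounded_integrable h M : measurable_fun setT h -> (forall t, `|h t| <= M) ->
  integrable_on_segments h.
Proof.
move=> mh hM a b.
apply: (@le_integrable _ _ _ mu `[a, b]%classic _ _ (EFin \o cst M)).
- exact: measurable_itv.
- by apply/measurable_realfun.measurable_EFinP; apply: measurable_funTS.
- move=> x _ /=; rewrite lee_fin; apply: le_trans (hM x) _; exact: ler_norm.
- apply: continuous_integrable; exact: cst_continuous.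
Qed.

Lemma is_derive_of_derive1 (F : R -> R) (t d : R) : derivable F t 1 -> derive1 F t = d ->
  is_derive t 1 F d.
Proof. by move=> dF <-; rewrite derive1E; exact: derivableP. Qed.

Lemma is_derive_prim h t : integrable_on_segments h -> lebesgue_pt h t ->
  is_derive t 1 (prim h) (h t).
Proof.
move=> ih ht; pose a := Num.min t 0 - 1.
have at_ : a < t by rewrite ltrBlDr gt_min ltrDl ltr01.
have a0 : a <= 0 by rewrite lerBlDr ge_min lerDl ler01 orbT.
have tt : t < t + 1 by rewrite ltrDl.
have ax : ((BLeft a : itv_bound R) < (BRight t : itv_bound R))%E by rewrite lte_fin.
have := @FTC1_lebesgue_pt R h (BLeft a) t (t + 1) tt (ih a (t + 1)) ax ht.
set F := fun y => _; move=> [dF F't].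
have F'E : is_derive t 1 F (h t) := is_derive_of_derive1 dF F't.
pose c := \int[mu]_(x in `[a, 0]) h x.
apply: (@near_eq_is_derive _ _ _ (F - cst c)); last first.
  by rewrite -[h t]subr0; apply: is_deriveB.
near=> y; rewrite (@prim_from h a) //.
by apply: ltW; near: y; exact: lt_nbhsr.
Unshelve. all: by end_near. Qed.
End SignedIntegral.

Section PrimitiveBounds.
Variable R : realType.
Implicit Types (h : R -> R) (a b t s T : R).
Notation mu := (@lebesgue_measure R).

Lemma is_derive_prim_continuous h t : continuous h -> is_derive t 1 (prim h) (h t).
Proof.
move=> ch; apply: is_derive_prim; first exact: continuous_integrable.
apply: (@continuous_lebesgue_pt R h t setT).
- by split=> //; exact: openT.
- exact: measurableT.
- exact: measurable_realfun.continuous_measurable_fun.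
- exact: ch.
Qed.

Lemma prim_lipschitz h M : measurable_fun setT h -> (forall t, `|h t| <= M) ->
  forall s t, `|prim h t - prim h s| <= M * `|t - s|.
Proof.
move=> mh hM; have ih := bounded_integrable mh hM.
have main s t : s <= t -> `|prim h t - prim h s| <= M * `|t - s|.
  move=> st; rewrite primB // (ger0_norm (_ : 0 <= t - s)) ?subr_ge0 //.
  apply: le_trans (le_normr_Rintegral _ (ih s t)) _; first exact: measurable_itv.
  have -> : M * (t - s) = \int[mu]_(x in `[s, t]) (cst M x).
    rewrite Rintegral_cst //= lebesgue_measure_itv /= lte_fin.
    by case: ltgtP st => // -> _; rewrite subrr.
  apply: le_Rintegral => //.
  - exact: (integrable_abse (ih s t)).
  - by apply: continuous_integrable; exact: cst_continuous.
move=> s t; case: (leP s t) => [/main//|/ltW/main].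
by rewrite distrC (distrC s).
Qed.

Lemma prim_translate h T : (forall t, h (t + T) = h t) -> measurable_fun setT h ->
  integrable_on_segments h -> forall t, prim h (t + T) = prim h t + prim h T.
Proof.
move=> hT mh ih t.
have hTE : (fun x : R => h (x + T)) = h by apply: funext.
have main s u : s <= u -> prim h (u + T) - prim h (s + T) = prim h u - prim h s.
  move=> su; rewrite !primB ?lerD2r // integral_segment_shift ?hTE //.
have : prim h (t + T) - prim h (0 + T) = prim h t - prim h 0.
  case: (leP 0 t) => [/main//|/ltW/main]; lra.
rewrite prim0 add0r; lra.
Qed.

End PrimitiveBounds.

(** * Means and periodic primitives *)

Section Mean.
Variables (R : realType) (T : R).
Hypothesis T_gt0 : 0 < T.
Implicit Types (h g H : R -> R) (t s B : R).

Definition periodic_on h := forall t, h (t + T) = h t.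

Lemma derive0_constant H : (forall t, is_derive t 1 H 0) -> forall t, H t = H 0.
Proof. by move=> dH t; exact: is_derive_0_is_cst. Qed.

Lemma is_derive_continuous H (dH : R -> R) :
  (forall t, is_derive t 1 H (dH t)) -> continuous H.
Proof.
move=> h t; apply: differentiable_continuous.
by apply/derivable1_diffP; exact: (ex_derive (is_derive := h t)).
Qed.

Lemma derive_bound_lipschitz H (dH : R -> R) B :
  (forall t, is_derive t 1 H (dH t)) -> (forall t, `|dH t| <= B) ->
  forall s t, `|H t - H s| <= B * `|t - s|.
Proof.
move=> h hB.
have main s t : s <= t -> `|H t - H s| <= B * `|t - s|.
  move=> st; have [c _ ->] := MVT_segment st (fun x _ => h x)
     (continuous_subspaceT (is_derive_continuous h)).
  by rewrite normrM ler_wpM2r.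
move=> s t; case: (leP s t) => [/main//|/ltW/main].
by rewrite distrC (distrC s).
Qed.

Lemma prim_unique h H : continuous h -> (forall t, is_derive t 1 H (h t)) ->
  forall t, prim h t = H t - H 0.
Proof.
move=> ch dH t.
have := @derive0_constant (prim h - H) _ t.
rewrite /= -[(prim h - H) t]/(prim h t - H t) -[(prim h - H) 0]/(prim h 0 - H 0) prim0.
move=> e; suff : prim h t - H t = 0 - H 0 by lra.
apply: e => s; rewrite -(subrr (h s)); apply: is_deriveB.
exact: is_derive_prim_continuous.
Qed.

Definition mean h : R := prim h T / T.

Lemma mean_derive h H : continuous h -> (forall t, is_derive t 1 H (h t)) ->
  mean h = (H T - H 0) / T.
Proof. by move=> ch dH; rewrite /mean (prim_unique ch dH). Qed.

Lemma prim_linear h g c t : continuous h -> continuous g ->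
  prim (fun s => h s + c * g s) t = prim h t + c * prim g t.
Proof.
move=> ch cg.
have cc : continuous (fun s => h s + c * g s).
  by move=> s; apply: cvgD; [exact: ch|apply: cvgMr; exact: cg].
have dd s : is_derive s 1 (prim h + c \*: prim g) (h s + c * g s).
  apply: is_deriveD; first exact: is_derive_prim_continuous.
  by apply: is_deriveZ; exact: is_derive_prim_continuous.
rewrite (prim_unique cc dd) -[(prim h + c \*: prim g) t]/(prim h t + c * prim g t).
by rewrite -[(prim h + c \*: prim g) 0]/(prim h 0 + c * prim g 0) !prim0; ring.
Qed.

Lemma mean_linear h g c : continuous h -> continuous g ->
  mean (fun s => h s + c * g s) = mean h + c * mean g.
Proof. by move=> ch cg; rewrite /mean prim_linear // mulrDl mulrA. Qed.

Lemma mean_cst c : mean (fun=> c) = c.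
Proof.
have dd t : is_derive t 1 (c \*: id) c.
  by apply: is_derive_eq; rewrite /GRing.scale /= mulr1.
rewrite (mean_derive (@cst_continuous _ _ c) dd).
by rewrite -[(c \*: id) T]/(c * T) -[(c \*: id) 0]/(c * 0) mulr0 subr0 mulfK ?gt_eqF.
Qed.

Lemma meanD h g : continuous h -> continuous g ->
  mean (fun s => h s + g s) = mean h + mean g.
Proof.
move=> ch cg; rewrite -[mean g]mul1r -mean_linear //; congr mean.
by apply: funext => s; rewrite mul1r.
Qed.

Lemma meanB h g : continuous h -> continuous g ->
  mean (fun s => h s - g s) = mean h - mean g.
Proof.
move=> ch cg; rewrite -[mean g]mul1r -mulNr -mean_linear //; congr mean.
by apply: funext => s; rewrite mulN1r.
Qed.

Lemma meanZ c h : continuous h -> mean (fun s => c * h s) = c * mean h.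
Proof.
move=> ch; rewrite -[RHS]add0r -(mean_cst 0) -mean_linear //; last exact: cst_continuous.
by congr mean; apply: funext => s; rewrite add0r.
Qed.

Lemma continuous_mul h g : continuous h -> continuous g -> continuous (fun t => h t * g t).
Proof. by move=> ch cg t; apply: cvgM; [exact: ch|exact: cg]. Qed.

Lemma continuous_sub h g : continuous h -> continuous g -> continuous (fun t => h t - g t).
Proof. by move=> ch cg t; apply: cvgB; [exact: ch|exact: cg]. Qed.

Lemma continuous_add h g : continuous h -> continuous g -> continuous (fun t => h t + g t).
Proof. by move=> ch cg t; apply: cvgD; [exact: ch|exact: cg]. Qed.

Lemma continuous_bigsum (I : Type) (r : seq I) (P : pred I) (F : I -> R -> R) :
  (forall i, continuous (F i)) -> continuous (fun t => \sum_(i <- r | P i) F i t).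
Proof.
move=> cF; elim: r => [|i r IH].
  rewrite (_ : (fun t => _) = cst 0); first exact: cst_continuous.
  by apply: funext => t; rewrite big_nil.
rewrite (_ : (fun t => _) = (fun t => (if P i then F i t else 0) +
   \sum_(j <- r | P j) F j t)).
  apply: continuous_add => //; case: (P i); [exact: cF|exact: cst_continuous].
by apply: funext => t; rewrite big_cons; case: (P i); rewrite ?add0r.
Qed.

Lemma mean_sum (I : finType) (F : I -> R -> R) : (forall i, continuous (F i)) ->
  mean (fun s => \sum_i F i s) = \sum_i mean (F i).
Proof.
move=> cF; elim: (index_enum I) => [|i r IH].
  rewrite big_nil -[RHS](mean_cst 0); congr mean; apply: funext => s; by rewrite big_nil.
rewrite big_cons -IH -meanD.
- by congr mean; apply: funext => s; rewrite big_cons.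
- exact: cF.
- exact: continuous_bigsum.
Qed.

Lemma mean_le h g : continuous h -> continuous g ->
  (forall t, 0 <= t <= T -> h t <= g t) -> mean h <= mean g.
Proof.
move=> ch cg hg; rewrite -subr_ge0 -meanB // /mean divr_ge0 ?(ltW T_gt0) //.
have cB : continuous (fun s => g s - h s) by move=> s; apply: cvgB; [exact: cg|exact: ch].
have dP s := is_derive_prim_continuous s cB.
have [c cT] := MVT_segment (ltW T_gt0) (fun x _ => dP x)
     (continuous_subspaceT (is_derive_continuous dP)).
rewrite prim0 !subr0 => ->; apply: mulr_ge0; last exact: ltW.
by rewrite subr_ge0 hg //; move: cT; rewrite in_itv.
Qed.

Lemma mean_bound h B : continuous h -> (forall t, 0 <= t <= T -> `|h t| <= B) ->
  `|mean h| <= B.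
Proof.
move=> ch hB; rewrite ler_norml; apply/andP; split.
  rewrite -(mean_cst (- B)); apply: mean_le => //; first exact: cst_continuous.
  by move=> t /hB; rewrite ler_norml => /andP[].
rewrite -[leRHS](mean_cst B); apply: mean_le => //; first exact: cst_continuous.
by move=> t /hB; rewrite ler_norml => /andP[].
Qed.

(** The representative [s] of [t] modulo [T] serves all periodic functions at once. *)
Lemma periodic_box t : exists2 s, 0 <= s <= T & forall h, periodic_on h -> h t = h s.
Proof.
pose f := Num.floor (t / T); exists (t - T * f%:~R).
  have := floor_itv (t / T); rewrite -/f ler_pdivlMr // ltr_pdivrMr //.
  by rewrite intrD mulrDl mul1r => /andP[h1 h2]; apply/andP; split; lra.
have pn (n : nat) g s : periodic_on g -> g (s + T * n%:R) = g s.
  move=> gT; elim: n => [|n IH]; first by rewrite mulr0 addr0.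
  by rewrite -[n.+1%:R]natr1 mulrDr mulr1 addrA gT.
move=> g gT; case: f => n.
  by rewrite -{1}(subrK (T * n%:R) t) pn.
rewrite NegzE mulrNz mulrN opprK -pmulrn.
by rewrite pn.
Qed.

(** The primitive of [h - mean h], periodic if [h] is. *)
Definition pprim h t : R := prim h t - t * mean h.
(** The primitive of [h - mean h] of mean zero: the inverse of differentiation on
    periodic functions of mean zero. *)
Definition cprim h t : R := pprim h t - mean (pprim h).

Lemma is_derive_pprim h t : continuous h -> is_derive t 1 (pprim h) (h t - mean h).
Proof.
move=> ch; have -> : pprim h = prim h - mean h \*: id.
  by apply: funext => s; rewrite /pprim mulrC.
apply: is_derive_eq.
  by apply: is_deriveB; exact: is_derive_prim_continuous.
by rewrite /GRing.scale /= mulr1.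
Qed.

Lemma pprim_continuous h : continuous h -> continuous (pprim h).
Proof. move=> ch; apply: is_derive_continuous => t; exact: is_derive_pprim. Qed.

Lemma is_derive_cprim h t : continuous h -> is_derive t 1 (cprim h) (h t - mean h).
Proof.
move=> ch; have -> : cprim h = pprim h - cst (mean (pprim h)) by [].
by rewrite -[X in is_derive _ _ _ X]subr0; apply: is_deriveB; exact: is_derive_pprim.
Qed.

Lemma cprim_continuous h : continuous h -> continuous (cprim h).
Proof. move=> ch; apply: is_derive_continuous => t; exact: is_derive_cprim. Qed.

Lemma pprim_periodic h : continuous h -> periodic_on h -> periodic_on (pprim h).
Proof.
move=> ch hT t; rewrite /pprim prim_translate //.
- by rewrite /mean; field; rewrite gt_eqF.
- exact: measurable_realfun.continuous_measurable_fun.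
- exact: continuous_integrable.
Qed.

Lemma cprim_periodic h : continuous h -> periodic_on h -> periodic_on (cprim h).
Proof. by move=> ch hT t; rewrite /cprim pprim_periodic. Qed.

Lemma mean_cprim h : continuous h -> mean (cprim h) = 0.
Proof.
move=> ch; rewrite /cprim meanB.
- by rewrite mean_cst subrr.
- exact: pprim_continuous.
- exact: cst_continuous.
Qed.

(** [cprim h] averages the increments of [pprim h], whose slope is at most [2 * B],
    over times at most [T]. *)
Lemma cprim_bound h B : continuous h -> periodic_on h -> (forall t, `|h t| <= B) ->
  forall t, `|cprim h t| <= 2 * T * B.
Proof.
move=> ch hT hB t.
have [s sT e] := periodic_box t; rewrite (e _ (cprim_periodic ch hT)).
have B0 : 0 <= B by apply: le_trans (hB 0).
have mB : `|mean h| <= B by apply: mean_bound.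
have co := pprim_continuous ch.
have lip u w : `|pprim h u - pprim h w| <= 2 * B * `|u - w|.
  apply: (derive_bound_lipschitz (fun t => is_derive_pprim t ch)) => x.
  apply: le_trans (ler_normB _ _) _; have := hB x; lra.
have -> : cprim h s = mean (fun u => pprim h s - pprim h u).
  by rewrite meanB ?mean_cst //; exact: cst_continuous.
apply: mean_bound.
  by move=> x; apply: cvgB; [exact: cvg_cst|exact: co].
move=> u uT; apply: le_trans (lip s u) _.
have : `|s - u| <= T by rewrite ler_norml; lra.
move=> /(ler_wpM2l B0); lra.
Qed.

Let subBB (x y z w : R) : (x - y) - (z - w) = (x - z) - (y - w).
Proof. by ring. Qed.

Lemma cprimB h g : continuous h -> continuous g ->
  forall t, cprim (fun s => h s - g s) t = cprim h t - cprim g t.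
Proof.
move=> ch cg.
have oB t : pprim (fun s => h s - g s) t = pprim h t - pprim g t.
  have e : (fun s => h s - g s) = (fun s => h s + (-1) * g s).
    by apply: funext => s; rewrite mulN1r.
  by rewrite /pprim e prim_linear // mean_linear //; ring.
move=> t; have m := meanB (pprim_continuous ch) (pprim_continuous cg).
exact: etrans (congr2 (fun x y => x - y) (oB t) (etrans (congr1 mean (funext oB)) m))
  (subBB _ _ _ _).
Qed.

Let leibniz_swap (x y dx dy : R) : x *: dy + y *: dx = x * dy + dx * y.
Proof. by rewrite /GRing.scale /= [y * dx]mulrC. Qed.

(** The derivative of the product [H * G] has mean zero. *)
Lemma mean_by_parts (h g H G : R -> R) (mh mg : R) :
  continuous h -> continuous g -> continuous H -> continuous G ->
  periodic_on H -> periodic_on G -> mean H = 0 -> mean G = 0 ->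
  (forall t, is_derive (t : R) (1 : R) H (h t - mh)) ->
  (forall t, is_derive (t : R) (1 : R) G (g t - mg)) ->
  mean (fun t => H t * g t) = - mean (fun t => h t * G t).
Proof.
move=> ch cg cH cG HT GT mH mG dH dG.
pose d t := H t * (g t - mg) + (h t - mh) * G t.
have cd : continuous d.
  by apply: continuous_add; apply: continuous_mul => //; apply: continuous_sub => //;
    exact: cst_continuous.
have dHG t : is_derive t 1 (H * G) (d t).
  apply: (is_derive_eq (is_deriveM (dH t) (dG t))); exact: leibniz_swap.
have m0 : mean d = 0.
  rewrite (mean_derive cd dHG) -[(H * G) T]/(H T * G T) -[(H * G) 0]/(H 0 * G 0).
  by rewrite -[in X in X - _](add0r T) HT GT subrr mul0r.
have dE : d = (fun t => (H t * g t + (- mg) * H t) + (h t * G t + (- mh) * G t)).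
  by apply: funext => t; rewrite /d; ring.
have c1 := continuous_mul cH cg; have c2 := continuous_mul ch cG.
move: m0; rewrite dE meanD; last 2 first.
- by apply: continuous_add => //; apply: continuous_mul => //; exact: cst_continuous.
- by apply: continuous_add => //; apply: continuous_mul => //; exact: cst_continuous.
by rewrite !mean_linear // mH mG !mulr0 !addr0 => /eqP; rewrite addr_eq0 => /eqP.
Qed.

Lemma mean_cprim_parts h g : continuous h -> continuous g -> periodic_on h -> periodic_on g ->
  mean (fun t => cprim h t * g t) = - mean (fun t => h t * cprim g t).
Proof.
move=> ch cg hT gT.
exact: mean_by_parts ch cg (cprim_continuous ch) (cprim_continuous cg) (cprim_periodic ch hT)
  (cprim_periodic cg gT) (mean_cprim ch) (mean_cprim cg)
  (fun t => is_derive_cprim t ch) (fun t => is_derive_cprim t cg).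
Qed.

Definition even_on h := forall t, h (- t) = h t.
Definition odd_on h := forall t, h (- t) = - h t.

Lemma is_derive_reflect H (dH : R -> R) t : (forall t, is_derive t 1 H (dH t)) ->
  is_derive t 1 (fun s => H (- s)) (- dH (- t)).
Proof.
move=> h; have := is_derive1_comp (h (- t)) (is_deriveNid t 1).
by rewrite mulrN1.
Qed.

(** The primitive of an odd function is even, so its increment over a period,
    compared at [- T] and at [T], is its own opposite. *)
Lemma mean_odd h : continuous h -> periodic_on h -> odd_on h -> mean h = 0.
Proof.
move=> ch hT ho.
have e : prim h (- T) = prim h T.
  have dd (t : R) : is_derive t 1 (fun s => prim h s - prim h (- s)) 0.
    have := is_deriveB (is_derive_prim_continuous t ch)
      (is_derive_reflect t (fun t => is_derive_prim_continuous t ch)).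
    by rewrite ho opprK subrr.
  by have := derive0_constant dd T; rewrite oppr0 subrr; lra.
have := prim_translate hT (measurable_realfun.continuous_measurable_fun ch)
  (continuous_integrable ch) (- T).
rewrite addNr prim0 e /mean => e2.
have -> : prim h T = 0 by lra.
by rewrite mul0r.
Qed.

(** The derivative of the even part of [cprim h] is zero; so is its mean. *)
Lemma cprim_even h : continuous h -> periodic_on h -> even_on h -> odd_on (cprim h).
Proof.
move=> ch hT he t; have cK := cprim_continuous ch.
have Kd := fun t => is_derive_cprim t ch.
have cN : continuous (fun s => cprim h (- s)) := is_derive_continuous (fun t => is_derive_reflect t Kd).
pose S s := cprim h s + cprim h (- s).
have S_cst s : S s = S 0.
  apply: derive0_constant => u; have := is_deriveD (Kd u) (is_derive_reflect u Kd).
  by rewrite he subrr.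
pose D s := cprim h s - cprim h (- s).
have D0 : mean D = 0.
  apply: mean_odd.
  - exact: continuous_sub.
  - move=> s; have := cprim_periodic ch hT (- s - T); rewrite subrK => e.
    by rewrite /D (cprim_periodic ch hT) [- (s + T)]opprD e.
  - by move=> s; rewrite /D (opprK s); ring.
have S0 : S 0 = 0.
  have -> : S 0 = mean S by rewrite (funext S_cst) mean_cst.
  have -> : S = (fun s => 2 * cprim h s - D s) by apply: funext => s; rewrite /S /D; ring.
  rewrite meanB ?D0 ?meanZ ?mean_cprim ?mulr0 ?subrr //.
  - by apply: continuous_mul => //; exact: cst_continuous.
  - exact: continuous_sub.
have := S_cst t; rewrite S0 /S; lra.
Qed.

Lemma cprim_odd h : continuous h -> periodic_on h -> odd_on h -> even_on (cprim h).
Proof.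
move=> ch hT ho t; have Kd := fun t => is_derive_cprim t ch.
have m0 := mean_odd ch hT ho.
have dd (u : R) : is_derive u 1 (fun s => cprim h s - cprim h (- s)) 0.
  have := is_deriveB (Kd u) (is_derive_reflect u Kd).
  by rewrite ho m0 !subr0 opprK subrr.
by have := derive0_constant dd t; rewrite oppr0 subrr; lra.
Qed.

End Mean.

(** * A pointwise contraction principle *)

Lemma norm_limit_le (R : realType) (v : nat -> R) (l M : R) :
  v @ \oo --> l -> (forall n, `|v n| <= M) -> `|l| <= M.
Proof.
move=> vl vM; apply: (@ler_cvg_to _ eventually eventually_filter _ (fun n => `|v n|) (fun=> M)).
- exact: cvg_norm.
- exact: cvg_cst.
- by near=> n.
Unshelve. all: by end_near. Qed.

Lemma limit_unique (R : realType) (v w : nat -> R) (x y : R) :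
  v @ \oo --> x -> w @ \oo --> y -> (forall n, v n = w n) -> x = y.
Proof. by move=> vx wy /funext vw; move: vx; rewrite vw => vx; exact: (cvg_unique _ vx wy). Qed.

Section Contraction.
Variables (R : realType) (D : Type) (P : (D -> R) -> Prop) (Phi : (D -> R) -> D -> R) (k : R).
Hypothesis k_ge0 : 0 <= k.
Hypothesis k_lt1 : k < 1.
Hypothesis P_closed : forall (u : nat -> D -> R) (l : D -> R),
  (forall n, P (u n)) -> (forall x, (fun n => u n x) @ \oo --> l x) -> P l.
Hypothesis P_stable : forall u, P u -> P (Phi u).
Hypothesis Phi_contracts : forall u w e, P u -> P w -> 0 <= e ->
  (forall x, `|u x - w x| <= e) -> forall x, `|Phi u x - Phi w x| <= k * e.

(** The successive iterates are uniformly close, so the orbit of [u0] converges at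
    every point with the same geometric rate; the pointwise limit remains in [P]
    and is fixed, by the contraction property between it and the orbit. *)
Lemma pointwise_contraction_fixpoint u0 e : P u0 -> 0 <= e ->
  (forall x, `|Phi u0 x - u0 x| <= e) -> exists2 u, P u & Phi u = u.
Proof.
move=> Pu0 e0 he; pose u n := iter n Phi u0.
have Pu n : P (u n) by elim: n => //= n; apply: P_stable.
have step n x : `|u n.+1 x - u n x| <= e * k ^+ n.
  elim: n x => [|n IH] x; first by rewrite expr0 mulr1; exact: he.
  have := Phi_contracts (Pu n.+1) (Pu n) _ IH x.
  by rewrite exprS mulrCA; apply; rewrite mulr_ge0 ?exprn_ge0.
pose S (x : D) : nat -> R := fun n => u n x - u0 x.
have k_norm : `|k| < 1 by rewrite ger0_norm.
have tail n m x : `|u (n + m)%N x - u n x| <= e / (1 - k) * k ^+ n.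
  have k1 : 0 < 1 - k by rewrite subr_gt0.
  suff : `|u (n + m)%N x - u n x| <= e / (1 - k) * (k ^+ n - k ^+ (n + m)).
    move=> /le_trans; apply; rewrite ler_wpM2l ?divr_ge0 ?(ltW k1) //.
    by rewrite gerBl exprn_ge0.
  elim: m => [|m IH]; first by rewrite addn0 !subrr normr0 mulr0.
  rewrite addnS -(subrKA (u (n + m)%N x)).
  apply: le_trans (ler_normD _ _) _; apply: le_trans (lerD (step _ x) IH) _.
  rewrite le_eqVlt exprS; apply/orP; left; apply/eqP; field.
  by rewrite gt_eqF.
have cvg_u x : cvgn (fun n => u n x).
  apply: cauchy_cvg; apply/cauchy_exP => eps eps0 /=.
  have lim0 : (fun n => e / (1 - k) * k ^+ n) @ \oo --> (0 : R).
    by rewrite -[X in _ --> X](mulr0 (e / (1 - k))); apply: cvgMr; exact: cvg_expr.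
  have /cvgrPdist_lt/(_ eps eps0)[n _ hn] := lim0.
  exists (u n x); exists n => // m /= nm; rewrite -ball_normE /= distrC.
  rewrite -(subnKC nm); apply: le_lt_trans (tail _ _ _) _.
  have := hn n (leqnn n); rewrite /= sub0r normrN; apply: le_lt_trans; exact: ler_norm.
pose l x := limn (fun n => u n x).
have ul x : (fun n => u n x) @ \oo --> l x by exact: cvg_u.
have Pl : P l by apply: P_closed ul.
exists l => //; apply: funext => x.
have lim0 c : (fun n => c * k ^+ n) @ \oo --> (0 : R).
  by rewrite -[X in _ --> X](mulr0 c); apply: cvgMr; exact: cvg_expr.
have close n y : `|u n y - l y| <= e / (1 - k) * k ^+ n.
  rewrite distrC; apply: (@ler_cvg_to _ eventually eventually_filter _
    (fun m => `|u (m + n)%N y - u n y|) (fun=> e / (1 - k) * k ^+ n)).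
  - by apply: cvg_norm; apply: cvgB; [rewrite (cvg_shiftn n (fun m => u m y))|exact: cvg_cst].
  - exact: cvg_cst.
  - by near=> m; rewrite addnC; exact: tail.
apply/eqP; rewrite -subr_eq0 -normr_le0.
apply: (@ler_cvg_to _ eventually eventually_filter _ (fun=> `|Phi l x - l x|)
  (fun n => (e / (1 - k) * k + e / (1 - k) * k) * k ^+ n)); last 1 first.
- near=> n; have C0 : 0 <= e / (1 - k) * k ^+ n.
    by rewrite mulr_ge0 ?exprn_ge0 // divr_ge0 // subr_ge0 ltW.
  have h1 := Phi_contracts (Pu n) Pl C0 (close n) x.
  have h2 := close n.+1 x; rewrite exprS in h2.
  have : `|Phi l x - l x| <= `|Phi l x - u n.+1 x| + `|u n.+1 x - l x| by exact: ler_distD.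
  rewrite (distrC (Phi l x) (u n.+1 x)); move: h1 h2; rewrite [Phi (u n)]/(u n.+1).
  set c := e / _; set q := k ^+ n; rewrite (mulrCA k) => h1 h2 h3.
  by apply: (le_trans h3); apply: le_trans (lerD h1 h2) _; rewrite mulrDl -mulrA.
- exact: cvg_cst.
- exact: lim0.
Unshelve. all: by end_near. Qed.
End Contraction.

(** * Trigonometric and product estimates *)

Lemma mean_translate (R : realType) (T : R) (h : R -> R) s : continuous h ->
  periodic_on T h -> mean T (fun t => h (t + s)) = mean T h.
Proof.
move=> ch hT; rewrite /mean; congr (_ / _).
have cs : continuous (fun t => h (t + s)).
  move=> t; apply: (@continuous_comp _ _ _ (fun t => t + s) h); last exact: ch.
  by apply: cvgD; [exact: cvg_id|exact: cvg_cst].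
have dd (t : R) : is_derive t 1 (fun t => prim h (t + s)) (h (t + s)).
  have ds : is_derive t 1 (fun t => t + s) 1.
    by apply: (is_derive_eq (is_deriveD (is_derive_id t 1) (is_derive_cst s t 1))); rewrite addr0.
  by have := @is_derive1_comp R (prim h) (fun t => t + s) t _ _
    (is_derive_prim_continuous (t + s) ch) ds; rewrite mulr1.
have e := prim_translate hT (measurable_realfun.continuous_measurable_fun ch)
  (continuous_integrable ch) s.
by rewrite (prim_unique cs dd) add0r (addrC T) e addrC addKr.
Qed.

Section Trigonometry.
Variable R : realType.
Implicit Types x y w : R.

Lemma sin_lipschitz x y : `|sin y - sin x| <= `|y - x|.
Proof.
rewrite -[leRHS]mul1r.
exact: (derive_bound_lipschitz (fun t => is_derive_sin t) (@cos_max R)).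
Qed.

Lemma cos_lipschitz x y : `|cos y - cos x| <= `|y - x|.
Proof.
rewrite -[leRHS]mul1r; apply: (derive_bound_lipschitz (fun t => is_derive_cos t)).
by move=> t; rewrite normrN; exact: sin_max.
Qed.

Lemma cos_taylor x y : `|cos y - cos x + sin x * (y - x)| <= (y - x) ^+ 2.
Proof.
pose f t := cos t + sin x * t.
have df (t : R) : is_derive t 1 f (- sin t + sin x).
  apply: (@is_deriveD _ _ _ cos (sin x \*: id)).
  by apply: is_derive_eq; rewrite /GRing.scale /= mulr1.
have fE : cos y - cos x + sin x * (y - x) = f y - f x by rewrite /f; ring.
have ineq (z : R) : `|z - x| <= `|y - x| -> `|(- sin z + sin x) * (y - x)| <= (y - x) ^+ 2.
  move=> zx; rewrite normrM -real_normK ?num_real // expr2 ler_wpM2r //.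
  by rewrite addrC distrC; apply: le_trans (sin_lipschitz _ _) zx.
rewrite fE; have cf := is_derive_continuous df.
case: (leP x y) => [xy|/ltW yx].
  have [z] := MVT_segment xy (fun t _ => df t) (continuous_subspaceT cf).
  rewrite in_itv /= => /andP[xz zy] ->; apply: ineq.
  by rewrite !ger0_norm ?subr_ge0 ?lerD2r.
have [z] := MVT_segment yx (fun t _ => df t) (continuous_subspaceT cf).
rewrite in_itv /= => /andP[yz zx] e.
have -> : f y - f x = (- sin z + sin x) * (y - x) by move: e; lra.
by apply: ineq; rewrite !ler0_norm ?subr_le0 // lerN2 lerD2r.
Qed.

(** The derivative [1 - cos z = 2 (sin (z / 2))^2] is at most 1/2 for [`|z| <= 1].
    This is what makes the phases of resting links contract. *)
Lemma sub_sin_lipschitz x y : `|x| <= 1 -> `|y| <= 1 ->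
  `|(y - sin y) - (x - sin x)| <= `|y - x| / 2.
Proof.
pose f (t : R) := t - sin t.
have df (t : R) : is_derive t 1 f (1 - cos t) by apply: is_deriveB.
have cf := is_derive_continuous df.
have small (z : R) : `|z| <= 1 -> 0 <= 1 - cos z <= 1 / 2.
  move=> z1; rewrite subr_ge0 cos_le1 /=.
  have -> : cos z = 1 - 2 * sin (z / 2) ^+ 2.
    have {1}-> : z = (z / 2) *+ 2 by rewrite mulr2n; field.
    by rewrite cos_mulr2n cos2sin2; ring.
  have h : `|sin (z / 2)| <= 1 / 2.
    have := sin_lipschitz 0 (z / 2); rewrite sin0 !subr0 => /le_trans; apply.
    by rewrite normrM (ger0_norm (_ : 0 <= 2^-1)) ?invr_ge0 // ler_wpM2r ?invr_ge0.
  have : `|sin (z / 2)| ^+ 2 <= (1 / 2) ^+ 2 by rewrite lerXn2r // nnegrE ?normr_ge0 ?divr_ge0.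
  rewrite real_normK ?num_real //; lra.
move=> x1 y1.
wlog xy : x y x1 y1 / x <= y.
  move=> h; case: (leP x y) => [|/ltW] xy; first exact: h.
  by rewrite distrC (distrC y); apply: h.
have [z] := MVT_segment xy (fun t _ => df t) (continuous_subspaceT cf).
rewrite in_itv /= => /andP[xz zy]; rewrite /f => ->.
have /small/andP[h0 h1] : `|z| <= 1 by move: x1 y1; rewrite !ler_norml; lra.
by rewrite normrM ger0_norm // mulrC ler_wpM2l //; lra.
Qed.

Lemma sinD2pin x (n : int) : sin (x + 2 * pi * n%:~R) = sin x.
Proof.
have main (m : nat) y : sin (y + 2 * pi * m%:R) = sin y.
  have -> : 2 * pi * m%:R = (pi *+ 2) *+ m :> R by rewrite -mulr_natr; ring.
  exact: (periodicn (@sinD2pi R)).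
case: n => n; first exact: main.
by rewrite NegzE mulrNz mulrN -[LHS](main n.+1) subrK.
Qed.

Lemma cosD2pin x (n : int) : cos (x + 2 * pi * n%:~R) = cos x.
Proof.
have main (m : nat) y : cos (y + 2 * pi * m%:R) = cos y.
  have -> : 2 * pi * m%:R = (pi *+ 2) *+ m :> R by rewrite -mulr_natr; ring.
  exact: (periodicn (@cosD2pi R)).
case: n => n; first exact: main.
by rewrite NegzE mulrNz mulrN -[LHS](main n.+1) subrK.
Qed.

Lemma continuous_sin_comp (f : R -> R) : continuous f -> continuous (fun t => sin (f t)).
Proof. by move=> cf t; apply: (@continuous_comp _ _ _ f sin); [exact: cf|exact: continuous_sin]. Qed.

Lemma continuous_cos_comp (f : R -> R) : continuous f -> continuous (fun t => cos (f t)).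
Proof. by move=> cf t; apply: (@continuous_comp _ _ _ f cos); [exact: cf|exact: continuous_cos]. Qed.

Lemma lipschitz_continuous (f : R -> R) L :
  (forall s t, `|f t - f s| <= L * `|t - s|) -> continuous f.
Proof.
move=> fL t; apply/cvgrPdist_lt => e e0; near=> s.
have L1 : 0 < `|L| + 1 by rewrite ltr_wpDl.
have h : `|t - s| < e / (`|L| + 1).
  by near: s; apply: (@cvgr_dist_lt _ _ _ _ _ id t) => //; rewrite divr_gt0.
apply: le_lt_trans (fL _ _) _; apply: (@le_lt_trans _ _ ((`|L| + 1) * `|t - s|)).
  by rewrite ler_wpM2r //; have := ler_norm L; lra.
by rewrite mulrC -ltr_pdivlMr.
Unshelve. all: by end_near. Qed.

Lemma weighted_sum_bound (I : finType) (c X : I -> R) M :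
  (forall j, 0 <= c j) -> (forall j, `|X j| <= M) ->
  `|\sum_j c j * X j| <= (\sum_j c j) * M.
Proof.
move=> c0 XM; apply: le_trans (ler_norm_sum _ _ _) _; rewrite mulr_suml.
by apply: ler_sum => j _; rewrite normrM ger0_norm // ler_wpM2l.
Qed.

Lemma weighted_sumB_bound (I : finType) (c X Y : I -> R) M :
  (forall j, 0 <= c j) -> (forall j, `|X j - Y j| <= M) ->
  `|\sum_j c j * X j - \sum_j c j * Y j| <= (\sum_j c j) * M.
Proof.
move=> c0 XM; rewrite -sumrB; under eq_bigr do rewrite -mulrBr.
exact: weighted_sum_bound.
Qed.

Lemma mul_bound (x y X Y : R) : `|x| <= X -> `|y| <= Y -> `|x * y| <= X * Y.
Proof. by move=> xX yY; rewrite normrM; apply: ler_pM. Qed.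

Lemma mulB_bound (x y x' y' X Y dx dy : R) : `|x'| <= X -> `|y| <= Y ->
  `|x' - x| <= dx -> `|y' - y| <= dy -> `|x' * y' - x * y| <= dx * Y + X * dy.
Proof.
move=> hx hy hdx hdy.
have -> : x' * y' - x * y = (x' - x) * y + x' * (y' - y) by ring.
by apply: le_trans (ler_normD _ _) _; apply: lerD; apply: mul_bound.
Qed.

Lemma subB_bound (x y x' y' dx dy : R) : `|x' - x| <= dx -> `|y' - y| <= dy ->
  `|x' - y' - (x - y)| <= dx + dy.
Proof.
move=> hx hy; have -> : x' - y' - (x - y) = (x' - x) - (y' - y) by ring.
by apply: le_trans (ler_normB _ _) _; apply: lerD.
Qed.

Lemma subB_mid (x v k x' k' : R) : x + v + k - (x' + v + k') = (x - x') + (k - k').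
Proof. by ring. Qed.

Lemma subB_left (f x y x' y' : R) : f + x - y - (f + x' - y') = (x - x') - (y - y').
Proof. by ring. Qed.

Lemma subB_scaled (a x y x' y' : R) :
  - (a * x) - y - (- (a * x') - y') = - (a * (x - x')) - (y - y').
Proof. by ring. Qed.

(** The three contributions are at most 17/32, 2/32 and 6/32 of [d]. *)
Lemma pendulum_step_bound (z k X z' k' X' d : R) :
  `|z + k| <= 1 -> `|z' + k'| <= 1 -> `|z - z'| <= d -> `|k - k'| <= d / 16 ->
  `|X - X'| <= 6 / 32 * d ->
  `|z + k - sin (z + k) - (k + X) - (z' + k' - sin (z' + k') - (k' + X'))| <= 7 / 8 * d.
Proof.
move=> zk1 zk1' hz hk hX; have h1 := sub_sin_lipschitz zk1' zk1.
have hzk : `|z + k - (z' + k')| <= d + d / 16.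
  have -> : z + k - (z' + k') = (z - z') + (k - k') by ring.
  by apply: le_trans (ler_normD _ _) _; lra.
set s := sin (z + k); set s' := sin (z' + k').
have -> : z + k - s - (k + X) - (z' + k' - s' - (k' + X')) =
   (z + k - s - (z' + k' - s')) - ((k - k') + (X - X')) by ring.
apply: le_trans (ler_normB _ _) _.
by have := ler_normD (k - k') (X - X'); have := normr_ge0 (z - z'); rewrite -/s -/s' in h1; lra.
Qed.

Lemma addr_shift (x s v k : R) : x + s + v + k = x + v + k + s.
Proof. by ring. Qed.

Lemma subB_multiple (x y k : R) (m n : int) :
  (x + k * m%:~R) - (y + k * n%:~R) = (x - y) + k * (m - n)%:~R.
Proof. by rewrite intrB; ring. Qed.

Lemma subBN_multiple (x y k : R) (m n : int) :
  (- x + k * m%:~R) - (- y + k * n%:~R) = - (x - y) + k * (m - n)%:~R.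
Proof. by rewrite intrB; ring. Qed.

Lemma mulNr_middle (c x y : R) : c * (- x * y) = - (c * (x * y)).
Proof. by ring. Qed.

Lemma oddB_scaled (a x y : R) : - (a * - x) - - y = - (- (a * x) - y).
Proof. by ring. Qed.

Lemma mulrD_swap (x y z : R) : x * (y + z) = x * z + y * x.
Proof. by ring. Qed.

Lemma rotate_sum (x v t s k : R) : x + v * (t + s) + k = x + v * t + k + v * s.
Proof. by ring. Qed.

Lemma phase_sum (x x' v t s k k' z : R) : x' + v * t + k' = x + v * (t + s) + k + z ->
  k' = (x + v * s + z - x') + k.
Proof. by lra. Qed.

End Trigonometry.

(** * Second-order bound for the Lagrangian *)

Section LagrangianTaylor.
Variable R : realType.

(** The remainder is a sum of three terms that are quadratic in the increments, at
    most 16, 8 and 1 times [B ^+ 2 * h ^+ 2]. *)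
Lemma pair_taylor (s s' p r p' r' B h : R) : 1 <= B ->
  `|p| <= B -> `|r| <= B -> `|p'| <= B -> `|r'| <= B ->
  `|p' - p| <= h -> `|r' - r| <= h -> `|s' - s| <= 4 * h ->
  cos s' * (p' * r') - cos s * (p * r) <=
  - sin s * (s' - s) * (p * r) + cos s * ((p' - p) * r + p * (r' - r)) + 25 * B ^+ 2 * h ^+ 2.
Proof.
move=> B1 pB rB pB' rB' hp hr hs.
have B0 : 0 <= B by lra.
have h0 : 0 <= h by apply: le_trans hp.
have -> : cos s' * (p' * r') - cos s * (p * r) =
  - sin s * (s' - s) * (p * r) + cos s * ((p' - p) * r + p * (r' - r)) +
  ((cos s' - cos s + sin s * (s' - s)) * (p' * r')
   - sin s * ((s' - s) * (p' * r' - p * r)) + cos s * ((p' - p) * (r' - r))) by ring.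
rewrite lerD2l.
have e1 : `|(cos s' - cos s + sin s * (s' - s)) * (p' * r')| <= (16 * h ^+ 2) * (B * B).
  apply: mul_bound; last exact: mul_bound.
  apply: le_trans (cos_taylor _ _) _; rewrite -real_normK ?num_real //.
  have -> : 16 * h ^+ 2 = (4 * h) ^+ 2 by ring.
  by rewrite lerXn2r // nnegrE mulr_ge0.
have e2 : `|sin s * ((s' - s) * (p' * r' - p * r))| <= 1 * (4 * h * (h * B + B * h)).
  by apply: mul_bound; [exact: sin_max|apply: mul_bound => //; exact: mulB_bound].
have e3 : `|cos s * ((p' - p) * (r' - r))| <= 1 * (h * h).
  by apply: mul_bound; [exact: cos_max|exact: mul_bound].
have h2 : 0 <= h * h by rewrite mulr_ge0.
have B2 : B <= B * B by rewrite ler_peMl.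
have BB : 1 <= B * B by lra.
have hB : h * h * B <= h * h * (B * B) by rewrite ler_wpM2l.
have hBB : h * h <= h * h * (B * B) by rewrite ler_peMr.
move: e1 e2 e3; rewrite !ler_norml !expr2 => /andP[_ e1] /andP[e2 _] /andP[_ e3].
lra.
Qed.

Variables (N : nat) (rho a : 'I_N -> R) (c : 'I_N -> 'I_N -> R).
Hypothesis rho_ge0 : forall i, 0 <= rho i.
Hypothesis a_ge0 : forall i, 0 <= a i.
Hypothesis c_ge0 : forall i j, 0 <= c i j.
Hypothesis rho_sym : forall i j, rho i * c i j = rho j * c j i.
Implicit Types q p f : 'I_N -> R.

(** The force enters through its primitive [f]: up to a total derivative,
    [- f p] is the potential [f' q]. *)
Definition lagr q p f : R :=
  \sum_i rho i * (p i ^+ 2 / 2 + a i * cos (q i) - f i * p i) +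
  2^-1 * \sum_i \sum_j rho i * c i j * (cos (q i - q j) * (p i * p j)).

Definition lagr_curvature (B : R) : R :=
  \sum_i rho i * (2^-1 + 4 * a i) +
  2^-1 * \sum_i \sum_j rho i * c i j * (25 * B ^+ 2).

(** The linear term pairs the momentum with the variation of the velocity and the
    torque with the variation of the angle.  The pair terms are symmetric in [i] and
    [j] by [rho_sym], which compensates the factor 1/2 of [lagr]. *)
Lemma lagr_taylor q p q' p' f (B h : R) : 1 <= B -> 0 <= h ->
  (forall i, `|p i| <= B) -> (forall i, `|p' i| <= B) ->
  (forall i, `|p' i - p i| <= h) -> (forall i, `|q' i - q i| <= 2 * h) ->
  lagr q' p' f <= lagr q p f +
   \sum_i rho i * ((p i + \sum_j c i j * (cos (q i - q j) * p j) - f i) * (p' i - p i) +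
      (- (a i * sin (q i)) - \sum_j c i j * (sin (q i - q j) * (p i * p j))) * (q' i - q i))
   + lagr_curvature B * h ^+ 2.
Proof.
move=> B1 h0 pB pB' hp hq.
pose X i j := rho i * c i j * (- (sin (q i - q j) * (p i * p j)) * (q' i - q i)
    + cos (q i - q j) * p j * (p' i - p i)).
have diag i : rho i * (p' i ^+ 2 / 2 + a i * cos (q' i) - f i * p' i) <=
  rho i * (p i ^+ 2 / 2 + a i * cos (q i) - f i * p i) +
  rho i * ((p i - f i) * (p' i - p i) - a i * sin (q i) * (q' i - q i)) +
  rho i * (2^-1 + 4 * a i) * h ^+ 2.
  suff key : p' i ^+ 2 / 2 + a i * cos (q' i) - f i * p' i <=
    (p i ^+ 2 / 2 + a i * cos (q i) - f i * p i) +
    ((p i - f i) * (p' i - p i) - a i * sin (q i) * (q' i - q i)) +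
    (2^-1 + 4 * a i) * h ^+ 2.
    by have := ler_wpM2l (rho_ge0 i) key; rewrite [in leRHS]mulrDr [in leRHS]mulrDr mulrA.
  have sq1 : (p' i - p i) ^+ 2 <= h ^+ 2.
    by rewrite -real_normK ?num_real // lerXn2r // nnegrE.
  have sq2 : (q' i - q i) ^+ 2 <= 4 * h ^+ 2.
    rewrite -real_normK ?num_real // (_ : 4 * h ^+ 2 = (2 * h) ^+ 2); last by ring.
    by rewrite lerXn2r // nnegrE mulr_ge0.
  have := cos_taylor (q i) (q' i); rewrite ler_norml => /andP[_] ct.
  have := ler_wpM2l (a_ge0 i) (le_trans ct sq2).
  lra.
have off i j : rho i * c i j * (cos (q' i - q' j) * (p' i * p' j)) <=
  rho i * c i j * (cos (q i - q j) * (p i * p j)) + (X i j + X j i)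
   + rho i * c i j * (25 * B ^+ 2) * h ^+ 2.
  have e0 : 0 <= rho i * c i j by rewrite mulr_ge0.
  have hs : `|q' i - q' j - (q i - q j)| <= 4 * h.
    by apply: le_trans (subB_bound (hq i) (hq j)) _; lra.
  have := ler_wpM2l e0 (pair_taylor B1 (pB i) (pB j) (pB' i) (pB' j) (hp i) (hp j) hs).
  have -> : X i j + X j i = rho i * c i j *
    (- sin (q i - q j) * (q' i - q' j - (q i - q j)) * (p i * p j) +
     cos (q i - q j) * ((p' i - p i) * p j + p i * (p' j - p j))).
    rewrite /X (rho_sym j i) -(opprB (q i) (q j)) sinN cosN; ring.
  lra.
have sumX : \sum_i \sum_j (X i j + X j i) = 2 * \sum_i \sum_j X i j.
  under eq_bigr do rewrite big_split /=.
  by rewrite big_split /= [X in _ + X]exchange_big /=; ring.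
have grad : \sum_i rho i * ((p i + \sum_j c i j * (cos (q i - q j) * p j) - f i) * (p' i - p i) +
      (- (a i * sin (q i)) - \sum_j c i j * (sin (q i - q j) * (p i * p j))) * (q' i - q i)) =
   \sum_i rho i * ((p i - f i) * (p' i - p i) - a i * sin (q i) * (q' i - q i)) +
   \sum_i \sum_j X i j.
  rewrite -big_split /=; apply: eq_bigr => i _.
  have -> : \sum_j X i j = rho i * ((\sum_j c i j * (cos (q i - q j) * p j)) * (p' i - p i)
     - (\sum_j c i j * (sin (q i - q j) * (p i * p j))) * (q' i - q i)).
    rewrite !mulr_suml -sumrB mulr_sumr; apply: eq_bigr => j _; rewrite /X; ring.
  ring.
have s1 : \sum_i rho i * (p' i ^+ 2 / 2 + a i * cos (q' i) - f i * p' i) <=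
    \sum_i rho i * (p i ^+ 2 / 2 + a i * cos (q i) - f i * p i) +
    \sum_i rho i * ((p i - f i) * (p' i - p i) - a i * sin (q i) * (q' i - q i)) +
    (\sum_i rho i * (2^-1 + 4 * a i)) * h ^+ 2.
  by rewrite mulr_suml -!big_split; apply: ler_sum => i _.
have s2 : \sum_i \sum_j rho i * c i j * (cos (q' i - q' j) * (p' i * p' j)) <=
    \sum_i \sum_j rho i * c i j * (cos (q i - q j) * (p i * p j)) +
    \sum_i \sum_j (X i j + X j i) +
    (\sum_i \sum_j rho i * c i j * (25 * B ^+ 2)) * h ^+ 2.
  rewrite mulr_suml -!big_split; apply: ler_sum => i _.
  by rewrite mulr_suml -!big_split; apply: ler_sum => j _.
rewrite sumX in s2.
rewrite grad /lagr /lagr_curvature mulrDl.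
lra.
Qed.
End LagrangianTaylor.

(** * The fixed-point equation *)

(** Link [i] has mean angular velocity [V i], gravity coefficient [a i], couplings
    [c i j] and impulse [F i], bounded by [phi i].  The links in [zero] rest near
    the equilibrium [base i], a zero of the sine.  All velocities are bounded by [B],
    and their fluctuations are sought below [amp i]: [amp_ge] makes [Phi] reproduce
    this bound, and [coupling_small] keeps the couplings from driving the phases of
    the resting links away from [base]. *)
Section System.
Variables (R : realType) (N : nat) (T : R).
Variables (V a amp phi base : 'I_N -> R) (c : 'I_N -> 'I_N -> R).
Variables (F : 'I_N -> R -> R) (zero : pred 'I_N) (B LF : R).
Hypothesis T_gt0 : 0 < T.
Hypothesis T_le : T <= 1 / 32.
Hypothesis amp_gt0 : forall i, 0 < amp i.
Hypothesis amp_le1 : forall i, amp i <= 1.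
Hypothesis a_gt0 : forall i, 0 < a i.
Hypothesis a_le1 : forall i, a i <= 1.
Hypothesis c_ge0 : forall i j, 0 <= c i j.
Hypothesis V_le : forall i, `|V i| + 1 <= B.
Hypothesis V_zero : forall i, zero i -> V i = 0.
Hypothesis V_period : forall i, exists n : int, V i * T = 2 * pi * n%:~R.
Hypothesis F_periodic : forall i, periodic_on T (F i).
Hypothesis F_le : forall i t, `|F i t| <= phi i.
Hypothesis F_lip : forall i s t, `|F i t - F i s| <= LF * `|t - s|.
Notation csum i := (\sum_j c i j).
Hypothesis amp_ge : forall i,
  16 * T * a i + 48 * B ^+ 2 * csum i + 4 * phi i <= amp i.
Hypothesis coupling_small : forall i, zero i -> 32 * csum i * amp i * B <= a i.
Hypothesis base_sin : forall i, zero i -> sin (base i) = 0.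

(** A state collects the fluctuations of the angular velocities, at [inl (i, t)], and
    the phases, at [inr i].  The fluctuations of link [i] are counted in units of
    [amp i]: the links live on very different scales, and in these units a single
    pointwise bound controls all of them. *)
Notation state := (('I_N * R) + 'I_N -> R)%type.
Implicit Types (u w : state) (eta : 'I_N -> R) (i j : 'I_N) (t s : R).

Definition fluct u i t : R := amp i * u (inl (i, t)).
Definition phase u i : R := u (inr i).
Definition angle u i t : R := phase u i + V i * t + cprim T (fluct u i) t.
Definition angvel u i t : R := V i + fluct u i t.
Definition cross_momentum u i t : R := \sum_j c i j * (cos (angle u i t - angle u j t) * angvel u j t).
Definition cross_torque u i t : R :=
  \sum_j c i j * (sin (angle u i t - angle u j t) * (angvel u i t * angvel u j t)).
Definition torque u i t : R := - (a i * sin (angle u i t)) - cross_torque u i t.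
(** For a solution, [angvel + cross_momentum - F] is a primitive of the torque, so
    that the fluctuation of the velocity is the balance minus its mean. *)
Definition balance u i t : R := F i t + cprim T (torque u i) t - cross_momentum u i t.

(** The phase of a resting link is moved in proportion to its mean torque, with the
    sign [cos (base i)] of the linearized gravity, hence towards a zero of the mean
    torque at the stable as well as at the unstable equilibrium. *)
Definition Phi eta u : state := fun d =>
  match d with
  | inl (i, t) => (balance u i t - mean T (balance u i)) / amp i
  | inr i => if zero i then phase u i + cos (base i) * mean T (torque u i) / a i else eta i
  end.

(** A Lipschitz constant for the fluctuations that [Phi] reproduces: the part of
    the new constant that comes from the old one carries the small factor
    [\sum_j c i j]. *)
Definition Lam : R := 2 * LF + 10 * B ^+ 2.

Definition admissible u : Prop :=
  [/\ forall i s t, `|fluct u i t - fluct u i s| <= Lam * `|t - s|,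
      forall i t, u (inl (i, t + T)) = u (inl (i, t)),
      forall i t, `|u (inl (i, t))| <= 1 &
      forall i, zero i -> `|phase u i - base i| <= 1 / 2].

Let csum_ge0 i : 0 <= csum i.
Proof. by apply: sumr_ge0. Qed.

Let B_ge1 i : 1 <= B.
Proof. by have := V_le i; have := normr_ge0 (V i); lra. Qed.

Let phi_ge0 i : 0 <= phi i.
Proof. exact: le_trans (normr_ge0 _) (F_le i 0). Qed.

Let LF_ge0 i : 0 <= LF.
Proof. by have := F_lip i 0 1; rewrite subr0 normr1 mulr1; apply: le_trans. Qed.

Let csum_small i : 48 * B ^+ 2 * csum i <= 1.
Proof.
have := amp_ge i; have := amp_le1 i; have := phi_ge0 i.
have : 0 <= T * a i by rewrite mulr_ge0 // ltW.
lra.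
Qed.

Let csum_B i : csum i * B <= csum i * B ^+ 2.
Proof. by rewrite ler_wpM2l // expr2 ler_peMl ?B_ge1 // (le_trans ler01) // B_ge1. Qed.

Let csum_1 i : csum i <= csum i * B ^+ 2.
Proof. by rewrite ler_peMr // expr_ge1 // ?B_ge1 // (le_trans ler01) // B_ge1. Qed.

Let B_ge0 i : 0 <= B. Proof. by have := B_ge1 i; lra. Qed.

Section Admissible.
Variable u : state.
Hypothesis uA : admissible u.

Lemma fluct_continuous i : continuous (fluct u i).
Proof. by case: uA => h _ _ _; exact: lipschitz_continuous (h i). Qed.

Lemma fluct_periodic i : periodic_on T (fluct u i).
Proof. by case: uA => _ h _ _ t; rewrite /fluct h. Qed.

Lemma fluct_le i t : `|fluct u i t| <= amp i.
Proof.
case: uA => _ _ h _; rewrite /fluct normrM gtr0_norm // -[leRHS]mulr1.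
by rewrite ler_pM2l.
Qed.

Lemma angvel_continuous i : continuous (angvel u i).
Proof. by apply: continuous_add; [exact: cst_continuous|exact: fluct_continuous]. Qed.

Lemma angvel_periodic i : periodic_on T (angvel u i).
Proof. by move=> t; rewrite /angvel fluct_periodic. Qed.

Lemma angvel_le i t : `|angvel u i t| <= B.
Proof.
apply: le_trans (ler_normD _ _) _; have := fluct_le i t; have := V_le i.
by have := amp_le1 i; lra.
Qed.

Lemma angvel_zero_le i t : zero i -> `|angvel u i t| <= amp i.
Proof. by move=> /V_zero V0; rewrite /angvel V0 add0r; exact: fluct_le. Qed.

Lemma cprim_fluct_le i t : `|cprim T (fluct u i) t| <= amp i / 16.
Proof.
have := cprim_bound T_gt0 (@fluct_continuous i) (fluct_periodic i) (fluct_le i) t.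
have : T * amp i <= 1 / 32 * amp i by rewrite ler_wpM2r // ltW.
lra.
Qed.

Lemma is_derive_angle i t : is_derive t 1 (angle u i) (V i + (fluct u i t - mean T (fluct u i))).
Proof.
have -> : angle u i = (cst (phase u i) + V i \*: id) + cprim T (fluct u i) by [].
apply: (is_derive_eq (is_deriveD (is_deriveD (is_derive_cst _ t 1)
  (is_deriveZ (V i) (is_derive_id t 1))) (is_derive_cprim T t (@fluct_continuous i)))).
by rewrite add0r /GRing.scale /= mulr1.
Qed.

Lemma angle_continuous i : continuous (angle u i).
Proof. exact: is_derive_continuous (is_derive_angle i). Qed.

Lemma angle_translate i t : exists n : int, angle u i (t + T) = angle u i t + 2 * pi * n%:~R.
Proof.
have [n hn] := V_period i; exists n.
rewrite /angle cprim_periodic //; [|exact: fluct_continuous|exact: fluct_periodic].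
by rewrite mulrDr hn; ring.
Qed.

Lemma angleB_translate i j t : exists n : int,
  angle u i (t + T) - angle u j (t + T) = angle u i t - angle u j t + 2 * pi * n%:~R.
Proof.
have [n ->] := angle_translate i t; have [m ->] := angle_translate j t.
by exists (n - m); rewrite intrB mulrBr opprD addrACA.
Qed.

Lemma angleB_continuous i j : continuous (fun t => angle u i t - angle u j t).
Proof. by apply: continuous_sub; exact: angle_continuous. Qed.

Lemma cross_momentum_continuous i : continuous (cross_momentum u i).
Proof.
apply: continuous_bigsum => j; apply: continuous_mul; first exact: cst_continuous.
apply: continuous_mul; last exact: angvel_continuous.
by apply: continuous_cos_comp; exact: angleB_continuous.
Qed.

Lemma cross_torque_continuous i : continuous (cross_torque u i).
Proof.
apply: continuous_bigsum => j; apply: continuous_mul; first exact: cst_continuous.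
apply: continuous_mul; last by apply: continuous_mul; exact: angvel_continuous.
by apply: continuous_sin_comp; exact: angleB_continuous.
Qed.

Lemma torque_continuous i : continuous (torque u i).
Proof.
apply: continuous_sub; last exact: cross_torque_continuous.
move=> t; apply: cvgN; move: t; apply: continuous_mul; first exact: cst_continuous.
by apply: continuous_sin_comp; exact: angle_continuous.
Qed.

Lemma F_continuous i : continuous (F i).
Proof. exact: lipschitz_continuous (F_lip i). Qed.

Lemma balance_continuous i : continuous (balance u i).
Proof.
apply: continuous_sub; last exact: cross_momentum_continuous.
apply: continuous_add; first exact: F_continuous.
by apply: cprim_continuous; exact: torque_continuous.
Qed.

Lemma cross_momentum_periodic i : periodic_on T (cross_momentum u i).
Proof.
move=> t; apply: eq_bigr => j _; have [n ->] := angleB_translate i j t.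
by rewrite cosD2pin angvel_periodic.
Qed.

Lemma cross_torque_periodic i : periodic_on T (cross_torque u i).
Proof.
move=> t; apply: eq_bigr => j _; have [n ->] := angleB_translate i j t.
by rewrite sinD2pin !angvel_periodic.
Qed.

Lemma torque_periodic i : periodic_on T (torque u i).
Proof.
move=> t; rewrite /torque cross_torque_periodic; have [n ->] := angle_translate i t.
by rewrite sinD2pin.
Qed.

Lemma balance_periodic i : periodic_on T (balance u i).
Proof.
move=> t; rewrite /balance F_periodic cross_momentum_periodic cprim_periodic //.
  exact: torque_continuous.
exact: torque_periodic.
Qed.

Lemma cross_momentum_le i t : `|cross_momentum u i t| <= csum i * B.
Proof.
apply: weighted_sum_bound => // j; rewrite -[leRHS]mul1r; apply: mul_bound.
  exact: cos_max.
exact: angvel_le.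
Qed.

Lemma cross_torque_le i t M : `|angvel u i t| <= M -> `|cross_torque u i t| <= csum i * (M * B).
Proof.
move=> pM; apply: weighted_sum_bound => // j; rewrite -[leRHS]mul1r; apply: mul_bound.
  exact: sin_max.
by apply: mul_bound => //; exact: angvel_le.
Qed.

Lemma torque_le i t : `|torque u i t| <= a i + csum i * B ^+ 2.
Proof.
apply: le_trans (ler_normB _ _) _; rewrite normrN; apply: lerD.
  rewrite normrM gtr0_norm // -[leRHS]mulr1 ler_pM2l //; exact: sin_max.
by rewrite expr2; apply: cross_torque_le; exact: angvel_le.
Qed.

Lemma balance_le i t : `|balance u i t| <= amp i / 2.
Proof.
apply: le_trans (ler_normB _ _) _.
have h1 := cross_momentum_le i t.
have := ler_normD (F i t) (cprim T (torque u i) t); have := F_le i t.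
have := cprim_bound T_gt0 (@torque_continuous i) (torque_periodic i) (torque_le i) t.
have := amp_ge i; have := csum_B i; have := phi_ge0 i.
have : 0 <= T * a i by rewrite mulr_ge0 // ltW.
have : T * (csum i * B ^+ 2) <= 1 / 32 * (csum i * B ^+ 2).
  by rewrite ler_wpM2r // mulr_ge0 // sqr_ge0.
have : 0 <= csum i * B ^+ 2 by rewrite mulr_ge0 // sqr_ge0.
lra.
Qed.

Lemma angle_lip i s t : `|angle u i t - angle u i s| <= 2 * B * `|t - s|.
Proof.
apply: (derive_bound_lipschitz (is_derive_angle i)) => x.
have m1 : `|mean T (fluct u i)| <= amp i.
  by apply: (mean_bound T_gt0); [exact: fluct_continuous|move=> y _; exact: fluct_le].
apply: le_trans (ler_normD _ _) _.
have := ler_normB (fluct u i x) (mean T (fluct u i)); have := fluct_le i x.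
by have := V_le i; have := amp_le1 i; have := B_ge1 i; lra.
Qed.

Lemma balance_lip i s t : `|balance u i t - balance u i s| <= Lam * `|t - s|.
Proof.
case: (uA) => rlip _ _ _.
have ts0 := normr_ge0 (t - s).
have hK : `|cprim T (torque u i) t - cprim T (torque u i) s| <= 2 * (a i + csum i * B ^+ 2) * `|t - s|.
  apply: (derive_bound_lipschitz (fun t => is_derive_cprim T t (@torque_continuous i))) => x.
  have m1 : `|mean T (torque u i)| <= a i + csum i * B ^+ 2.
    by apply: (mean_bound T_gt0); [exact: torque_continuous|move=> y _; exact: torque_le].
  by have := ler_normB (torque u i x) (mean T (torque u i)); have := torque_le i x; lra.
have hC : `|cross_momentum u i t - cross_momentum u i s| <= csum i * ((4 * B ^+ 2 + Lam) * `|t - s|).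
  apply: weighted_sumB_bound => // j.
  have hc : `|cos (angle u i t - angle u j t) - cos (angle u i s - angle u j s)| <= 4 * B * `|t - s|.
    apply: le_trans (cos_lipschitz _ _) _.
    have e1 := subB_bound (angle_lip i s t) (angle_lip j s t).
    by apply: le_trans e1 _; rewrite -!mulrDl (_ : 2 + 2 = 4 :> R) //; ring.
  have hp : `|angvel u j t - angvel u j s| <= Lam * `|t - s|.
    by rewrite /angvel opprD addrACA subrr add0r.
  apply: le_trans (mulB_bound (cos_max _) (angvel_le j s) hc hp) _.
  by rewrite expr2; lra.
have := F_lip i s t.
have : `|balance u i t - balance u i s| <= `|F i t - F i s| +
  `|cprim T (torque u i) t - cprim T (torque u i) s| + `|cross_momentum u i t - cross_momentum u i s|.
  have -> : balance u i t - balance u i s = (F i t - F i s + (cprim T (torque u i) t - cprim T (torque u i) s))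
     - (cross_momentum u i t - cross_momentum u i s) by rewrite /balance; ring.
  apply: le_trans (ler_normB _ _) _; rewrite lerD2r; exact: ler_normD.
have B1 : 1 <= B ^+ 2 by apply: exprn_ege1; exact: B_ge1 i.
have g2 : 2 * csum i <= 1.
  have := csum_small i; have := csum_1 i; have := csum_ge0 i; lra.
have g1 : 48 * (csum i * B ^+ 2) <= 1 by have := csum_small i; lra.
have Lam0 : 0 <= Lam by rewrite /Lam; have := LF_ge0 i; lra.
have e1 : LF + 2 * (a i + csum i * B ^+ 2) + csum i * (4 * B ^+ 2 + Lam) <= Lam.
  have : csum i * Lam <= 1 / 2 * Lam by rewrite ler_wpM2r //; lra.
  by have := a_le1 i; have := LF_ge0 i; have : Lam = 2 * LF + 10 * B ^+ 2 by []; lra.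
have := ler_wpM2r ts0 e1; rewrite !mulrDl; lra.
Qed.

End Admissible.

Lemma small_sum_lt1 u i t : admissible u -> zero i ->
  `|phase u i - base i + cprim T (fluct u i) t| <= 1.
Proof.
move=> uA zi; case: (uA) => _ _ _ /(_ i zi) h.
by have := cprim_fluct_le uA i t; have := amp_le1 i;
   have := ler_normD (phase u i - base i) (cprim T (fluct u i) t); lra.
Qed.

Lemma base_cos2 i : zero i -> cos (base i) ^+ 2 = 1.
Proof. by move=> zi; rewrite cos2sin2 base_sin // expr0n subr0. Qed.

Lemma sin_angle_zero u i t : zero i -> cos (base i) * sin (angle u i t) =
  sin (phase u i - base i + cprim T (fluct u i) t).
Proof.
move=> zi; rewrite /angle V_zero // mul0r addr0.
have -> : phase u i + cprim T (fluct u i) t = base i + (phase u i - base i + cprim T (fluct u i) t) by ring.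
by rewrite sinD base_sin // mul0r add0r mulrA -expr2 base_cos2 ?mul1r.
Qed.

(** Up to small terms the corrected deviation from the equilibrium is the mean of
    [z - sin z]. *)
Lemma step_zero u i : admissible u -> zero i ->
  phase u i + cos (base i) * mean T (torque u i) / a i - base i =
  mean T (fun t => (phase u i - base i + cprim T (fluct u i) t
             - sin (phase u i - base i + cprim T (fluct u i) t))
          - (cprim T (fluct u i) t + cos (base i) / a i * cross_torque u i t)).
Proof.
move=> uA zi.
have -> : (fun t => (phase u i - base i + cprim T (fluct u i) t
             - sin (phase u i - base i + cprim T (fluct u i) t))
          - (cprim T (fluct u i) t + cos (base i) / a i * cross_torque u i t)) =
   (fun t => (phase u i - base i) + cos (base i) / a i * torque u i t).
  apply: funext => t; rewrite -sin_angle_zero // /torque.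
  by field; rewrite gt_eqF.
rewrite mean_linear //; [|exact: cst_continuous|exact: torque_continuous].
by rewrite mean_cst //; ring.
Qed.

Lemma Phi_admissible eta u : admissible u -> admissible (Phi eta u).
Proof.
move=> uA; have rrE i t : fluct (Phi eta u) i t = balance u i t - mean T (balance u i).
  by rewrite /fluct /= mulrC divfK // gt_eqF.
split=> [i s t|i t|i t|i zi].
- by rewrite !rrE opprB addrA subrK; exact: balance_lip.
- by rewrite /= balance_periodic.
- rewrite /= normrM (gtr0_norm (_ : 0 < (amp i)^-1)) ?invr_gt0 // ler_pdivrMr // mul1r.
  apply: le_trans (ler_normB _ _) _.
  have : `|mean T (balance u i)| <= amp i / 2.
    by apply: (mean_bound T_gt0); [exact: balance_continuous|move=> y _; exact: balance_le].
  by have := balance_le uA i t; lra.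
- rewrite /phase /= zi step_zero //.
  have cK : continuous (fun t => phase u i - base i + cprim T (fluct u i) t).
    apply: continuous_add; first exact: cst_continuous.
    by apply: cprim_continuous; exact: fluct_continuous.
  apply: (mean_bound T_gt0).
    apply: continuous_sub; first by apply: continuous_sub => //; exact: continuous_sin_comp.
    apply: continuous_add; first by apply: cprim_continuous; exact: fluct_continuous.
    by apply: continuous_mul; [exact: cst_continuous|exact: cross_torque_continuous].
  move=> t _; set z := phase u i - base i; set k := cprim T (fluct u i) t.
  have zk1 : `|z + k| <= 1 by exact: small_sum_lt1.
  have := sub_sin_lipschitz (_ : `|0| <= 1) zk1; rewrite normr0 => /(_ ler01).
  rewrite sin0 !subr0 => h1.
  have h2 : `|cos (base i) / a i * cross_torque u i t| <= 1 / 32.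
    rewrite mulrAC normrM (gtr0_norm (_ : 0 < (a i)^-1)) ?invr_gt0 // ler_pdivrMr //.
    have h3 := cross_torque_le uA (angvel_zero_le uA t zi).
    have := mul_bound (cos_max (base i)) h3.
    by have := coupling_small zi; lra.
  have zle : `|z| <= 1 / 2 by case: (uA) => _ _ _ /(_ i zi).
  have kle : `|k| <= 1 / 16 by have := cprim_fluct_le uA i t; have := amp_le1 i; rewrite -/k; lra.
  have := ler_normD z k.
  have := ler_normB (z + k - sin (z + k)) (k + cos (base i) / a i * cross_torque u i t).
  have := ler_normD k (cos (base i) / a i * cross_torque u i t).
  lra.
Qed.

Section Close.
Variables (u w : state) (d : R).
Hypothesis uA : admissible u.
Hypothesis wA : admissible w.
Hypothesis d_ge0 : 0 <= d.
Hypothesis uw : forall x, `|u x - w x| <= d.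

Lemma fluct_close i t : `|fluct u i t - fluct w i t| <= amp i * d.
Proof. by rewrite /fluct -mulrBr normrM gtr0_norm // ler_pM2l. Qed.

Lemma cprim_fluct_close i t : `|cprim T (fluct u i) t - cprim T (fluct w i) t| <= amp i * d / 16.
Proof.
rewrite -cprimB; [|exact: fluct_continuous|exact: fluct_continuous].
have := @cprim_bound R T T_gt0 (fun s => fluct u i s - fluct w i s) (amp i * d).
move=> /(_ _ _ (fluct_close i) t) h; apply: le_trans (h _ _) _.
- by apply: continuous_sub; exact: fluct_continuous.
- by move=> s; rewrite !fluct_periodic.
- have : T * (amp i * d) <= 1 / 32 * (amp i * d) by rewrite ler_wpM2r // mulr_ge0 // ltW.
  lra.
Qed.

Lemma kd_le i : amp i * d <= d.
Proof. by rewrite ler_piMl. Qed.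

Lemma angle_close i t : `|angle u i t - angle w i t| <= 2 * d.
Proof.
have hx : `|phase u i - phase w i| <= d by exact: uw (inr i).
have e1 : angle u i t - angle w i t = (phase u i - phase w i) + (cprim T (fluct u i) t - cprim T (fluct w i) t).
  exact: subB_mid.
rewrite e1; apply: le_trans (ler_normD _ _) _; apply: le_trans (lerD hx (cprim_fluct_close i t)) _.
clear e1 hx; have := kd_le i; have := d_ge0; lra.
Qed.

Lemma angvel_close i t : `|angvel u i t - angvel w i t| <= amp i * d.
Proof. by rewrite /angvel opprD addrACA subrr add0r; exact: fluct_close. Qed.

Lemma angleB_close i j t :
  `|angle u i t - angle u j t - (angle w i t - angle w j t)| <= 4 * d.
Proof.
by apply: le_trans (subB_bound (angle_close i t) (angle_close j t)) _; rewrite -mulrDl (_ : 2 + 2 = 4 :> R) //; ring.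
Qed.

Lemma cross_momentum_close i t : `|cross_momentum u i t - cross_momentum w i t| <= csum i * (5 * B * d).
Proof.
apply: weighted_sumB_bound => // j.
have hc := le_trans (cos_lipschitz _ _) (angleB_close i j t).
apply: le_trans (mulB_bound (cos_max _) (angvel_le wA j t) hc (angvel_close j t)) _.
have := kd_le j; have : d <= B * d by rewrite ler_peMl // (B_ge1 i).
lra.
Qed.

(** The bound is proportional to the velocities of link [i]: for a resting link, where
    [M = amp i], it is of second order in the coupling and the fluctuations. *)
Lemma cross_torque_close i t M : 0 <= M -> `|angvel u i t| <= M -> `|angvel w i t| <= M -> amp i <= M ->
  `|cross_torque u i t - cross_torque w i t| <= csum i * (6 * M * B * d).
Proof.
move=> M0 uM wM kM; apply: weighted_sumB_bound => // j.
have hs := le_trans (sin_lipschitz _ _) (angleB_close i j t).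
have hp := mulB_bound uM (angvel_le wA j t) (angvel_close i t) (angvel_close j t).
apply: le_trans (mulB_bound (sin_max _) (mul_bound wM (angvel_le wA j t)) hs hp) _.
have B0 := B_ge0 i.
have k1 : amp i * d * B <= M * B * d.
  by rewrite -!mulrA (mulrC d) ler_wpM2r // mulr_ge0.
have k2 : M * (amp j * d) <= M * B * d.
  rewrite -mulrA ler_wpM2l // ler_wpM2r //.
  by have := amp_le1 j; have := B_ge1 i; lra.
lra.
Qed.

Lemma torque_close i t : `|torque u i t - torque w i t| <= (2 * a i + 6 * B ^+ 2 * csum i) * d.
Proof.
have -> : torque u i t - torque w i t = - (a i * (sin (angle u i t) - sin (angle w i t)))
   - (cross_torque u i t - cross_torque w i t) by exact: subB_scaled.
apply: le_trans (ler_normB _ _) _; rewrite normrN normrM gtr0_norm //.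
have h1 := le_trans (sin_lipschitz _ _) (angle_close i t).
have kB : amp i <= B by have := amp_le1 i; have := B_ge1 i; lra.
have := cross_torque_close (B_ge0 i) (angvel_le uA i t) (angvel_le wA i t) kB.
have : a i * `|sin (angle u i t) - sin (angle w i t)| <= a i * (2 * d) by rewrite ler_pM2l.
rewrite expr2; lra.
Qed.

Lemma balance_close i t : `|balance u i t - balance w i t| <= 7 / 16 * (amp i * d).
Proof.
have -> : balance u i t - balance w i t = (cprim T (torque u i) t - cprim T (torque w i) t)
   - (cross_momentum u i t - cross_momentum w i t) by exact: subB_left.
apply: le_trans (ler_normB _ _) _; rewrite -cprimB; try exact: torque_continuous.
have := @cprim_bound R T T_gt0 (fun s => torque u i s - torque w i s) _ _ _ (torque_close i) t.
move=> /(_ _ _)h.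
have {}h : `|cprim T (fun s => torque u i s - torque w i s) t| <= 2 * T * ((2 * a i + 6 * B ^+ 2 * csum i) * d).
  apply: h; first by apply: continuous_sub; exact: torque_continuous.
  by move=> s; rewrite !torque_periodic.
have := cross_momentum_close i t.
have k0 := ler_wpM2r d_ge0 (amp_ge i).
have Bd := ler_wpM2r d_ge0 (csum_B i).
have : 0 <= phi i * d by rewrite mulr_ge0.
have : 0 <= T * a i * d by rewrite !mulr_ge0 // ltW.
have gB0 : 0 <= csum i * B ^+ 2 * d by rewrite mulr_ge0 // mulr_ge0 // sqr_ge0.
have : T * (csum i * B ^+ 2 * d) <= 1 / 32 * (csum i * B ^+ 2 * d) by rewrite ler_wpM2r.
lra.
Qed.

Lemma Phi_close_velocity eta eta' i t :
  `|Phi eta u (inl (i, t)) - Phi eta' w (inl (i, t))| <= 7 / 8 * d.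
Proof.
rewrite /= -mulrBl normrM (gtr0_norm (_ : 0 < (amp i)^-1)) ?invr_gt0 // ler_pdivrMr //.
have -> : balance u i t - mean T (balance u i) - (balance w i t - mean T (balance w i)) =
  (balance u i t - balance w i t) - mean T (fun s => balance u i s - balance w i s).
  by rewrite meanB; [ring|exact: balance_continuous|exact: balance_continuous].
apply: le_trans (ler_normB _ _) _.
have := balance_close i t.
have : `|mean T (fun s => balance u i s - balance w i s)| <= 7 / 16 * (amp i * d).
  apply: (mean_bound T_gt0); last by move=> s _; exact: balance_close.
  by apply: continuous_sub; exact: balance_continuous.
lra.
Qed.

Lemma Phi_close_phase eta eta' i : zero i ->
  `|Phi eta u (inr i) - Phi eta' w (inr i)| <= 7 / 8 * d.
Proof.
move=> zi; rewrite /= zi.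
have -> : forall p q : R, p - q = (p - base i) - (q - base i) by move=> p q; ring.
rewrite !step_zero //.
have cK v : admissible v -> continuous (fun t => phase v i - base i + cprim T (fluct v i) t).
  move=> vA; apply: continuous_add; first exact: cst_continuous.
  by apply: cprim_continuous; exact: fluct_continuous.
have cv v : admissible v -> continuous (fun t => phase v i - base i + cprim T (fluct v i) t
   - sin (phase v i - base i + cprim T (fluct v i) t)
   - (cprim T (fluct v i) t + cos (base i) / a i * cross_torque v i t)).
  move=> vA; have := cK v vA => cKv.
  apply: continuous_sub; first by apply: continuous_sub => //; exact: continuous_sin_comp.
  apply: continuous_add; first by apply: cprim_continuous; exact: fluct_continuous.
  by apply: continuous_mul; [exact: cst_continuous|exact: cross_torque_continuous].
rewrite -meanB; [|exact: cv|exact: cv].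
apply: (mean_bound T_gt0); first by apply: continuous_sub; exact: cv.
move=> t _; apply: pendulum_step_bound.
- exact: small_sum_lt1.
- exact: small_sum_lt1.
- have := uw (inr i); rewrite -[u (inr i)]/(phase u i) -[w (inr i)]/(phase w i).
  by rewrite opprB addrA subrK.
- by have := cprim_fluct_close i t; have := kd_le i; lra.
- rewrite -mulrBr mulrAC normrM (gtr0_norm (_ : 0 < (a i)^-1)) ?invr_gt0 // ler_pdivrMr //.
  have h3 := cross_torque_close (ltW (amp_gt0 i)) (angvel_zero_le uA t zi) (angvel_zero_le wA t zi) (lexx _).
  have := mul_bound (cos_max (base i)) h3.
  by have := ler_wpM2r d_ge0 (coupling_small zi); lra.
Qed.

End Close.

(** * Solutions with prescribed phases *)

Lemma admissible_closed (v : nat -> state) (l : state) :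
  (forall n, admissible (v n)) -> (forall x, (fun n => v n x) @ \oo --> l x) -> admissible l.
Proof.
move=> vA vl; split.
- move=> i s t; apply: (@norm_limit_le R (fun n => fluct (v n) i t - fluct (v n) i s)).
    by apply: cvgB; apply: cvgMr; exact: vl.
  by move=> n; case: (vA n).
- move=> i t; apply: (limit_unique (vl _) (vl _)) => n.
  by case: (vA n).
- by move=> i t; apply: (norm_limit_le (vl _)) => n; case: (vA n).
- move=> i zi; apply: (@norm_limit_le R (fun n => phase (v n) i - base i)).
    by apply: cvgB; [exact: vl|exact: cvg_cst].
  by move=> n; case: (vA n) => _ _ _; apply.
Qed.

(** The closed class [P] is a parameter, to be taken as all admissible states or as the
    time-reversible ones. *)
Lemma contraction_solution eta (P : state -> Prop) (u0 : state) :
  (forall u, P u -> forall i, ~~ zero i -> phase u i = eta i) ->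
  (forall u, P u -> admissible u) ->
  (forall u, P u -> P (Phi eta u)) ->
  (forall (v : nat -> state) (l : state), (forall n, P (v n)) ->
     (forall x, (fun n => v n x) @ \oo --> l x) -> P l) ->
  P u0 -> exists2 u, P u & Phi eta u = u.
Proof.
move=> Peta PA Pstab Pcl P0.
have k0 : 0 <= 7 / 8 :> R by lra.
have k1 : 7 / 8 < 1 :> R by lra.
apply: (@pointwise_contraction_fixpoint _ _ P (Phi eta) (7 / 8) k0 k1 Pcl Pstab _ u0 2) => //.
- move=> u w e Pu Pw e0 uw [[i t]|i].
    exact: (Phi_close_velocity (PA _ Pu) (PA _ Pw)).
  case: (boolP (zero i)) => zi; first exact: (Phi_close_phase (PA _ Pu) (PA _ Pw)).
  by rewrite /= (negbTE zi) subrr normr0 mulr_ge0.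
- have A0 := PA _ P0; have A1 := Phi_admissible eta A0.
  case=> [[i t]|i].
    case: A0 => _ _ /(_ i t) h0 _; case: A1 => _ _ /(_ i t) h1 _.
    by have := ler_normB (Phi eta u0 (inl (i, t))) (u0 (inl (i, t))); lra.
  case: (boolP (zero i)) => zi; last first.
    by rewrite /= (negbTE zi) -(Peta _ P0 i zi) subrr normr0.
  case: A0 => _ _ _ /(_ i zi) h0; case: A1 => _ _ _ /(_ i zi) h1.
  have := ler_normB (phase (Phi eta u0) i - base i) (phase u0 i - base i).
  by rewrite opprB addrA subrK /phase in h0 h1 *; lra.
Qed.

Lemma admissible_const (x : 'I_N -> R) : (forall i, zero i -> x i = base i) ->
  admissible (fun d => match d with inl _ => 0 | inr i => x i end).
Proof.
move=> xb; split=> [i s t|i t|i t|i zi].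
- rewrite /fluct !mulr0 subrr normr0 mulr_ge0 // /Lam.
  have := LF_ge0 i; have : 0 <= B ^+ 2 by apply: sqr_ge0.
  lra.
- by [].
- by rewrite normr0.
- by rewrite /phase xb // subrr normr0 divr_ge0.
Qed.

Lemma solution_exists eta : exists2 u, admissible u & Phi eta u = u.
Proof.
have [] := @contraction_solution eta
  (fun u => admissible u /\ forall i, ~~ zero i -> phase u i = eta i)
  (fun d => match d with inl _ => 0 | inr i => if zero i then base i else eta i end).
- by move=> u [].
- by move=> u [].
- move=> u [uA ue]; split; first exact: Phi_admissible.
  by move=> i /negbTE zi; rewrite /phase /= zi.
- move=> v l vP vl; split; first by apply: admissible_closed vl => n; case: (vP n).
  move=> i zi; apply: (limit_unique (vl _) (cvg_cst (eta i))) => n.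
  by case: (vP n) => _ /(_ i zi).
- split; first by apply: admissible_const => i ->.
  by move=> i /negbTE zi; rewrite /phase zi.
- by move=> u [uA _] uE; exists u.
Qed.

(** Two fixed points within [d >= h] of each other are within [max h (7 / 8 * d)] by
    the contraction, and they are within [max h 2] by admissibility. *)
Lemma solution_lipschitz eta eta' u w h :
  admissible u -> admissible w -> Phi eta u = u -> Phi eta' w = w -> 0 <= h ->
  (forall i, ~~ zero i -> `|eta i - eta' i| <= h) -> forall x, `|u x - w x| <= h.
Proof.
move=> uA wA uE wE h0 hh.
have main n : forall x, `|u x - w x| <= Num.max h ((7 / 8) ^+ n * 2).
  elim: n => [|n IH] x.
    rewrite expr0 mul1r le_max; case: x => [[i t]|i].
      case: uA => _ _ /(_ i t) h1 _; case: wA => _ _ /(_ i t) h2 _.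
      by apply/orP; right; have := ler_normB (u (inl (i, t))) (w (inl (i, t))); lra.
    case: (boolP (zero i)) => zi.
      case: uA => _ _ _ /(_ i zi) h1; case: wA => _ _ _ /(_ i zi) h2.
      have := ler_normB (phase u i - base i) (phase w i - base i).
      by rewrite opprB addrA subrK /phase in h1 h2 *; move=> h3; apply/orP; right; lra.
    by rewrite -uE -wE /= (negbTE zi) hh.
  set d := Num.max h ((7 / 8) ^+ n * 2) in IH.
  have d0 : 0 <= d by rewrite le_max h0.
  have dd : 7 / 8 * d <= Num.max h ((7 / 8) ^+ n.+1 * 2).
    have k0 : 0 <= 7 / 8 :> R by lra.
    rewrite /d (maxr_pMr _ _ k0) exprS -[7 / 8 * _ * 2]mulrA ge_max !le_max lexx orbT andbT.
    by apply/orP; left; lra.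
  rewrite -uE -wE; case: x => [[i t]|i].
    by apply: le_trans dd; exact: Phi_close_velocity.
  case: (boolP (zero i)) => zi; first by apply: le_trans dd; exact: Phi_close_phase.
  by rewrite /= (negbTE zi) le_max hh.
move=> x; rewrite leNgt; apply/negP => lt.
have l0 : (fun n => (7 / 8) ^+ n * 2 : R) @ \oo --> (0 : R).
  rewrite -[X in _ --> X](mul0r 2); apply: cvgMl; apply: cvg_expr.
  by rewrite ger0_norm; lra.
have /cvgrPdist_lt/(_ _ (le_lt_trans h0 lt))[n _ hn] := l0.
have := hn n (leqnn n); rewrite /= sub0r normrN => h1.
have := main n x; rewrite le_max => /orP[|]; first by rewrite leNgt lt.
by have := ler_norm ((7 / 8) ^+ n * 2 : R); lra.
Qed.

Lemma solution_unique eta u w : admissible u -> admissible w ->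
  Phi eta u = u -> Phi eta w = w -> u = w.
Proof.
move=> uA wA uE wE; apply: funext => x; apply/eqP; rewrite -subr_eq0 -normr_le0.
by apply: (solution_lipschitz uA wA uE wE) => // i _; rewrite subrr normr0.
Qed.

Section Solution.
Variables (eta : 'I_N -> R) (u : state).
Hypothesis uA : admissible u.
Hypothesis uE : Phi eta u = u.

Lemma solution_velocity i t : fluct u i t = balance u i t - mean T (balance u i).
Proof. by rewrite /fluct -[in LHS]uE /= mulrC divfK // gt_eqF. Qed.

Lemma solution_mean_fluct i : mean T (fluct u i) = 0.
Proof.
rewrite (funext (solution_velocity i)) meanB ?mean_cst ?subrr //.
- exact: balance_continuous.
- exact: cst_continuous.
Qed.

Lemma solution_phase i : ~~ zero i -> phase u i = eta i.
Proof. by move=> /negbTE zi; rewrite /phase -uE /= zi. Qed.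

Lemma solution_mean_torque i : zero i -> mean T (torque u i) = 0.
Proof.
move=> zi; have : phase u i = phase u i + cos (base i) * mean T (torque u i) / a i.
  by rewrite {1}/phase -uE /= zi uE.
move=> e; have : cos (base i) * mean T (torque u i) / a i = 0 by lra.
move/eqP; rewrite mulf_eq0 invr_eq0 (gt_eqF (a_gt0 i)) orbF mulf_eq0.
have : cos (base i) != 0 by rewrite -sqrf_eq0 base_cos2 // oner_eq0.
by move=> /negbTE -> /= /eqP.
Qed.

Lemma is_derive_solution i t : is_derive t 1 (angle u i) (angvel u i t).
Proof. by have := is_derive_angle uA i t; rewrite solution_mean_fluct subr0. Qed.

Lemma solution_momentum i t : angvel u i t + cross_momentum u i t - F i t =
  V i - mean T (balance u i) + cprim T (torque u i) t.
Proof. by rewrite /angvel solution_velocity /balance; set A := cprim _ _ _; set C := cross_momentum _ _ _; ring. Qed.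

Lemma is_derive_momentum i t : mean T (torque u i) = 0 ->
  is_derive t 1 (fun s => angvel u i s + cross_momentum u i s - F i s) (torque u i t).
Proof.
move=> m0; rewrite (funext (solution_momentum i)).
have := is_deriveD (is_derive_cst (V i - mean T (balance u i)) t 1)
  (is_derive_cprim T t (torque_continuous uA (i := i))).
by rewrite m0 subr0 add0r.
Qed.

End Solution.

Section Shift.
Variables (u w : state) (z : 'I_N -> int).
Hypothesis same_velocity : forall i t, w (inl (i, t)) = u (inl (i, t)).
Hypothesis shifted : forall i, phase w i = phase u i + 2 * pi * (z i)%:~R.

Let fluct_shift : fluct w = fluct u.
Proof. by apply: funext => i; apply: funext => t; rewrite /fluct same_velocity. Qed.

Lemma angvel_shift : angvel w = angvel u.
Proof. by rewrite /angvel fluct_shift. Qed.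

Lemma angle_shift i t : angle w i t = angle u i t + 2 * pi * (z i)%:~R.
Proof.
rewrite /angle fluct_shift shifted; exact: addr_shift.
Qed.

Let cos_angleB_shift i j t : cos (angle w i t - angle w j t) = cos (angle u i t - angle u j t).
Proof.
apply: etrans (cosD2pin _ (z i - z j)); congr cos.
by apply: etrans (congr2 (fun x y => x - y) (angle_shift i t) (angle_shift j t)) (subB_multiple _ _ _ _ _).
Qed.

Let sin_angleB_shift i j t : sin (angle w i t - angle w j t) = sin (angle u i t - angle u j t).
Proof.
apply: etrans (sinD2pin _ (z i - z j)); congr sin.
by apply: etrans (congr2 (fun x y => x - y) (angle_shift i t) (angle_shift j t)) (subB_multiple _ _ _ _ _).
Qed.

Let angvel_shift' i t : angvel w i t = angvel u i t.
Proof. by rewrite angvel_shift. Qed.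

Lemma cross_momentum_shift : cross_momentum w = cross_momentum u.
Proof.
apply: funext => i; apply: funext => t; apply: eq_bigr => j _.
exact: (congr2 (fun x y => c i j * (x * y)) (cos_angleB_shift i j t) (angvel_shift' j t)).
Qed.

Let cross_torque_shift i t : cross_torque w i t = cross_torque u i t.
Proof.
apply: eq_bigr => j _.
exact: (congr2 (fun x y => c i j * (x * y)) (sin_angleB_shift i j t)
  (congr2 (fun x y => x * y) (angvel_shift' i t) (angvel_shift' j t))).
Qed.

Lemma torque_shift : torque w = torque u.
Proof.
apply: funext => i; apply: funext => t.
exact: (congr2 (fun x y => - (a i * x) - y)
  (etrans (congr1 sin (angle_shift i t)) (sinD2pin _ _)) (cross_torque_shift i t)).
Qed.

Lemma balance_shift : balance w = balance u.
Proof. by rewrite /balance torque_shift cross_momentum_shift. Qed.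

Lemma lagr_shift rho t : lagr rho a c (angle w ^~ t) (angvel w ^~ t) (F ^~ t) =
  lagr rho a c (angle u ^~ t) (angvel u ^~ t) (F ^~ t).
Proof.
apply: (congr2 (fun x y => x + 2^-1 * y)).
  apply: eq_bigr => i _.
  exact: (congr2 (fun x y => rho i * (x ^+ 2 / 2 + a i * y - F i t * x)) (angvel_shift' i t)
    (etrans (congr1 cos (angle_shift i t)) (cosD2pin _ _))).
apply: eq_bigr => i _; apply: eq_bigr => j _.
exact: (congr2 (fun x y => rho i * c i j * (x * y)) (cos_angleB_shift i j t)
  (congr2 (fun x y => x * y) (angvel_shift' i t) (angvel_shift' j t))).
Qed.

End Shift.

(** The translate of a solution by a period lattice vector is the solution for the
    translated phases, by uniqueness. *)
Lemma solution_lattice eta eta' u w (z : 'I_N -> int) :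
  (forall i, eta' i = eta i + 2 * pi * (z i)%:~R) ->
  admissible u -> Phi eta u = u -> admissible w -> Phi eta' w = w ->
  exists z' : 'I_N -> int, (forall i t, w (inl (i, t)) = u (inl (i, t))) /\
    forall i, phase w i = phase u i + 2 * pi * (z' i)%:~R.
Proof.
move=> etaE uA uE wA wE.
pose z' i := if zero i then 0 else z i.
pose v : state := fun d => match d with
  | inl (i, t) => u (inl (i, t)) | inr i => u (inr i) + 2 * pi * (z' i)%:~R end.
have vv i t : v (inl (i, t)) = u (inl (i, t)) by [].
have vx i : phase v i = phase u i + 2 * pi * (z' i)%:~R by [].
have vA : admissible v.
  case: (uA) => h1 h2 h3 h4; split=> // i zi.
  by rewrite vx /z' zi mulr0 addr0; exact: h4.
have vE : Phi eta' v = v.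
  apply: funext => -[[i t]|i] /=.
    by rewrite (balance_shift vv vx); exact: (congr1 (fun f => f (inl (i, t))) uE).
  rewrite (torque_shift vv vx); case: (boolP (zero i)) => zi.
    by rewrite (solution_mean_torque uE) // mulr0 mul0r addr0.
  by rewrite etaE -(solution_phase uE) // /z' (negbTE zi).
by exists z'; rewrite (solution_unique wA vA wE vE).
Qed.

(** When the phases are multiples of [pi] and the velocities are even, the angles
    are odd modulo [2 pi], so the torques are odd and have mean zero.  The next state
    then has even velocities and the same phases: [Phi] stays in this class. *)
Lemma symmetric_solution (b : 'I_N -> R) :
  (forall i t, F i t = 0) -> (forall i, zero i -> b i = base i) ->
  (forall i, exists n : int, b i = pi * n%:~R) ->
  exists u, [/\ admissible u, Phi b u = u, forall i, phase u i = b i &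
    forall i, mean T (torque u i) = 0].
Proof.
move=> F0 bz bpi.
pose P u := [/\ admissible u, forall i, phase u i = b i & forall i, even_on (fluct u i)].
have sym u : P u -> [/\ forall i, odd_on (torque u i) & forall i, even_on (cross_momentum u i)].
  move=> [uA ux ue].
  have qr i t : exists n : int, angle u i (- t) = - angle u i t + 2 * pi * n%:~R.
    have [n hn] := bpi i; exists n.
    rewrite /angle ux (cprim_even T_gt0 (@fluct_continuous _ uA i) (fluct_periodic uA i) (ue i)) hn.
    by set A := cprim _ _ _; ring.
  have qBr i j t : exists n : int, angle u i (- t) - angle u j (- t) =
      - (angle u i t - angle u j t) + 2 * pi * n%:~R.
    have [n hn] := qr i t; have [m hm] := qr j t; exists (n - m).
    exact: etrans (congr2 (fun x y => x - y) hn hm) (subBN_multiple _ _ _ _ _).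
  have sinr i j t : sin (angle u i (- t) - angle u j (- t)) = - sin (angle u i t - angle u j t).
    have [m hm] := qBr i j t.
    exact: etrans (congr1 sin hm) (etrans (sinD2pin _ _) (sinN _)).
  have cosr i j t : cos (angle u i (- t) - angle u j (- t)) = cos (angle u i t - angle u j t).
    have [m hm] := qBr i j t.
    exact: etrans (congr1 cos hm) (etrans (cosD2pin _ _) (cosN _)).
  have pe i t : angvel u i (- t) = angvel u i t by rewrite /angvel ue.
  split=> i t.
    have [n hn] := qr i t.
    have e1 : sin (angle u i (- t)) = - sin (angle u i t).
      exact: etrans (congr1 sin hn) (etrans (sinD2pin _ _) (sinN _)).
    have e2 : cross_torque u i (- t) = - cross_torque u i t.
      rewrite /cross_torque -sumrN; apply: eq_bigr => j _.
      apply: etrans (mulNr_middle _ _ _).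
      exact: (congr2 (fun x y => c i j * (x * y)) (sinr i j t)
        (congr2 (fun x y => x * y) (pe i t) (pe j t))).
    exact: etrans (congr2 (fun x y => - (a i * x) - y) e1 e2) (oddB_scaled _ _ _).
  apply: eq_bigr => j _.
  exact: (congr2 (fun x y => c i j * (x * y)) (cosr i j t) (pe j t)).
have m0 u i : P u -> mean T (torque u i) = 0.
  move=> Pu; have [so _] := sym _ Pu; case: Pu => uA _ _.
  by apply: mean_odd; [exact: torque_continuous|exact: torque_periodic|exact: so].
have [] := @contraction_solution b P (fun d => match d with inl _ => 0 | inr i => b i end).
- by move=> u [_ ux _] i _; exact: ux.
- by move=> u [].
- move=> u Pu; have [so ce] := sym _ Pu; case: (Pu) => uA ux ue; split.
  + exact: Phi_admissible.
  + move=> i; rewrite /phase /= m0 // mulr0 mul0r addr0 ux; by case: ifP.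
  + move=> i t; rewrite /fluct /= /balance !F0 ce (cprim_odd _ _ (so i)) //.
      exact: torque_continuous.
    exact: torque_periodic.
- move=> v l vP vl; split; first by apply: admissible_closed vl => n; case: (vP n).
    move=> i; apply: (limit_unique (vl _) (cvg_cst (b i))) => n.
    by case: (vP n) => _ /(_ i).
  move=> i t; rewrite /fluct; congr (_ * _).
  apply: (limit_unique (vl _) (vl _)) => n; case: (vP n) => _ _ /(_ i t).
  by rewrite /fluct => /(mulfI (lt0r_neq0 (amp_gt0 i))).
- by split=> //; exact: admissible_const.
- move=> u Pu uE; exists u; case: (Pu) => uA ux _; split=> // i; exact: m0.
Qed.

(** * The reduced action *)

Section Action.
Variable rho : 'I_N -> R.
Hypothesis rho_gt0 : forall i, 0 < rho i.
Hypothesis rho_sym : forall i j, rho i * c i j = rho j * c j i.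

Definition action u : R :=
  mean T (fun t => lagr rho a c (angle u ^~ t) (angvel u ^~ t) (F ^~ t)).

Lemma lagr_continuous u : admissible u ->
  continuous (fun t => lagr rho a c (angle u ^~ t) (angvel u ^~ t) (F ^~ t)).
Proof.
move=> uA; apply: continuous_add.
  apply: continuous_bigsum => i; apply: continuous_mul; first exact: cst_continuous.
  apply: continuous_sub; last by apply: continuous_mul; [exact: F_continuous|exact: angvel_continuous].
  apply: continuous_add; last first.
    apply: continuous_mul; first exact: cst_continuous.
    by apply: continuous_cos_comp; exact: angle_continuous.
  apply: continuous_mul; last exact: cst_continuous.
  by apply: continuous_mul; exact: angvel_continuous.
apply: continuous_mul; first exact: cst_continuous.
apply: continuous_bigsum => i; apply: continuous_bigsum => j.
apply: continuous_mul; first exact: cst_continuous.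
apply: continuous_mul; last by apply: continuous_mul; exact: angvel_continuous.
by apply: continuous_cos_comp; exact: angleB_continuous.
Qed.

(** In the mean of the first variation, the momentum is a constant plus the periodic
    primitive of the torque.  Integrated by parts against the variation of the velocity,
    it cancels the mean-zero part of the variation of the angle; what
    remains is the mean torque times the variation of the phase. *)
Lemma action_taylor eta eta' u w h : admissible u -> admissible w ->
  Phi eta u = u -> Phi eta' w = w -> 0 <= h -> (forall x, `|w x - u x| <= h) ->
  action w <= action u + \sum_i rho i * mean T (torque u i) * (phase w i - phase u i)
     + lagr_curvature rho a c B * h ^+ 2.
Proof.
move=> uA wA uE wE h0 uw.
have cL := lagr_continuous uA.
pose G i t := rho i * ((angvel u i t + cross_momentum u i t - F i t) * (angvel w i t - angvel u i t) +
   torque u i t * (angle w i t - angle u i t)).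
have cp i : continuous (fun t => angvel w i t - angvel u i t).
  by apply: continuous_sub; exact: angvel_continuous.
have cq i : continuous (fun t => angle w i t - angle u i t).
  by apply: continuous_sub; exact: angle_continuous.
have cP i : continuous (fun t => angvel u i t + cross_momentum u i t - F i t).
  apply: continuous_sub; last exact: F_continuous.
  by apply: continuous_add; [exact: angvel_continuous|exact: cross_momentum_continuous].
have cPp i : continuous (fun t => (angvel u i t + cross_momentum u i t - F i t) * (angvel w i t - angvel u i t)).
  exact: continuous_mul.
have cQq i : continuous (fun t => torque u i t * (angle w i t - angle u i t)).
  by apply: continuous_mul => //; exact: torque_continuous.
have cG i : continuous (G i).
  by apply: continuous_mul; [exact: cst_continuous|exact: continuous_add].
have mG i : mean T (G i) = rho i * mean T (torque u i) * (phase w i - phase u i).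
  rewrite /G meanZ //; last exact: continuous_add.
  rewrite -mulrA; congr (_ * _); rewrite meanD //.
  pose d t := fluct w i t - fluct u i t.
  have cd : continuous d by apply: continuous_sub; exact: fluct_continuous.
  have dT : periodic_on T d by move=> t; rewrite /d !fluct_periodic.
  have md : mean T d = 0.
    rewrite meanB; [|exact: fluct_continuous|exact: fluct_continuous].
    by rewrite (solution_mean_fluct wA wE) (solution_mean_fluct uA uE) subrr.
  have cQ := torque_continuous uA (i := i); have cK := cprim_continuous (T := T) cQ.
  have -> : (fun t => (angvel u i t + cross_momentum u i t - F i t) * (angvel w i t - angvel u i t)) =
      (fun t => cprim T (torque u i) t * d t + (V i - mean T (balance u i)) * d t).
    have dE t : angvel w i t - angvel u i t = d t by rewrite /angvel opprD addrACA subrr add0r.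
    apply: funext => t.
    apply: etrans (congr2 (fun x y => x * y) (solution_momentum uE i t) (dE t)) _.
    by rewrite mulrDl; exact: addrC.
  have cKd : continuous (fun t => cprim T (torque u i) t * d t) by exact: continuous_mul.
  rewrite (mean_linear T (V i - mean T (balance u i)) cKd cd).
  rewrite md mulr0 addr0 (mean_cprim_parts T_gt0 cQ cd (torque_periodic uA i) dT).
  have -> : (fun t => torque u i t * (angle w i t - angle u i t)) =
      (fun t => torque u i t * cprim T d t + (phase w i - phase u i) * torque u i t).
    have qE t : angle w i t - angle u i t = (phase w i - phase u i) + cprim T d t.
      rewrite cprimB; [|exact: fluct_continuous|exact: fluct_continuous].
      exact: subB_mid.
    apply: funext => t; apply: etrans (congr1 (fun x => torque u i t * x) (qE t)) _.
    exact: mulrD_swap.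
  have cQK : continuous (fun t => torque u i t * cprim T d t).
    exact: continuous_mul cQ (cprim_continuous (T := T) cd).
  rewrite (mean_linear T (phase w i - phase u i) cQK cQ) addKr.
  exact: mulrC.
have -> : \sum_i rho i * mean T (torque u i) * (phase w i - phase u i) = mean T (fun t => \sum_i G i t).
  by rewrite mean_sum //; apply: eq_bigr => i _; rewrite mG.
rewrite -meanD //; last exact: continuous_bigsum.
rewrite -[X in _ <= _ + X](mean_cst T_gt0) -meanD; last 2 first.
- by apply: continuous_add => //; exact: continuous_bigsum.
- exact: cst_continuous.
apply: (mean_le T_gt0); first exact: lagr_continuous.
  apply: continuous_add; last exact: cst_continuous.
  by apply: continuous_add => //; exact: continuous_bigsum.
move=> t _.
case: (pickP 'I_N) => [i0 _|N0]; last first.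
  by rewrite /lagr /lagr_curvature !big_pred0 // !mulr0 !addr0 mul0r.
apply: lagr_taylor => //.
- by move=> i; exact: ltW.
- by move=> i; exact: ltW.
- exact: (B_ge1 i0).
- by move=> i; exact: angvel_le.
- by move=> i; exact: angvel_le.
- move=> i; apply: le_trans (angvel_close uw i t) _; exact: kd_le.
- by move=> i; exact: (angle_close wA uA h0 uw).
Qed.

End Action.

(** * Critical phases *)

Definition stationary u : Prop := exists eta,
  [/\ admissible u, Phi eta u = u & forall i, mean T (torque u i) = 0].

Lemma angle_rotates u i t : admissible u -> angle u i (t + T) = angle u i t + V i * T.
Proof.
move=> uA; rewrite /angle (cprim_periodic T_gt0 (@fluct_continuous _ uA i) (fluct_periodic uA i)).
exact: rotate_sum.
Qed.

(** The phase is the mean over a period of [angle u i t - V i * t]. *)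
Lemma angle_phase u w (s : R) (k : 'I_N -> R) :
  (forall i, continuous (fluct u i)) -> (forall i, periodic_on T (fluct u i)) ->
  (forall i, continuous (fluct w i)) ->
  (forall t i, angle w i t = angle u i (t + s) + k i) ->
  forall i, phase w i = phase u i + V i * s + k i.
Proof.
move=> uc up wc h i.
have cu := cprim_continuous (T := T) (uc i).
have e t : cprim T (fluct w i) t = (phase u i + V i * s + k i - phase w i) + cprim T (fluct u i) (t + s).
  exact: phase_sum (h t i).
have cus : continuous (fun t => cprim T (fluct u i) (t + s)).
  have -> : (fun t => cprim T (fluct u i) (t + s)) =
     (fun t => cprim T (fluct w i) t - (phase u i + V i * s + k i - phase w i)).
    by apply: funext => t; rewrite e addrAC subrr add0r.
  apply: continuous_sub; last exact: cst_continuous.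
  by apply: cprim_continuous; exact: (wc i).
have m0 := mean_cprim T_gt0 (wc i).
have := m0; rewrite (funext e) meanD; [|exact: cst_continuous|exact: cus].
rewrite mean_cst // (mean_translate s cu (cprim_periodic T_gt0 (uc i) (up i))).
rewrite (mean_cprim T_gt0 (uc i)).
by rewrite addr0 => /eqP; rewrite subr_eq0 => /eqP.
Qed.

Lemma lagr_curvature_ge0 rho : (forall i, 0 < rho i) -> 0 <= lagr_curvature rho a c B.
Proof.
move=> rho0; apply: addr_ge0.
  apply: sumr_ge0 => i _; apply: mulr_ge0; first exact: ltW.
  by have := a_gt0 i; lra.
apply: mulr_ge0 => //; apply: sumr_ge0 => i _; apply: sumr_ge0 => j _.
apply: mulr_ge0; first by apply: mulr_ge0 => //; exact: ltW.
by apply: mulr_ge0 => //; exact: sqr_ge0.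
Qed.

(** The solutions depend on the phases of the rotating links in a Lipschitz way, so
    [action_taylor] makes the reduced action a function on the torus whose gradient
    is formed by the mean torques; its critical points are stationary states. *)
Lemma torus_stationary (rho : 'I_N -> R) (d : nat) (e : 'I_d.+1 -> 'I_N) :
  (forall i, 0 < rho i) -> (forall i j, rho i * c i j = rho j * c j i) ->
  injective e -> (forall j : 'I_d.+1, ~~ zero (e j)) ->
  (forall i, ~~ zero i -> exists j : 'I_d.+1, e j = i) ->
  exists us : 'I_d.+2 -> state, (forall k, stationary (us k)) /\
    forall k k' (z : 'I_N -> int),
      (forall i, phase (us k) i = phase (us k') i + 2 * pi * (z i)%:~R) -> k = k'.
Proof.
move=> rho0 rho_sym e_inj e_rot e_onto.
have [U [UA UE]] : exists U : ('I_N -> R) -> state,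
    (forall eta, admissible (U eta)) /\ (forall eta, Phi eta (U eta) = U eta).
  have [U hU] := boolp.choice (fun eta => let: ex_intro2 u uA uE := solution_exists eta in
    ex_intro (fun u => admissible u /\ Phi eta u = u) u (conj uA uE)).
  by exists U; split=> eta; have [] := hU eta.
pose ext (K : Type) (k0 : K) (y : 'I_d.+1 -> K) i :=
  if [pick j : 'I_d.+1 | e j == i] is Some j then y j else k0.
have extE (K : Type) (k0 : K) y (j : 'I_d.+1) : ext K k0 y (e j) = y j.
  rewrite /ext; case: pickP => [j' /eqP/e_inj -> //|/(_ j)]; by rewrite eqxx.
pose eta (y : 'rV[R]_d.+1) := ext R 0 (y ord0).
have etaE y (j : 'I_d.+1) : eta y (e j) = y ord0 j by exact: extE.
pose Psi y := action rho (U (eta y)).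
pose G y : 'rV[R]_d.+1 := \row_(j < d.+1) (rho (e j) * mean T (torque (U (eta y)) (e j))).
have close y y' x : `|U (eta y') x - U (eta y) x| <= `|y' - y|.
  apply: (solution_lipschitz (UA _) (UA _) (UE _) (UE _) (normr_ge0 _)) => i.
  move=> /e_onto[j <-]; rewrite !etaE.
  by have := coord_le_norm (y' - y) j; rewrite !mxE.
have shift_eta y z i : eta (y + lat (2 * pi) z) i = eta y i + 2 * pi * (ext int 0 z i)%:~R.
  by rewrite /eta /ext; case: pickP => [j _|_]; rewrite ?mxE ?mxE // mulr0 addr0.
pose Cg := \sum_i rho i * (2 * a i + 6 * B ^+ 2 * csum i).
have Cg_term i : 0 <= rho i * (2 * a i + 6 * B ^+ 2 * csum i).
  apply: mulr_ge0; first exact: ltW.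
  apply: addr_ge0; first by apply: mulr_ge0 => //; exact: ltW.
  by apply: mulr_ge0 => //; apply: mulr_ge0 => //; exact: sqr_ge0.
have Cg0 : 0 <= Cg by apply: sumr_ge0.
have L0 := lagr_curvature_ge0 rho0.
pose C := lagr_curvature rho a c B + Cg + 1.
have C0 : 0 < C by rewrite /C; lra.
have pi2 : 0 < 2 * pi :> R by rewrite mulr_gt0 // pi_gt0.
have [] := @many_torus_critical_points R d (2 * pi) C Psi G pi2 C0.
- move=> y z; rewrite /Psi /action; congr mean; apply: funext => t.
  have [z' [hv hx]] := solution_lattice (shift_eta y z) (UA _) (UE _) (UA _) (UE _).
  exact: lagr_shift hv hx _ _.
- move=> y z; apply/rowP => j; rewrite !mxE.
  have [z' [hv hx]] := solution_lattice (shift_eta y z) (UA _) (UE _) (UA _) (UE _).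
  by rewrite (torque_shift hv hx).
- move=> y y'.
  have := action_taylor rho0 rho_sym (UA (eta y)) (UA (eta y')) (UE _) (UE _)
    (normr_ge0 (y' - y)) (close y y').
  have -> : \sum_i rho i * mean T (torque (U (eta y)) i) * (phase (U (eta y')) i - phase (U (eta y)) i) =
      \sum_(j < d.+1) G y ord0 j * (y' - y) ord0 j.
    rewrite (bigID zero) /= big1 ?add0r; last first.
      by move=> i zi; rewrite (solution_mean_torque (UE _) zi) mulr0 mul0r.
    rewrite (reindex e); last first.
      exists (fun i => odflt ord0 [pick j : 'I_d.+1 | e j == i]) => [j _|i /e_onto[j <-]].
        by case: pickP => [j' /eqP/e_inj|/(_ j)] //; rewrite eqxx.
      by case: pickP => [j' /eqP/e_inj -> //|/(_ j)]; rewrite eqxx.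
    rewrite big_mkcond /=; apply: eq_bigr => j _.
    by rewrite e_rot !mxE !(solution_phase (UE _)) // !etaE.
  move=> h; apply: le_trans h _; rewrite lerD2l ler_wpM2r ?sqr_ge0 // /C; lra.
- move=> y y'; apply: norm_row_le; first by rewrite mulr_ge0 // ltW.
  move=> j; rewrite !mxE -mulrBr -meanB; [|exact: torque_continuous|exact: torque_continuous].
  rewrite normrM gtr0_norm //.
  have hm : `|mean T (fun s => torque (U (eta y')) (e j) s - torque (U (eta y)) (e j) s)| <=
      (2 * a (e j) + 6 * B ^+ 2 * csum (e j)) * `|y' - y|.
    apply: (mean_bound T_gt0).
      by apply: continuous_sub; exact: torque_continuous.
    move=> t _; exact: (torque_close (UA _) (UA _) (normr_ge0 _) (close y y')).
  apply: le_trans (ler_wpM2l (ltW (rho0 (e j))) hm) _; rewrite mulrA ler_wpM2r //.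
  have : rho (e j) * (2 * a (e j) + 6 * B ^+ 2 * csum (e j)) <= Cg.
    rewrite /Cg [leRHS](bigD1 (e j)) //= lerDl; apply: sumr_ge0 => i _; exact: Cg_term.
  rewrite /C; lra.
- move=> crit [crit0 crit_inj]; exists (fun k => U (eta (crit k))); split.
    move=> k; exists (eta (crit k)); split=> // i.
    case: (boolP (zero i)) => zi; first exact: (solution_mean_torque (UE _) zi).
    have [j <-] := e_onto i zi.
    have /rowP/(_ j) := crit0 k; rewrite !mxE => /eqP.
    by rewrite mulf_eq0 (gt_eqF (rho0 _)) => /eqP.
  move=> k k' z hz; apply: (crit_inj k k' (z \o e)); apply/rowP => j.
  by have := hz (e j); rewrite !(solution_phase (UE _)) // !etaE !mxE.
Qed.
End System.

(** * Lagrange equations in normalized form *)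

Section PhysicalLagrangian.
Variables (R : realType) (N : nat).
Variables (m l : 'I_N -> R) (g : R).
Implicit Types (q p : 'rV[R]_N) (i j : 'I_N).

Definition link_inertia i : R := alpha m i * l i ^+ 2.

(** The off-diagonal coefficients of [inertia m l], divided by [link_inertia i]. *)
Definition coupling i j : R :=
  if i == j then 0 else alpha m (if (i <= j)%N then j else i) * l j / (alpha m i * l i).

Let b i j : R := alpha m (if (i <= j)%N then j else i) * l i * l j.

Let b_sym i j : b i j = b j i.
Proof.
rewrite /b; case: ltngtP => [||/val_inj -> //] _; by rewrite mulrAC.
Qed.

Lemma derive_along_line (f : 'rV[R]_N -> R) q e :
  'D_e f q = derive1 (fun h : R => f (h *: e + q)) 0.
Proof.
rewrite /derive1 /derive; congr (lim (_ @ 0^')); apply: funext => h /=.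
by rewrite addr0 scale0r add0r.
Qed.

Lemma is_derive_bigsum (I : finType) (F : I -> R -> R) (dF : I -> R) (t : R) :
  (forall k : I, is_derive t 1 (F k) (dF k)) ->
  is_derive t 1 (fun s => \sum_k F k s) (\sum_k dF k).
Proof.
move=> h; elim: (index_enum I) => [|i r IH].
  rewrite big_nil (_ : (fun s => _) = cst 0); first exact: (is_derive_cst (0 : R) t 1).
  by apply: funext => s; rewrite big_nil.
rewrite big_cons (_ : (fun s => _) = F i + (fun s => \sum_(k <- r) F k s)).
  exact: (is_deriveD (h i) IH).
by apply: funext => s; rewrite big_cons.
Qed.

Lemma is_derive_affine (x y t : R) : is_derive t 1 (fun h => h * y + x) y.
Proof.
have -> : (fun h => h * y + x) = y \*: id + cst x by apply: funext => h; rewrite /= mulrC.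
apply: (is_derive_eq (is_deriveD (is_deriveZ y (is_derive_id t 1)) (is_derive_cst x t 1))).
by rewrite addr0 /GRing.scale /= mulr1.
Qed.

Lemma is_derive_scale (x dF t : R) (F : R -> R) : is_derive t 1 F dF ->
  is_derive t 1 (fun s => x * F s) (x * dF).
Proof. exact: is_deriveZ. Qed.

Lemma is_derive_mul (F G : R -> R) (dF dG t : R) : is_derive t 1 F dF -> is_derive t 1 G dG ->
  is_derive t 1 (fun s => F s * G s) (dF * G t + F t * dG).
Proof.
move=> hF hG; apply: (is_derive_eq (is_deriveM hF hG)).
by rewrite /GRing.scale /=; ring.
Qed.

Lemma is_derive_cos_comp (F : R -> R) (dF t : R) : is_derive t 1 F dF ->
  is_derive t 1 (fun s => cos (F s)) (- sin (F t) * dF).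
Proof. by move=> hF; exact: (is_derive1_comp (is_derive_cos (F t)) hF). Qed.

Lemma is_derive_sub (F G : R -> R) (dF dG t : R) : is_derive t 1 F dF -> is_derive t 1 G dG ->
  is_derive t 1 (fun s => F s - G s) (dF - dG).
Proof. exact: is_deriveB. Qed.

Lemma is_derive_add (F G : R -> R) (dF dG t : R) : is_derive t 1 F dF -> is_derive t 1 G dG ->
  is_derive t 1 (fun s => F s + G s) (dF + dG).
Proof. exact: is_deriveD. Qed.

Lemma is_derive_const (x t : R) : is_derive t 1 (fun=> x) 0.
Proof. exact: is_derive_cst. Qed.

Lemma lagrangian_sum q p : lagrangian m l g q p =
  2^-1 * (\sum_i \sum_j b i j * (cos (q 0 i - q 0 j) * (p 0 i * p 0 j))) +
  g * \sum_j beta m l j * cos (q 0 j).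
Proof.
rewrite /lagrangian /potential; congr (2^-1 * _ + _).
rewrite /kinetic /dot exchange_big /=; apply: eq_bigr => j _.
rewrite mxE mulr_suml; apply: eq_bigr => i _.
by rewrite mxE /b; ring.
Qed.

Let delta (i j : 'I_N) : R := (j == i)%:R.

Let sum_delta (F : 'I_N -> R) i : \sum_j delta i j * F j = F i.
Proof.
rewrite (bigD1 i) //= /delta eqxx mul1r big1 ?addr0 // => j /negbTE ->.
by rewrite mul0r.
Qed.

Lemma Lq_sum q p i : Lq m l g q p i =
  - (\sum_j b i j * (sin (q 0 i - q 0 j) * (p 0 i * p 0 j))) - g * (beta m l i * sin (q 0 i)).
Proof.
pose y (j : 'I_N) (h : R) := h * delta i j + q 0 j.
have yE h j : (h *: delta_mx 0 i + q) 0 j = y j h.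
  by rewrite !mxE eqxx /y /delta.
have dy j : is_derive (0 : R) 1 (y j) (delta i j) by exact: is_derive_affine.
have y0 j : y j 0 = q 0 j by rewrite /y mul0r add0r.
pose S i j := b i j * (sin (q 0 i - q 0 j) * (p 0 i * p 0 j)).
rewrite /Lq derive_along_line.
have -> : (fun h : R => lagrangian m l g (h *: delta_mx 0 i + q) p) =
  (fun h => 2^-1 * (\sum_i \sum_j b i j * (cos (y i h - y j h) * (p 0 i * p 0 j)))
     + g * \sum_j beta m l j * cos (y j h)).
  apply: funext => h; rewrite lagrangian_sum; congr (2^-1 * _ + g * _).
    by apply: eq_bigr => a _; apply: eq_bigr => c _; rewrite !yE.
  by apply: eq_bigr => a _; rewrite yE.
have dK a c : is_derive (0 : R) 1 (fun h => b a c * (cos (y a h - y c h) * (p 0 a * p 0 c)))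
    (delta i a * (- S a c) + delta i c * S a c).
  apply: (is_derive_eq (is_derive_scale (b a c) (is_derive_mul
     (is_derive_cos_comp (is_derive_sub (dy a) (dy c))) (is_derive_const (p 0 a * p 0 c) 0)))).
  by rewrite !y0 /S; ring.
have dP c : is_derive (0 : R) 1 (fun h => beta m l c * cos (y c h))
    (delta i c * - (beta m l c * sin (q 0 c))).
  apply: (is_derive_eq (is_derive_scale _ (is_derive_cos_comp (dy c)))).
  by rewrite y0; ring.
rewrite derive1E; have := is_derive_add
  (is_derive_scale 2^-1 (is_derive_bigsum (fun a => is_derive_bigsum (dK a))))
  (is_derive_scale g (is_derive_bigsum dP)).
move=> /(@derive_val _ _ _ _ _ _ _) ->.
rewrite sum_delta.
have -> : \sum_a \sum_c (delta i a * (- S a c) + delta i c * S a c) =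
   - \sum_c S i c + \sum_a S a i.
  under eq_bigr => a _ do rewrite big_split /= sum_delta -mulr_sumr sumrN.
  by rewrite big_split /= sum_delta.
have -> : \sum_a S a i = - \sum_c S i c.
  rewrite -sumrN; apply: eq_bigr => c _.
  by rewrite /S b_sym -(opprB (q 0 i) (q 0 c)) sinN; ring.
by field.
Qed.

Lemma Lp_sum q p i : Lp m l g q p i = \sum_j b i j * (cos (q 0 i - q 0 j) * p 0 j).
Proof.
pose y (j : 'I_N) (h : R) := h * delta i j + p 0 j.
have yE h j : (h *: delta_mx 0 i + p) 0 j = y j h.
  by rewrite !mxE eqxx /y /delta.
have dy j : is_derive (0 : R) 1 (y j) (delta i j) by exact: is_derive_affine.
have y0 j : y j 0 = p 0 j by rewrite /y mul0r add0r.
pose C i j := b i j * (cos (q 0 i - q 0 j) * p 0 j).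
rewrite /Lp derive_along_line.
have -> : (fun h : R => lagrangian m l g q (h *: delta_mx 0 i + p)) =
  (fun h => 2^-1 * (\sum_i \sum_j b i j * (cos (q 0 i - q 0 j) * (y i h * y j h)))
     + g * \sum_j beta m l j * cos (q 0 j)).
  apply: funext => h; rewrite lagrangian_sum; congr (2^-1 * _ + g * _).
  by apply: eq_bigr => a _; apply: eq_bigr => c _; rewrite !yE.
have dK a c : is_derive (0 : R) 1 (fun h => b a c * (cos (q 0 a - q 0 c) * (y a h * y c h)))
    (delta i a * C a c + delta i c * C c a).
  apply: (is_derive_eq (is_derive_scale (b a c) (is_derive_scale (cos (q 0 a - q 0 c))
    (is_derive_mul (dy a) (dy c))))).
  rewrite !y0 /C (b_sym c a) -(opprB (q 0 a) (q 0 c)) cosN; ring.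
rewrite derive1E; have := is_derive_add
  (is_derive_scale 2^-1 (is_derive_bigsum (fun a => is_derive_bigsum (dK a))))
  (is_derive_const (g * \sum_j beta m l j * cos (q 0 j)) 0).
move=> /(@derive_val _ _ _ _ _ _ _) ->.
have -> : \sum_a \sum_c (delta i a * C a c + delta i c * C c a) =
   \sum_c C i c + \sum_a C i a.
  under eq_bigr => a _ do rewrite big_split /= (sum_delta (C^~ a)) -mulr_sumr.
  by rewrite big_split /= (sum_delta (fun a => \sum_c C a c)).
by rewrite addr0 /C; field.
Qed.

Hypothesis alpha_gt0 : forall i, 0 < alpha m i.
Hypothesis l_gt0 : forall i, 0 < l i.

Let al_neq0 i : alpha m i * l i != 0.
Proof. by rewrite mulf_neq0 // gt_eqF. Qed.

Lemma link_inertia_gt0 i : 0 < link_inertia i.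
Proof. by rewrite mulr_gt0 // exprn_gt0. Qed.

Lemma coupling_inertia i j : i != j -> link_inertia i * coupling i j = b i j.
Proof.
move=> ij; rewrite /coupling (negbTE ij) /link_inertia /b.
have := al_neq0 i; rewrite mulf_eq0 negb_or => /andP[a0 l0].
by field; rewrite a0 l0.
Qed.

Lemma coupling_diag i : coupling i i = 0.
Proof. by rewrite /coupling eqxx. Qed.

Lemma inertia_coupling_sym i j : link_inertia i * coupling i j = link_inertia j * coupling j i.
Proof.
have [->//|ij] := eqVneq i j.
by rewrite !coupling_inertia // 1?eq_sym // b_sym.
Qed.

Lemma Lp_normalized q p i : Lp m l g q p i =
  link_inertia i * (p 0 i + \sum_j coupling i j * (cos (q 0 i - q 0 j) * p 0 j)).
Proof.
rewrite Lp_sum mulrDr mulr_sumr (bigD1 i) //= [X in _ = _ + X](bigD1 i) //=.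
rewrite coupling_diag mul0r mulr0 add0r subrr cos0 mul1r; congr (_ + _).
  by rewrite /b leqnn /link_inertia; ring.
by apply: eq_bigr => j ji; rewrite [RHS]mulrA coupling_inertia // eq_sym.
Qed.

Lemma Lq_normalized q p i : Lq m l g q p i =
  link_inertia i * (- (g / l i * sin (q 0 i)) -
    \sum_j coupling i j * (sin (q 0 i - q 0 j) * (p 0 i * p 0 j))).
Proof.
rewrite Lq_sum mulrBr mulr_sumr addrC; congr (_ - _).
  rewrite /beta /link_inertia; have := l_gt0 i => /gt_eqF/negbT l0.
  by field.
rewrite (bigD1 i) //= [X in _ = X](bigD1 i) //= subrr sin0 mul0r !mulr0 !add0r.
by apply: eq_bigr => j ji; rewrite [RHS]mulrA coupling_inertia // eq_sym.
Qed.

End PhysicalLagrangian.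

(** * From momentum balance to the pendulum equations *)

Section Bridge.
Context {R : realType} {N : nat}.

Lemma lipschitz_abs_continuous (h : R -> R) (K a b : R) :
  (forall s t, `|h t - h s| <= K * `|t - s|) -> abs_continuous a b h.
Proof.
move=> hK e e0.
have K0 : 0 <= K by have := hK 0 1; rewrite subr0 normr1 mulr1; apply: le_trans.
exists (e / (K + 1)) => [|n u w uw _ small]; first by rewrite divr_gt0 //; lra.
apply: (@le_lt_trans _ _ (K * \sum_(i < n) (w i - u i))).
  rewrite mulr_sumr; apply: ler_sum => i _; apply: le_trans (hK _ _) _.
  by have [_ [h0 _]] := uw i; rewrite ger0_norm // subr_ge0.
apply: (@le_lt_trans _ _ (K * (e / (K + 1)))); first by rewrite ler_wpM2l // ltW.
rewrite mulrA ltr_pdivrMr; last lra.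
by rewrite mulrDr mulr1 mulrC ltrDl.
Qed.

Lemma bounded_locally_integrable (h : R -> R) (M : R) :
  measurable_fun setT h -> (forall t, `|h t| <= M) -> locally_integrable setT h.
Proof.
move=> mh hM; split=> //; first exact: openT.
move=> K _ cK.
have [A [_ hA]] := compact_bounded cK.
have KA : K `<=` `[- (A + 1), A + 1]%classic.
  have A1 : A < A + 1 by rewrite ltrDl.
  by move=> x /(hA _ A1) /=; rewrite ler_norml in_itv.
have mK : measurable K by exact: measurable_realfun.compact_measurable.
have : lebesgue_measure.-integrable K (EFin \o h).
  by apply: integrableS (bounded_integrable mh hM (- (A + 1)) (A + 1)).
by case/integrableP.
Qed.

(** Along the curve, [Lp] is [link_inertia i] times the normalized momentum minus
    impulse, which is differentiable everywhere, plus the primitive of the force, which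
    is differentiable at the Lebesgue points of the force. *)
Lemma solves_pendulum_of_flow (m l : 'I_N -> R) (g M K : R) (f : R -> 'rV[R]_N)
    (q p : 'I_N -> R -> R) :
  (forall i, 0 < alpha m i) -> (forall i, 0 < l i) ->
  (forall i, measurable_fun setT (fun t => f t 0 i)) ->
  (forall i t, `|f t 0 i| <= M) ->
  (forall i t, is_derive (t : R) (1 : R) (q i) (p i t)) ->
  (forall i s t, `|p i t - p i s| <= K * `|t - s|) ->
  (forall i t, is_derive (t : R) (1 : R)
    (fun s => p i s + \sum_j coupling m l i j * (cos (q i s - q j s) * p j s)
              - prim (fun r => f r 0 i) s / link_inertia m l i)
    (- (g / l i * sin (q i t)) -
     \sum_j coupling m l i j * (sin (q i t - q j t) * (p i t * p j t)))) ->
  solves_pendulum m l g f (fun t => \row_i q i t).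
Proof.
move=> al0 l0 mf fM dq pK dP.
have coordE i : (fun s => (\row_j q j s) 0 i) = q i.
  by apply: funext => s; rewrite mxE.
have velE : velocity (fun t => \row_i q i t) = fun t => \row_i p i t.
  apply: funext => t; apply/rowP => i; rewrite !mxE coordE derive1E.
  exact: (@derive_val _ _ _ _ _ _ _ (dq i t)).
have LpE i : (fun s => Lp m l g (\row_j q j s) (\row_j p j s) i) = fun s =>
    link_inertia m l i *
      (p i s + \sum_j coupling m l i j * (cos (q i s - q j s) * p j s)
       - prim (fun r => f r 0 i) s / link_inertia m l i) + prim (fun r => f r 0 i) s.
  apply: funext => s; rewrite (Lp_normalized _ al0 l0) mxE.
  have -> : \sum_j coupling m l i j *
      (cos ((\row_j q j s) 0 i - (\row_j q j s) 0 j) * (\row_j p j s) 0 j) =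
      \sum_j coupling m l i j * (cos (q i s - q j s) * p j s).
    by apply: eq_bigr => j _; rewrite !mxE.
  have := link_inertia_gt0 al0 l0 i; move/gt_eqF/negbT => li0.
  set A := link_inertia m l i in li0 *; set S := \sum_j _; set P := prim _ _.
  by rewrite mulrBr mulrCA divff // mulr1 subrK.
have LqE i t : Lq m l g (\row_j q j t) (\row_j p j t) i = link_inertia m l i *
    (- (g / l i * sin (q i t)) -
     \sum_j coupling m l i j * (sin (q i t - q j t) * (p i t * p j t))).
  rewrite (Lq_normalized _ al0 l0) !mxE; congr (_ * (_ - _)).
  by apply: eq_bigr => j _; rewrite !mxE.
split.
- by move=> t i; rewrite coordE; exact: (@ex_derive _ _ _ _ _ _ _ (dq i t)).
- move=> a b i; rewrite velE.
  have -> : (fun s => (\row_j p j s) 0 i) = p i by apply: funext => s; rewrite mxE.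
  exact: lipschitz_abs_continuous (pK i).
have leb i : {ae lebesgue_measure, forall t : R, lebesgue_pt (fun r => f r 0 i) t}.
  by apply: lebesgue_differentiation; apply: bounded_locally_integrable (mf i) (fM i).
apply: (@filterS _ (almost_everywhere lebesgue_measure) _ _ _ _ (filter_forall _ leb)).
move=> t ht i; rewrite velE LpE LqE /=.
have dF := is_derive_prim (bounded_integrable (mf i) (fM i)) (ht i).
have dL := is_derive_add (is_derive_scale (link_inertia m l i) (dP i t)) dF.
split; first exact: (@ex_derive _ _ _ _ _ _ _ dL).
by rewrite derive1E (@derive_val _ _ _ _ _ _ _ dL) addrAC subrr add0r.
Qed.

End Bridge.

(** * A hierarchy of masses and lengths *)

Section Hierarchy.
Context {R : realType} {N : nat}.
Variables (g M eps : R).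
Hypotheses (g_gt0 : 0 < g) (M_gt0 : 0 < M) (eps_gt0 : 0 < eps) (eps_le1 : eps <= 1).
Implicit Types i j : 'I_N.

(* both [N * y] and [N ^ 2 * y] are at most [eps] *)
Let y : R := eps / (N%:R + 2) ^+ 2.

Let y_gt0 : 0 < y.
Proof. by rewrite divr_gt0 // exprn_gt0 // ltr_wpDl. Qed.

Let yE : y * (N%:R + 2) ^+ 2 = eps.
Proof. by rewrite divfK // expf_neq0 // gt_eqF // ltr_wpDl. Qed.

Let y_small : [/\ y < 1, N%:R * y <= eps & N%:R ^+ 2 * y <= eps].
Proof.
have n0 : 0 <= N%:R :> R by [].
have := yE; set n : R := N%:R in n0 *; move=> e.
have ny : 0 <= n * y by rewrite mulr_ge0 // ltW.
have nny : 0 <= n * (n * y) by rewrite mulr_ge0.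
have := y_gt0; have := eps_le1; have e' : n * (n * y) + 4 * (n * y) + 4 * y = eps by rewrite -e; ring.
have -> : n ^+ 2 * y = n * (n * y) by ring.
by move=> *; split; lra.
Qed.

Let pow_anti k k' : (k <= k')%N -> y ^+ k' <= y ^+ k.
Proof.
have [y1 _ _] := y_small.
by move=> kk'; apply: ler_wiXn2l => //; exact: ltW.
Qed.

(** Gravity decreases along the chain like the powers [y ^+ (3 ^ i)].  With tails
    such that [alpha_i l_i] is proportional to [y ^+ (i * 3 ^ N)], the coupling of [i]
    to [j] is [y ^+ ((j - i) * 3 ^ N)] if [i < j] and [y ^+ (3 ^ i - 3 ^ j)] if [j < i].
    In both cases its square is at most [y * y ^+ (3 ^ i)]. *)
Definition rod_length i : R := g / y ^+ (3 ^ i).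

(* large enough for a force of size [M] to be negligible on every link *)
Let S : R := M / (eps * g * y ^+ (N * 3 ^ N)).

Definition tail_mass (k : nat) : R :=
  if (k < N)%N then S * y ^+ (k * 3 ^ N) * y ^+ (3 ^ k) / g else 0.

Definition bob_mass i : R := tail_mass i - tail_mass i.+1.

Let S_gt0 : 0 < S.
Proof. by do ?[apply: divr_gt0 | apply: mulr_gt0 | apply: exprn_gt0]. Qed.

Lemma rod_length_gt0 i : 0 < rod_length i.
Proof. by rewrite divr_gt0 // exprn_gt0. Qed.

Lemma alpha_bob_mass i : alpha bob_mass i = tail_mass i.
Proof.
have -> : alpha bob_mass i = \sum_(i <= k < N) (tail_mass k - tail_mass k.+1).
  by rewrite big_geq_mkord.
transitivity (- \sum_(i <= k < N) (tail_mass k.+1 - tail_mass k)).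
  by rewrite -sumrN; apply: eq_bigr => k _; rewrite opprB.
rewrite telescope_sumr; last exact: ltnW.
by rewrite opprB [X in _ - X]/tail_mass ltnn subr0.
Qed.

Lemma tail_massE i : tail_mass i = S * y ^+ (i * 3 ^ N) * y ^+ (3 ^ i) / g.
Proof. by rewrite /tail_mass ltn_ord. Qed.

Lemma tail_mass_gt0 i : 0 < tail_mass i.
Proof. by rewrite tail_massE; do ?[apply: divr_gt0 | apply: mulr_gt0 | apply: exprn_gt0]. Qed.

Lemma bob_mass_gt0 i : 0 < bob_mass i.
Proof.
rewrite subr_gt0; have := tail_mass_gt0 i; rewrite {2}/tail_mass; case: ifP => // _ _.
rewrite tail_massE; clearbody S; rewrite ltr_pM2r ?invr_gt0 // -!mulrA ltr_pM2l // -!exprD.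
have [y1 _ _] := y_small.
rewrite ltr_iXn2l // mulSn expnS.
have := expn_gt0 3 N; have := expn_gt0 3 i; lia.
Qed.

Lemma tail_mass_length i : tail_mass i * rod_length i = S * y ^+ (i * 3 ^ N).
Proof.
rewrite tail_massE /rod_length.
have := expf_neq0 (3 ^ i) (lt0r_neq0 y_gt0); have := lt0r_neq0 g_gt0.
by set Y := y ^+ (3 ^ i); move=> g0 Y0; field; rewrite g0 Y0.
Qed.

Lemma gravity_ratio i : g / rod_length i = y ^+ (3 ^ i).
Proof. by rewrite /rod_length invf_div mulrCA divff ?mulr1 // gt_eqF. Qed.

Lemma gravity_ratio_le1 i : g / rod_length i <= 1.
Proof. by rewrite gravity_ratio -(expr0 y); exact: pow_anti. Qed.

(** For [j < i] this is [2 * (3 ^ i - 3 ^ j) >= 3 ^ i + 1], as [3 ^ j <= 3 ^ i / 3]. *)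
Lemma coupling_le i j : coupling bob_mass rod_length i j <= y ^+ uphalf (3 ^ i + 1).
Proof.
rewrite /coupling; case: eqP => [_|/eqP ij]; first by rewrite exprn_ge0 // ltW.
have yn0 k : y ^+ k != 0 by rewrite expf_neq0 // gt_eqF.
case: (leqP i j) => lij; rewrite !alpha_bob_mass.
  have {}lij : (i < j)%N by rewrite ltn_neqAle lij andbT.
  rewrite !tail_mass_length.
  have -> : S * y ^+ (j * 3 ^ N) / (S * y ^+ (i * 3 ^ N)) = y ^+ ((j - i) * 3 ^ N).
    rewrite -(subnK (ltnW lij)) addnK mulnDl exprD mulrCA mulfK //.
    by rewrite mulf_neq0 // gt_eqF.
  apply: pow_anti.
  have : (3 ^ i <= 3 ^ N)%N by rewrite leq_exp2l // ltnW.
  have : (1 * 3 ^ N <= (j - i) * 3 ^ N)%N by rewrite leq_mul2r subn_gt0 lij orbT.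
  lia.
have al0 := lt0r_neq0 (tail_mass_gt0 i).
have -> : tail_mass i * rod_length j / (tail_mass i * rod_length i) =
    y ^+ (3 ^ i - 3 ^ j).
  have e : (3 ^ j <= 3 ^ i)%N by rewrite leq_exp2l // ltnW.
  rewrite -mulf_div divff // mul1r /rod_length -{1}(subnK e) exprD.
  have := yn0 (3 ^ i - 3 ^ j)%N; have := yn0 (3 ^ j)%N; have := lt0r_neq0 g_gt0.
  by set Y := y ^+ _; set Z := y ^+ _ => g0 Z0 Y0; field; rewrite g0 Y0 Z0.
apply: pow_anti.
have : (3 ^ j.+1 <= 3 ^ i)%N by rewrite leq_exp2l.
rewrite expnS; have := expn_gt0 3 j; lia.
Qed.

Lemma coupling_ge0 i j : 0 <= coupling bob_mass rod_length i j.
Proof.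
rewrite /coupling; case: eqP => // _; rewrite !alpha_bob_mass.
have p k k' := mulr_gt0 (tail_mass_gt0 k) (rod_length_gt0 k').
exact: ltW (divr_gt0 (p _ j) (p i i)).
Qed.

Let coupling_sum_le i :
  \sum_j coupling bob_mass rod_length i j <= N%:R * y ^+ uphalf (3 ^ i + 1).
Proof.
apply: le_trans (ler_sum _ (fun j _ => coupling_le i j)) _.
by rewrite sumr_const card_ord mulr_natl.
Qed.

Lemma coupling_sum_small i : \sum_j coupling bob_mass rod_length i j <= eps.
Proof.
have [_ h _] := y_small.
apply: le_trans (coupling_sum_le i) _; apply: le_trans h; rewrite ler_wpM2l //.
apply: (@pow_anti 1%N); have := expn_gt0 3 i; lia.
Qed.

Lemma coupling_sum_sqr_small i :
  (\sum_j coupling bob_mass rod_length i j) ^+ 2 <= eps * (g / rod_length i).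
Proof.
have [_ _ h] := y_small.
have c0 : 0 <= \sum_j coupling bob_mass rod_length i j.
  by apply: sumr_ge0 => j _; exact: coupling_ge0.
apply: le_trans (_ : (N%:R * y ^+ uphalf (3 ^ i + 1)) ^+ 2 <= _).
  by rewrite ler_sqr ?nnegrE ?coupling_sum_le // (le_trans c0 (coupling_sum_le i)).
rewrite gravity_ratio exprMn -exprM.
apply: (@le_trans _ _ (N%:R ^+ 2 * (y * y ^+ (3 ^ i)))).
  rewrite ler_wpM2l // -exprS; apply: pow_anti; lia.
by rewrite mulrA ler_wpM2r // exprn_ge0 // ltW.
Qed.

Lemma forcing_small i :
  M / link_inertia bob_mass rod_length i <= eps * (g / rod_length i).
Proof.
have li0 : 0 < link_inertia bob_mass rod_length i.
  by apply: link_inertia_gt0 => j; rewrite ?alpha_bob_mass ?tail_mass_gt0 ?rod_length_gt0.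
rewrite ler_pdivrMr // /link_inertia alpha_bob_mass expr2 [X in _ <= _ * X]mulrA tail_mass_length.
have -> : eps * (g / rod_length i) * (S * y ^+ (i * 3 ^ N) * rod_length i) =
    eps * g * y ^+ (i * 3 ^ N) * S.
  by have := lt0r_neq0 (rod_length_gt0 i); set Y := y ^+ _ => h; field.
rewrite mulrA ler_pdivlMr ?mulr_gt0 ?exprn_gt0 // mulrC ler_pM2r // ler_pM2l ?mulr_gt0 //.
by apply: pow_anti; rewrite leq_mul2r ltnW ?orbT.
Qed.

End Hierarchy.

(** * Counting classes of solutions *)

Section Counting.
Context {R : realType} {N : nat}.

Lemma card_ge_injection (D : finType) (X : Type) (A : set X) (h : D -> X) (n : nat) :
  (n <= #|D|)%N -> injective h -> (forall d, A (h d)) -> (`I_n #<= A)%card.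
Proof.
case: n => [|n] nD h_inj hA; first by rewrite II0 card_ge0.
pose d0 : D := enum_val (Ordinal nD).
pose F k := h (nth d0 (enum D) k).
have F_inj : {in `I_n.+1 &, injective F}.
  have lt k : k \in `I_n.+1 -> (k < size (enum D))%N.
    by move=> /set_mem kn; rewrite -cardE; exact: leq_trans kn nD.
  by move=> k k' /lt kD /lt kD' /h_inj/eqP; rewrite nth_uniq ?enum_uniq // => /eqP.
apply: card_le_trans (subset_card_le (_ : F @` `I_n.+1 `<=` A)); last first.
  by move=> _ [k _ <-]; exact: hA.
by have /card_eqPle[] := inj_card_eq F_inj.
Qed.

Lemma distinct_solutions_ge (m l : 'I_N -> R) (g T : R) (f : R -> 'rV[R]_N) (v : 'rV[int]_N)
    (D : finType) (q : D -> R -> 'rV[R]_N) (n : nat) : (n <= #|D|)%N ->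
  (forall d, rotational_solutions m l g f v T (q d)) ->
  (forall d d', same_solution f (q d) (q d') -> d = d') ->
  (`I_n #<= distinct_rotational_solutions m l g f v T)%card.
Proof.
move=> nD q_sol q_inj.
apply: (card_ge_injection (h := fun d =>
  [set q' | rotational_solutions m l g f v T q' /\ same_solution f (q d) q'])) nD _ _.
  move=> d d' /= e; apply: q_inj.
  have : [set q' | rotational_solutions m l g f v T q' /\ same_solution f (q d') q'] (q d').
    by split=> //; exact: same_solution_refl.
  by rewrite -e; case.
by move=> d; exists (q d).
Qed.

Lemma prime_vector_combination (v : 'rV[int]_N) : prime_vector v ->
  exists i j (x y : int), x * v 0 i + y * v 0 j = 1.
Proof.
case=> _ [[i [vi _]]|[i [j [_ /eqP ij]]]]; first by exists i, i, 1, 0; rewrite vi.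
by have [x [y]] := Bezoutz (v 0 i) (v 0 j); rewrite ij; exists i, j, x, y.
Qed.

(** Otherwise the combination would be even. *)
Lemma combination_odd_coord (v : 'rV[int]_N) i j (x y : int) :
  x * v 0 i + y * v 0 j = 1 -> exists i0 (h : int), v 0 i0 = 2 * h + 1.
Proof.
have parity (z : int) : exists h : int, z = 2 * h \/ z = 2 * h + 1.
  exists (z %/ 2)%Z; have := divz_eq z 2; have := @modz_ge0 z 2 isT; have := @ltz_pmod z 2 isT.
  lia.
have [h [ei|ei]] := parity (v 0 i); last by exists i, h.
have [h' [ej|ej]] := parity (v 0 j); last by exists j, h'.
rewrite ei ej => e; exfalso.
have : 2 * (x * h + y * h') = 1 by rewrite -[RHS]e; ring.
lia.
Qed.

(** The number [s] is a time translation in units of half a period, and [b], [b'] are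
    phases in units of [pi].  All [v i * s] are integers, hence so is [s], as a
    combination of two of them; at the odd coordinate [i0], where the phases agree,
    [v i0 * s] is even, so [s] is even and all phases differ by even numbers. *)
Lemma half_period_parity (v k b b' : 'rV[int]_N) (s : R) i j (x y : int) i0 (h : int) :
  x * v 0 i + y * v 0 j = 1 -> v 0 i0 = 2 * h + 1 ->
  (forall i, (b' 0 i)%:~R = (b 0 i)%:~R + (v 0 i)%:~R * s + 2 * (k 0 i)%:~R) ->
  b 0 i0 = b' 0 i0 -> exists w : 'rV[int]_N, forall i, b' 0 i - b 0 i = 2 * w 0 i.
Proof.
move=> xy odd0 e b0.
pose zz i := b' 0 i - b 0 i - 2 * k 0 i.
have vs i' : (v 0 i')%:~R * s = (zz i')%:~R.
  by rewrite /zz !intrB intrM e; ring.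
pose sigma := x * zz i + y * zz j.
have sE : s = sigma%:~R.
  transitivity ((x * v 0 i + y * v 0 j)%:~R * s); first by rewrite xy mul1r.
  by rewrite /sigma !intrD !intrM -!vs mulrDl !mulrA.
have vsz i' : v 0 i' * sigma = zz i'.
  by apply: (@intr_inj R); rewrite intrM -sE vs.
pose tau := - (k 0 i0) - h * sigma.
have st : sigma = 2 * tau.
  have := vsz i0; rewrite odd0 /zz b0 subrr /tau mulrDl mul1r; lia.
exists (\row_i (v 0 i * tau + k 0 i)) => i'; rewrite mxE.
have := vsz i'; rewrite st /zz mulrCA; lia.
Qed.

Definition bit_angle (z : bool) : R := if z then pi else 0.

Lemma bit_angleE (z : bool) : bit_angle z = pi * (z : int)%:~R.
Proof. by case: z; rewrite ?mulr1 ?mulr0. Qed.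

Definition extend_bits (P : pred 'I_N) (b : {ffun {i | P i} -> bool}) (i : 'I_N) : bool :=
  if insub i is Some s then b s else false.

Lemma extend_bits_inj (P : pred 'I_N) (b b' : {ffun {i | P i} -> bool}) :
  (forall i, P i -> extend_bits b i = extend_bits b' i) -> b = b'.
Proof.
by move=> e; apply/ffunP => s; have := e (val s) (valP s); rewrite /extend_bits !valK.
Qed.

(** Otherwise the two phases would differ by an odd multiple of [pi] up to an error
    of 1, while [pi > 1]. *)
Lemma bit_angle_near (z z' : bool) (x x' : R) (k : int) :
  `|x - bit_angle z| <= 1 / 2 -> `|x' - bit_angle z'| <= 1 / 2 ->
  x' = x + 2 * pi * k%:~R -> z = z'.
Proof.
move=> hx hx' e; have pi2 := pi_ge2 R.
pose n : int := 2 * k + (z : int) - (z' : int).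
have n0 : n = 0.
  apply/eqP; rewrite -(@intr_eq0 R) -normr_le0 leNgt; apply/negP => n0.
  have n1 : 1 <= `|n%:~R : R|.
    by rewrite -intr_norm ler1z -gtz0_ge1 -(@ltr0z R) intr_norm.
  have : `|pi * n%:~R : R| <= 1.
    have -> : pi * n%:~R = (x' - bit_angle z') - (x - bit_angle z).
      by rewrite e !bit_angleE /n intrB intrD intrM; ring.
    by apply: le_trans (ler_normB _ _) _; lra.
  rewrite normrM gtr0_norm ?pi_gt0 // => h.
  have : pi * 1 <= pi * `|n%:~R : R| by rewrite ler_wpM2l // ltW // pi_gt0.
  lra.
by move: n0; rewrite /n; clear; case: z; case: z' => //=; lia.
Qed.

Lemma eq_bits_parity (z z' : bool) (w : int) : (z' : int) - (z : int) = 2 * w -> z = z'.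
Proof. by case: z; case: z' => //=; lia. Qed.

End Counting.

(** * The forced pendulum with small coupling *)

Lemma sin_pi_int (R : realType) (n : int) : sin (pi * n%:~R) = 0 :> R.
Proof.
have main (k : nat) : sin (pi * k%:R) = 0 :> R.
  elim: k => [|k IH]; first by rewrite mulr0 sin0.
  by rewrite -natr1 mulrDr mulr1 sinDpi IH oppr0.
case: n => k; first exact: main.
by rewrite NegzE mulrNz mulrN sinN main oppr0.
Qed.

Section Forced_pendulum.
Variables (R : realType) (N : nat) (m l : 'I_N -> R) (g M0 eps B T : R).
Variables (v : 'rV[int]_N) (f : R -> 'rV[R]_N).

Notation a i := (g / l i).
Notation c := (coupling m l).
Notation csum i := (\sum_j c i j).
Notation rho i := (link_inertia m l i).
Implicit Types i j : 'I_N.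

Hypothesis g_gt0 : 0 < g.
Hypothesis alpha_gt0 : forall i, 0 < alpha m i.
Hypothesis l_gt0 : forall i, 0 < l i.
Hypothesis a_le1 : forall i, a i <= 1.
Hypothesis csum_le : forall i, csum i <= eps.
Hypothesis csum_sqr_le : forall i, csum i ^+ 2 <= eps * a i.
Hypothesis forcing_le : forall i, M0 / rho i <= eps * a i.
Hypothesis M0_gt0 : 0 < M0.
Hypothesis T_gt0 : 0 < T.
Hypothesis T_le : T <= 1 / 64.
Hypothesis eps_gt0 : 0 < eps.
Hypothesis eps_small : 2000 * B ^+ 3 * eps <= 1.

Definition mean_speed i : R := 2 * pi * (v 0 i)%:~R / T.

Hypothesis mean_speed_le : forall i, `|mean_speed i| + 1 <= B.

Hypothesis f_periodic : L2_periodic T f.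
Hypothesis f_mean : forall i, \int[lebesgue_measure]_(t in `[0, T]) f t ord0 i = 0.
Hypothesis f_le : forall t, eucl_norm (f t) <= M0.

Definition impulse i (t : R) : R := prim (fun s => f s 0 i) t / rho i.

(** The smallest amplitude compatible with the fixed-point estimates. *)
Definition fluct_size i : R :=
  16 * T * a i + 48 * B ^+ 2 * csum i + 4 * (M0 / rho i).

Definition resting i : bool := v 0 i == 0.

Let LF : R := \sum_i M0 / rho i.

Let a_gt0 i : 0 < a i. Proof. exact: divr_gt0. Qed.

Let rho_gt0 i : 0 < rho i. Proof. exact: link_inertia_gt0. Qed.

Let c_ge0 i j : 0 <= c i j.
Proof.
rewrite /coupling; case: eqP => // _.
exact: ltW (divr_gt0 (mulr_gt0 (alpha_gt0 _) (l_gt0 _)) (mulr_gt0 (alpha_gt0 _) (l_gt0 _))).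
Qed.

Let csum_ge0 i : 0 <= csum i. Proof. exact: sumr_ge0. Qed.

Let phi_gt0 i : 0 < M0 / rho i. Proof. exact: divr_gt0. Qed.

Let B_ge1 i : 1 <= B.
Proof. by have := mean_speed_le i; have := normr_ge0 (mean_speed i); lra. Qed.

Let B_powers i : B ^+ 2 * eps <= 1 / 2000 /\ B * eps <= 1 / 2000 /\ eps <= 1 / 2000.
Proof.
have B1 := B_ge1 i; have B0 : 0 <= B by apply: le_trans B1.
have e3 : B ^+ 3 * eps <= 1 / 2000 by move: eps_small; rewrite -mulrA; lra.
have h k k' : (k <= k')%N -> B ^+ k * eps <= B ^+ k' * eps.
  by move=> kk'; rewrite ler_wpM2r ?ler_weXn2l // ltW.
split; first exact: le_trans (h 2%N 3 isT) e3.
split; first exact: le_trans (h 1%N 3 isT) e3.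
by apply: le_trans (_ : B ^+ 0 * eps <= _); [rewrite mul1r|exact: le_trans (h 0%N 3 isT) e3].
Qed.

Let fluct_size_gt0 i : 0 < fluct_size i.
Proof.
have h1 : 0 < T * a i by rewrite mulr_gt0.
have h2 : 0 <= B ^+ 2 * csum i by rewrite mulr_ge0 // sqr_ge0.
rewrite /fluct_size; have := phi_gt0 i; lra.
Qed.

Let fluct_size_le1 i : fluct_size i <= 1.
Proof.
have [e2 [_ e0]] := B_powers i.
have h1 : T * a i <= 1 / 64.
  by apply: le_trans T_le; rewrite ler_piMr // ltW.
have h2 : B ^+ 2 * csum i <= B ^+ 2 * eps by rewrite ler_wpM2l // sqr_ge0.
have h3 : eps * a i <= eps by rewrite ler_piMr // ltW.
rewrite /fluct_size; have := forcing_le i; lra.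
Qed.

Let coupling_negligible i : 32 * csum i * fluct_size i * B <= a i.
Proof.
have [_ [e1 e0]] := B_powers i.
have B0 : 0 <= B by apply: le_trans (B_ge1 i).
have e3 : B ^+ 3 * eps <= 1 / 2000 by move: eps_small; rewrite -mulrA; lra.
have := forcing_le i; have := csum_sqr_le i; have := a_gt0 i; have := csum_le i.
have := csum_ge0 i; have := phi_gt0 i; have := a_le1 i; rewrite /fluct_size.
move: (a i) (csum i) (M0 / rho i) => A G P A1 P0 G0 GE A0 G2 PA.
have h1 : G * B * (T * A) <= 1 / 2000 * (1 / 64 * A).
  apply: ler_pM; rewrite ?mulr_ge0 ?(ltW T_gt0) ?(ltW A0) //.
    by apply: le_trans e1; rewrite mulrC ler_wpM2l.
  by rewrite ler_wpM2r // ltW.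
have h2 : B ^+ 3 * G ^+ 2 <= 1 / 2000 * A.
  apply: le_trans (_ : B ^+ 3 * (eps * A) <= _); first by rewrite ler_wpM2l ?exprn_ge0.
  by rewrite mulrA ler_wpM2r // ltW.
have h3 : G * B * P <= 1 / 2000 * A.
  apply: ler_pM; rewrite ?mulr_ge0 ?(ltW P0) //.
    by apply: le_trans e1; rewrite mulrC ler_wpM2l.
  by apply: le_trans PA _; rewrite ler_piMl // ?(ltW A0) //; lra.
have -> : 32 * G * (16 * T * A + 48 * B ^+ 2 * G + 4 * P) * B =
  512 * (G * B * (T * A)) + 1536 * (B ^+ 3 * G ^+ 2) + 128 * (G * B * P) by ring.
lra.
Qed.

Let mean_speed_period i : mean_speed i * T = 2 * pi * (v 0 i)%:~R.
Proof. by rewrite divfK // gt_eqF. Qed.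

Let mean_speed_resting i : resting i -> mean_speed i = 0.
Proof. by rewrite /mean_speed => /eqP ->; rewrite mulr0 mul0r. Qed.

Let f_measurable i : measurable_fun setT (fun t => f t 0 i).
Proof. by case: f_periodic. Qed.

Lemma coord_le_eucl_norm (x : 'rV[R]_N) i : `|x 0 i| <= eucl_norm x.
Proof.
rewrite -sqrtr_sqr ler_wsqrtr // /dot (bigD1 i) //= -expr2 lerDl.
by apply: sumr_ge0 => j _; rewrite -expr2 sqr_ge0.
Qed.

Let f_coord_le i t : `|f t 0 i| <= M0.
Proof. exact: le_trans (coord_le_eucl_norm _ _) (f_le t). Qed.

Let f_integrable i : integrable_on_segments (fun t => f t 0 i).
Proof. exact: bounded_integrable (f_measurable i) (f_coord_le i). Qed.

Let impulse_periodic i : periodic_on T (impulse i).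
Proof.
move=> t; rewrite /impulse; congr (_ / _).
have fp s : f (s + T) 0 i = f s 0 i by case: f_periodic => ->.
rewrite (prim_translate fp (f_measurable i) (@f_integrable i)).
by rewrite (prim_integral _ (ltW T_gt0)) f_mean addr0.
Qed.

Let impulse_lipschitz i s t : `|impulse i t - impulse i s| <= M0 / rho i * `|t - s|.
Proof.
rewrite /impulse -mulrBl normrM (gtr0_norm (_ : 0 < (rho i)^-1)) ?invr_gt0 // mulrAC.
rewrite ler_wpM2r ?invr_ge0 ?(ltW (rho_gt0 i)) //.
exact: (prim_lipschitz (f_measurable i) (f_coord_le i)).
Qed.

Let impulse_lip i s t : `|impulse i t - impulse i s| <= LF * `|t - s|.
Proof.
apply: le_trans (impulse_lipschitz i s t) _; rewrite ler_wpM2r //.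
by rewrite /LF (bigD1 i) //= lerDl; apply: sumr_ge0 => j _; exact: ltW.
Qed.

Let impulse_le i t : `|impulse i t| <= M0 / rho i.
Proof.
have [s /andP[s0 sT] /(_ _ (@impulse_periodic i)) ->] := periodic_box T_gt0 t.
have := impulse_lipschitz i 0 s.
rewrite subr0 [impulse i 0]/impulse prim0 mul0r subr0 => h; apply: le_trans h _.
by rewrite ler_piMr ?(ltW (phi_gt0 i)) // ger0_norm //; have := T_le; lra.
Qed.

Lemma impulse_ae_zero : ae_zero f -> forall i t, impulse i t = 0.
Proof.
move=> f0 i t; rewrite /impulse.
suff z r s : \int[lebesgue_measure]_(x in `[r, s]) f x 0 i = 0 by rewrite /prim !z subrr mul0r.
rewrite /Rintegral (@ae_eq_integral _ _ _ _ _ (cst 0%E)) //.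
- by rewrite integral0.
- by apply/measurable_realfun.measurable_EFinP; apply: measurable_funTS; exact: f_measurable.
- by apply: (@filterS _ (almost_everywhere lebesgue_measure) _ _ _ _ f0) => x /= -> _; rewrite mxE.
Qed.

Definition flow (u : 'I_N * R + 'I_N -> R) (t : R) : 'rV[R]_N :=
  \row_i angle T mean_speed fluct_size u i t.

Let addrKA_common (x y z : R) : (x + y) - (x + z) = y - z.
Proof. by ring. Qed.

Let flowE u t i : flow u t 0 i = angle T mean_speed fluct_size u i t.
Proof. exact: mxE. Qed.

Lemma stationary_rotational base u :
  stationary T mean_speed (fun i => a i) fluct_size base c impulse resting B LF u ->
  rotational_solutions m l g f v T (flow u).
Proof.
case=> eta [uA uE u0]; split; last first.
  move=> t i; rewrite !flowE (angle_rotates _ T_gt0 _ _ uA) addrAC subrr add0r.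
  exact: mean_speed_period.
apply: (@solves_pendulum_of_flow _ _ m l g M0 (Lam B LF) f (angle T mean_speed fluct_size u)
  (angvel mean_speed fluct_size u) alpha_gt0 l_gt0 f_measurable f_coord_le).
- exact: (is_derive_solution T_gt0 fluct_size_gt0 impulse_lip uA uE).
- by move=> i s t; rewrite /angvel addrKA_common; case: uA => h _ _ _; exact: (h i s t).
- by move=> i t; exact: (is_derive_momentum fluct_size_gt0 uA uE t (u0 i)).
Qed.

(** Equivalent solutions have equivalent phases, since the phases are means. *)
Lemma same_flow_phases base base' u w :
  admissible T fluct_size base resting B LF u ->
  admissible T fluct_size base' resting B LF w ->
  same_solution f (flow u) (flow w) ->
  exists (k : 'rV[int]_N) (theta : R), (theta <> 0 -> ae_zero f) /\
    forall i, phase w i = phase u i + mean_speed i * theta + 2 * pi * (k 0 i)%:~R.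
Proof.
move=> uA wA [k [theta [h e]]]; exists k, theta; split=> //.
have e' t i : angle T mean_speed fluct_size w i t =
    angle T mean_speed fluct_size u i (t + theta) + 2 * pi * (k 0 i)%:~R.
  exact: etrans (esym (flowE w t i))
    (etrans (e t i) (congr1 (fun x => x + _) (flowE u (t + theta) i))).
exact: (angle_phase T_gt0 (fun i => @fluct_continuous _ _ _ _ _ _ _ _ _ uA i)
  (fun i => fluct_periodic uA i) (fun i => @fluct_continuous _ _ _ _ _ _ _ _ _ wA i) e').
Qed.

Lemma torus_solutions (base : 'I_N -> R) (d : nat) (e : 'I_d.+1 -> 'I_N) :
  (forall i, resting i -> sin (base i) = 0) ->
  injective e -> (forall j : 'I_d.+1, ~~ resting (e j)) ->
  (forall i, ~~ resting i -> exists j : 'I_d.+1, e j = i) ->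
  exists us : 'I_d.+2 -> 'I_N * R + 'I_N -> R,
    (forall k, stationary T mean_speed (fun i => a i) fluct_size base c impulse resting B LF (us k)) /\
    forall k k' (z : 'I_N -> int),
      (forall i, phase (us k) i = phase (us k') i + 2 * pi * (z i)%:~R) -> k = k'.
Proof.
move=> base_sin.
have T32 : T <= 1 / 32 by have := T_le; lra.
exact: (torus_stationary T_gt0 T32 fluct_size_gt0 fluct_size_le1 a_gt0 a_le1 c_ge0
  mean_speed_le mean_speed_resting (fun i => ex_intro _ (v 0 i) (mean_speed_period i)) impulse_periodic
  impulse_le impulse_lip (fun i => lexx _) (fun i _ => coupling_negligible i) base_sin
  rho_gt0 (inertia_coupling_sym alpha_gt0 l_gt0)).
Qed.

Lemma reversible_solutions (b : 'I_N -> R) :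
  ae_zero f -> (forall i, exists n : int, b i = pi * n%:~R) ->
  exists2 u, stationary T mean_speed (fun i => a i) fluct_size b c impulse resting B LF u &
    forall i, phase u i = b i.
Proof.
move=> f0 bpi; have T32 : T <= 1 / 32 by have := T_le; lra.
have b_sin i : resting i -> sin (b i) = 0.
  by move=> _; have [n ->] := bpi i; exact: sin_pi_int.
have [u [uA uE ub u0]] := symmetric_solution T_gt0 T32 fluct_size_gt0 fluct_size_le1 a_gt0
  a_le1 c_ge0 mean_speed_le mean_speed_resting (fun i => ex_intro _ (v 0 i) (mean_speed_period i))
  impulse_periodic impulse_le impulse_lip (fun i => lexx _)
  (fun i _ => coupling_negligible i) b_sin (impulse_ae_zero f0) (fun i _ => erefl) bpi.
by exists u => //; exists b.
Qed.

(** * Lower bounds for the number of solutions *)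

(** When [f] is not zero, no time translation is allowed.  Equivalent solutions thus
    have phases congruent modulo [2 pi]: those of the resting links determine the
    equilibria, and for given equilibria those of the rotating links determine the
    critical point. *)
Lemma forced_solutions_count : ~ ae_zero f -> (0 < #|[pred i | ~~ resting i]|)%N ->
  (`I_((#|[pred i | ~~ resting i]| + 1) * 2 ^ #|[pred i | resting i]|)
     #<= distinct_rotational_solutions m l g f v T)%card.
Proof.
move=> fn0; case ed : #|_| => [//|d] _.
pose e (j : 'I_d.+1) : 'I_N := enum_val (cast_ord (esym ed) j).
have e_inj : injective e by move=> j j' /enum_val_inj/cast_ord_inj.
have e_rot (j : 'I_d.+1) : ~~ resting (e j).
  by have := enum_valP (cast_ord (esym ed) j).
have e_onto i : ~~ resting i -> exists j : 'I_d.+1, e j = i.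
  move=> ri; have iP : i \in [pred i | ~~ resting i] by [].
  by exists (cast_ord ed (enum_rank_in iP i)); rewrite /e cast_ordK enum_rankK_in.
pose bits := {ffun {i | resting i} -> bool}.
pose base (b : bits) i : R := bit_angle (extend_bits b i).
have base_sin b i : resting i -> sin (base b i) = 0.
  by move=> _; rewrite /base bit_angleE sin_pi_int.
have [us us_sol] := boolp.choice (fun b =>
  torus_solutions (base_sin b) e_inj e_rot e_onto).
have crit b k : stationary T mean_speed (fun i => a i) fluct_size (base b) c impulse resting B LF (us b k).
  by case: (us_sol b).
pose D := (bits * 'I_d.+2)%type.
apply: (@distinct_solutions_ge _ _ _ _ _ _ _ _ D (fun x => flow (us x.1 x.2))).
- by rewrite card_prod card_ffun card_bool card_sig card_ord mulnC addn1.
- by move=> [b k]; exact: stationary_rotational (crit b k).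
- move=> [b k] [b' k'] /= same.
  have [eta [uA _ _]] := crit b k; have [eta' [wA _ _]] := crit b' k'.
  have [z [theta [hth e_th]]] := same_flow_phases uA wA same.
  have th0 : theta = 0 by apply/eqP/negPn/negP => /eqP/hth/fn0.
  have {}e_th i : phase (us b' k') i = phase (us b k) i + 2 * pi * (z 0 i)%:~R.
    by rewrite e_th th0 mulr0 addr0.
  have bb : b = b'.
    apply: extend_bits_inj => i ri.
    case: uA => _ _ _ /(_ i ri) hu; case: wA => _ _ _ /(_ i ri) hw.
    exact: bit_angle_near hu hw (e_th i).
  move: e_th; rewrite -bb => e_th; congr (_, _).
  by have [_ inj] := us_sol b; apply/esym/(inj k' k (fun i => z 0 i)) => i; exact: e_th.
Qed.

(** All links but one, of odd rotation number, have a free phase in [{0, pi}]. *)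
Lemma free_solutions_count : prime_vector v -> ae_zero f ->
  (`I_(2 ^ N.-1) #<= distinct_rotational_solutions m l g f v T)%card.
Proof.
move=> v_prime f0.
have [i [j [x [y xy]]]] := prime_vector_combination v_prime.
have [i0 [h odd0]] := combination_odd_coord xy.
pose bits := {ffun {i | i != i0} -> bool}.
have [U U_sol] := boolp.choice (fun b : bits =>
  let: ex_intro2 u uS ub := reversible_solutions f0
    (fun i => ex_intro (fun n : int => bit_angle (extend_bits b i) = pi * n%:~R :> R) _
      (bit_angleE (extend_bits b i))) in
  ex_intro (fun u => stationary T mean_speed (fun i => a i) fluct_size
      (fun i => bit_angle (extend_bits b i)) c impulse resting B LF u /\
    forall i, phase u i = bit_angle (extend_bits b i)) u (conj uS ub)).
apply: (@distinct_solutions_ge _ _ _ _ _ _ _ _ bits (fun b => flow (U b))).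
- by rewrite card_ffun card_bool card_sig cardC1 card_ord.
- by move=> b; have [uS _] := U_sol b; exact: stationary_rotational uS.
- move=> b b' same.
  have [[eta [uA _ _]] ub] := U_sol b; have [[eta' [wA _ _]] wb] := U_sol b'.
  have [k [theta [_ e_th]]] := same_flow_phases uA wA same.
  pose bz (b : bits) : 'rV[int]_N := \row_i (extend_bits b i : int).
  have pi0 : pi != 0 :> R by rewrite gt_eqF // pi_gt0.
  have e_bits i' : (bz b' 0 i')%:~R =
      (bz b 0 i')%:~R + (v 0 i')%:~R * (2 * theta / T) + 2 * (k 0 i')%:~R :> R.
    apply: (mulfI pi0); have := e_th i'.
    rewrite ub wb !bit_angleE !mxE /mean_speed => ->; ring.
  have b0 : bz b 0 i0 = bz b' 0 i0.
    by rewrite !mxE /extend_bits insubF ?eqxx.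
  have [w hw] := half_period_parity xy odd0 e_bits b0.
  apply: extend_bits_inj => i' _; have := hw i'; rewrite !mxE.
  exact: eq_bits_parity.
Qed.

End Forced_pendulum.

(** * Choice of the parameters *)

Lemma count_free_le (N N0 : nat) : (1 <= N0 <= N - 1)%N -> ((N - N0) * 2 ^ N0 <= 2 ^ N.-1)%N.
Proof.
move=> /andP[N01 N0N].
have := ltn_expl (N - N0).-1 (isT : (1 < 2)%N).
have -> : N.-1 = ((N - N0).-1 + N0)%N by lia.
rewrite expnD leq_mul2r; lia.
Qed.

Lemma mean_speed_bound (R : realType) (N : nat) (v : 'rV[int]_N) (T : R) i :
  1 / 128 <= T -> `|mean_speed T v i| <= 256 * pi * `|(v 0 i)%:~R|.
Proof.
move=> T1; have T0 : 0 < T by lra.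
have p0 : 0 < 2 * pi :> R by rewrite mulr_gt0 ?pi_gt0.
rewrite /mean_speed !normrM (gtr0_norm (_ : 0 < T^-1)) ?invr_gt0 // ler_pdivrMr //.
rewrite -normrM gtr0_norm //; move: `|_| (normr_ge0 ((v 0 i)%:~R : R)) => x x0.
have -> : 256 * pi * x * T = 2 * pi * x * (128 * T) by ring.
by rewrite ler_peMr; [|rewrite mulr_ge0 // ltW|lra].
Qed.

Theorem theorem2 (R : realType) (N : nat) (g : R) (v : 'rV[int]_N) (N0 : nat)
    (M0 : R)
    (g_gt0 : 0 < g)
    (v_prime : prime_vector v)
    (N0_def : N0 = #|[pred i : 'I_N | v ord0 i == 0]|)
    (M0_gt0 : 0 < M0)
    (N0_bounds : (1 <= N0 <= N - 1)%N) :
  exists (m l : 'I_N -> R) (T1 T2 : R),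
    [/\ forall j, 0 < m j,
        forall j, 0 < l j,
        0 < T1, T1 < T2 &
        forall (T : R) (f : R -> 'rV[R]_N),
          T1 <= T <= T2 ->
          L2_periodic T f ->
          (forall i, \int[lebesgue_measure]_(t in `[0, T]) f t ord0 i = 0) ->
          (forall t, eucl_norm (f t) <= M0) ->
          (~ ae_zero f ->
             `I_((N - N0 + 1) * 2 ^ N0)
               #<= distinct_rotational_solutions m l g f v T) /\
          (ae_zero f ->
             `I_((N - N0) * 2 ^ N0)
               #<= distinct_rotational_solutions m l g f v T)].
Proof.
(* [B] bounds the angular velocities, in view of [mean_speed_bound] *)
have [B B_ge1 B_le] : exists2 B : R, 1 <= B &
    forall i, 1 + 256 * pi * `|(v 0 i)%:~R| <= B.
  have p0 : 0 <= 256 * pi :> R := mulr_ge0 (ler0n _ _) (pi_ge0 R).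
  have s0 : 0 <= \sum_i `|(v 0 i)%:~R : R| by apply: sumr_ge0.
  exists (1 + 256 * pi * \sum_i `|(v 0 i)%:~R|); first by rewrite lerDl mulr_ge0.
  by move=> i; rewrite lerD2l ler_wpM2l // (bigD1 i) //= lerDl sumr_ge0.
have [eps [eps_gt0 eps_le1 eps_small]] : exists eps : R,
    [/\ 0 < eps, eps <= 1 & 2000 * B ^+ 3 * eps <= 1].
  have B3 : 1 <= 2000 * B ^+ 3 by have := exprn_ege1 3 B_ge1; lra.
  have B0 := lt_le_trans ltr01 B3.
  exists (2000 * B ^+ 3)^-1; split; first by rewrite invr_gt0.
    by rewrite invf_le1.
  by rewrite (divff (lt0r_neq0 B0)).
have al_gt0 (i : 'I_N) : 0 < alpha (bob_mass g M0 eps) i.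
  by rewrite alpha_bob_mass; exact: tail_mass_gt0.
have l_gt0 (i : 'I_N) : 0 < rod_length g eps i by exact: rod_length_gt0.
have a_le1 (i : 'I_N) : g / rod_length g eps i <= 1.
  exact: gravity_ratio_le1.
exists (bob_mass g M0 eps), (rod_length g eps), (1 / 128), (1 / 64).
split; [exact: bob_mass_gt0|exact: l_gt0|by rewrite divr_gt0| |].
  by rewrite ltr_pM2l // ltf_pV2 ?posrE // ltr_nat.
move=> T f /andP[T1 T2] f_per f_mean f_le.
have T_gt0 : 0 < T by lra.
have mean_speed_le i : `|mean_speed T v i| + 1 <= B.
  apply: le_trans (B_le i); rewrite addrC lerD2l; exact: mean_speed_bound.
have restE : #|[pred i | resting v i]| = N0 by rewrite N0_def.
have rotE : #|[pred i | ~~ resting v i]| = (N - N0)%N.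
  have e : (N0 + #|[pred i | ~~ resting v i]|)%N = N.
    by rewrite -restE; exact: etrans (cardC _) (card_ord N).
  by rewrite -(addKn N0 #|_|) e.
have rot_gt0 : (0 < N - N0)%N by clear - N0_bounds; lia.
split=> hf.
  have := forced_solutions_count g_gt0 al_gt0 l_gt0 a_le1
    (coupling_sum_small g_gt0 M0_gt0 eps_gt0 eps_le1)
    (coupling_sum_sqr_small g_gt0 M0_gt0 eps_gt0 eps_le1)
    (forcing_small g_gt0 M0_gt0 eps_gt0 eps_le1)
    M0_gt0 T_gt0 T2 eps_gt0 eps_small mean_speed_le f_per f_mean f_le hf.
  by rewrite rotE restE; apply.
apply: card_le_trans (free_solutions_count g_gt0 al_gt0 l_gt0 a_le1
    (coupling_sum_small g_gt0 M0_gt0 eps_gt0 eps_le1)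
    (coupling_sum_sqr_small g_gt0 M0_gt0 eps_gt0 eps_le1)
    (forcing_small g_gt0 M0_gt0 eps_gt0 eps_le1)
    M0_gt0 T_gt0 T2 eps_gt0 eps_small mean_speed_le f_per f_mean f_le v_prime hf).
by rewrite card_le_II; exact: count_free_le.
Qed.
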